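(* Let $d\in\mathbb N$, $\Omega=\mathbb T^d$, suppose $A\in\mathrm{SL}(d,\mathbb Z)$ is such that no eigenvalue of $A$ is a root of unity, let $T_{A,0}:\mathbb T^d\to\mathbb T^d$ be $T_{A,0}\,\omega=A\omega$, and let $\mu$ denote Lebesgue measure. Then $$\mathfrak A(\Omega,T_{A,0},\mu)=\mathbb Z.$$ Consequently, for every $f\in C(\Omega,\mathbb R)$, $\Sigma_{\mu,f}$ is an interval.
   Context: $\mathbb T=\mathbb R/\mathbb Z$, $\mathbb T^d=\mathbb R^d/\mathbb Z^d$. Under the eigenvalue assumption, $\mu$ is $T_{A,0}$-ergodic. For $T=T_{A,0}$, $f\in C(\Omega,\mathbb R)$ and $\omega\in\Omega$, $H_{f,\omega}$ acts on $\ell^2(\mathbb Z)$ by $[H_{f,\omega}\psi](n)=\psi(n-1)+\psi(n+1)+f(T^n\omega)\psi(n)$, and $\Sigma_{\mu,f}\subseteq\mathbb R$ is the compact set with $\sigma(H_{f,\omega})=\Sigma_{\mu,f}$ for $\mu$-a.e. $\omega$ (it exists by ergodicity). For a compact metric space $\Omega$, homeomorphism $T:\Omega\to\Omega$ and $T$-ergodic Borel probability measure $\mu$: the suspension is $X=(\Omega\times\mathbb R)/\!\sim$, where $(\omega,t)\sim(\omega',t')$ iff $(\omega',t')=(T^n\omega,t-n)$ for some $n\in\mathbb Z$, with classes $[\omega,t]$, flow $\overline T^{t}[\omega,s]=[\omega,s+t]$, and $\overline T$-ergodic measure $\overline\mu$ given by $\int_X g\,d\overline\mu=\int_0^1\int_\Omega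 g[\omega,s]\,d\mu(\omega)\,ds$. $C^\sharp(X,\mathbb T)$ is the group of homotopy classes of continuous maps $X\to\mathbb T$ (pointwise addition). For $\phi\in C(X,\mathbb T)$, $x\in X$, let $\widetilde\phi_x:\mathbb R\to\mathbb R$ be a continuous lift of $t\mapsto\phi(\overline T^{t}x)$. For $\overline\mu$-a.e. $x$, $\lim_{t\to\infty}\widetilde\phi_x(t)/t$ exists and equals a constant depending only on $[\phi]$, denoted $\mathfrak A_{\overline\mu}([\phi])$ (the Schwartzman homomorphism). $\mathfrak A(\Omega,T,\mu)=\mathfrak A_{\overline\mu}(C^\sharp(X,\mathbb T))\subseteq\mathbb R$ is its range. *)

(* Defs.v *)
From HB Require Import structures.
From mathcomp Require Import all_boot all_order all_algebra.
From mathcomp Require Import generic_quotient.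
From mathcomp Require Import complex.
From mathcomp Require Import all_classical all_reals all_analysis.
Import Order.TTheory GRing.Theory Num.Theory.
Import numFieldNormedType.Exports.
Set Implicit Arguments.
Unset Strict Implicit.
Unset Printing Implicit Defensive.

Local Open Scope classical_set_scope.
Local Open Scope ring_scope.
Local Open Scope quotient_scope.
Local Open Scope complex_scope.

Section Circle.
Variable R : realType.

Definition circle_rel (x y : R) : bool := `[< exists k : int, y = x + k%:~R >].

Lemma circle_rel_refl : reflexive circle_rel.
Proof. by move=> x; apply/asboolP; exists 0; rewrite addr0. Qed.

Lemma circle_rel_sym : symmetric circle_rel.
Proof.
suff H x y : circle_rel x y -> circle_rel y x.
  by move=> x y; apply/idP/idP; exact: H.
move=> /asboolP[k ->]; apply/asboolP; exists (- k).
by rewrite rmorphN /= addrK.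
Qed.

Lemma circle_rel_trans : transitive circle_rel.
Proof.
move=> y x z /asboolP[k ->] /asboolP[l ->]; apply/asboolP; exists (k + l).
by rewrite rmorphD /= addrA.
Qed.

Canonical circle_equiv :=
  EquivRel circle_rel circle_rel_refl circle_rel_sym circle_rel_trans.

Definition circle := quotient_topology {eq_quot circle_equiv}.

Definition circle_pi (x : R) : circle := \pi_circle x.

End Circle.

Section Torus.
Variables (R : realType) (d : nat).

Definition torus_rel (x y : 'cV[R]_d) : bool :=
  `[< exists k : 'cV[int]_d, y = x + map_mx intr k >].

Lemma torus_rel_refl : reflexive torus_rel.
Proof. by move=> x; apply/asboolP; exists 0; rewrite map_mx0 addr0. Qed.

Lemma torus_rel_sym : symmetric torus_rel.
Proof.
suff H x y : torus_rel x y -> torus_rel y x.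
  by move=> x y; apply/idP/idP; exact: H.
move=> /asboolP[k ->]; apply/asboolP; exists (- k).
by rewrite map_mxN addrK.
Qed.

Lemma torus_rel_trans : transitive torus_rel.
Proof.
move=> y x z /asboolP[k ->] /asboolP[l ->]; apply/asboolP; exists (k + l).
by rewrite map_mxD addrA.
Qed.

Canonical torus_equiv :=
  EquivRel torus_rel torus_rel_refl torus_rel_sym torus_rel_trans.

Definition torus := quotient_topology {eq_quot torus_equiv}.

Definition torus_pi (x : 'cV[R]_d) : torus := \pi_torus x.

End Torus.

Section TorusMap.
Variables (R : realType) (d : nat).
Local Notation torus := (torus R d).

Lemma torus_piP (x y : 'cV[R]_d) :
  torus_pi x = torus_pi y <-> exists k : 'cV[int]_d, y = x + map_mx intr k.
Proof.
split=> [/(@eqquotP _ (torus_equiv R d))/asboolP //|xy].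
by apply/(@eqquotP _ (torus_equiv R d)); exact/asboolP.
Qed.

Lemma torus_pi_repr (x : torus) : torus_pi (repr x) = x.
Proof. exact: reprK. Qed.

Definition torus_map (B : 'M[int]_d) (x : torus) : torus :=
  torus_pi (map_mx intr B *m repr x).

Lemma torus_map_pi B v : torus_map B (torus_pi v) = torus_pi (map_mx intr B *m v).
Proof.
rewrite /torus_map; apply/torus_piP.
have [k e] := (torus_piP (repr (torus_pi v)) v).1 (torus_pi_repr _).
by exists (B *m k); rewrite {1}e mulmxDr map_mxM.
Qed.

Lemma torus_map_comp B C x : torus_map B (torus_map C x) = torus_map (B *m C) x.
Proof. by rewrite {2}/torus_map torus_map_pi mulmxA -map_mxM. Qed.

Lemma torus_map1 x : torus_map 1%:M x = x.
Proof. by rewrite /torus_map map_mx1 mul1mx torus_pi_repr. Qed.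

Lemma continuous_mulmxl (M : 'M[R]_d) : continuous (fun v : 'cV[R]_d => M *m v).
Proof.
move=> v U [P vP PU].
pose Q (ij : 'I_d * 'I_1) w := P ij.1 ij.2 ((M *m w) ij.1 ij.2).
have : \forall w \near v, forall ij, Q ij w.
  have Fv : Filter (nbhs v) by exact: nbhs_filter.
  apply: (filter_forall (f := Q) Fv).
  move=> [i j] /=.
  suff : (fun w : 'cV[R]_d => (M *m w) i j) @ v --> (M *m v) i j.
    by apply; exact: vP.
  rewrite mxE; under eq_fun do rewrite mxE.
  apply: cvg_big => [|k _]; first exact: add_continuous.
  apply: cvgMr; exact: coord_continuous.
by apply: filterS => w Pw; apply: PU => i j; exact: (Pw (i, j)).
Qed.

Lemma torus_map_continuous B : continuous (torus_map B).
Proof.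
apply/quotient_continuous.
rewrite (_ : _ \o _ = @torus_pi R d \o (fun v => map_mx intr B *m v)); last first.
  by apply/funext => v; exact: torus_map_pi.
move=> v; apply: continuous_comp; first exact: continuous_mulmxl.
exact: pi_continuous.
Qed.

End TorusMap.

Record homeomorphism (X : topologicalType) := Homeomorphism {
  hfun :> X -> X;
  hinv : X -> X;
  hfunK : cancel hfun hinv;
  hinvK : cancel hinv hfun;
  hfun_continuous : continuous hfun;
  hinv_continuous : continuous hinv }.

Definition hpow (X : topologicalType) (T : homeomorphism X) (n : int) : X -> X :=
  match n with
  | Posz k => iter k T
  | Negz k => iter k.+1 (hinv T)
  end.

Section HPow.
Variables (X : topologicalType) (T : homeomorphism X).

Lemma hpow0 x : hpow T 0 x = x. Proof. by []. Qed.

Lemma hpowS n x : hpow T (n + 1) x = T (hpow T n x).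
Proof.
case: n => [k|[|k]]; first by rewrite -PoszD addn1.
  exact/esym/hinvK.
have -> : Negz k.+1 + 1 = Negz k.
  by rewrite !NegzE -[k.+2]addn1 PoszD opprD addrNK.
exact/esym/hinvK.
Qed.

Lemma hpowB1 n x : hpow T (n - 1) x = hinv T (hpow T n x).
Proof. by rewrite -[in RHS](subrK 1 n) hpowS hfunK. Qed.

Lemma hpowD m n x : hpow T (m + n) x = hpow T m (hpow T n x).
Proof.
elim: m => [|m IH|m IH]; first by rewrite add0r.
  by rewrite intS [1 + _]addrC addrAC !hpowS IH.
by rewrite intS opprD [-1 + _]addrC addrAC !hpowB1 IH.
Qed.

End HPow.

Section ToralAutomorphism.
Variables (R : realType) (d : nat) (A : 'M[int]_d) (hA : \det A = 1).

Lemma toral_autK : cancel (@torus_map R d A) (torus_map (\adj A)).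
Proof. by move=> x; rewrite torus_map_comp mul_adj_mx hA torus_map1. Qed.

Lemma toral_aut_invK : cancel (@torus_map R d (\adj A)) (torus_map A).
Proof. by move=> x; rewrite torus_map_comp mul_mx_adj hA torus_map1. Qed.

Definition toral_aut : homeomorphism (torus R d) :=
  Homeomorphism toral_autK toral_aut_invK
    (@torus_map_continuous R d A) (@torus_map_continuous R d (\adj A)).

End ToralAutomorphism.

Definition borel (X : ptopologicalType) := g_sigma_algebraType (@open X).

Section LebesgueTorus.
Variable R : realType.
Local Notation mR := (measurableTypeR R).

Definition tcons n (p : mR * n.-tuple mR) : n.+1.-tuple mR := [tuple of p.1 :: p.2].

Lemma measurable_tcons n : measurable_fun setT (@tcons n).
Proof. exact: measurable_cons. Qed.

HB.instance Definition _ n :=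
  isMeasurableFun.Build _ _ _ _ (@tcons n) (@measurable_tcons n).

(* the product of d copies of Lebesgue measure on [0, 1] *)
Fixpoint cube_measure (d : nat) : probability (d.-tuple mR) R :=
  if d is n.+1 then
    distribution (uniform_prob (@ltr01 R) \x cube_measure n)%E (@tcons n)
  else \d_ [tuple].

Variable d : nat.

Definition cube_proj (t : d.-tuple mR) : borel (torus R d) :=
  torus_pi (\col_i tnth t i).

Lemma measurable_open_col (U : set 'cV[R]_d) : open U ->
  measurable [set t : d.-tuple mR | U (\col_i tnth t i)].
Proof.
move=> oU.
pose box (q : {ffun 'I_d -> rat * rat}) : set 'cV[R]_d :=
  [set v | forall i, v i 0 \in `](ratr (q i).1), (ratr (q i).2)[].
pose F (q : {ffun 'I_d -> rat * rat}) : set (d.-tuple mR) :=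
  [set t | box q `<=` U /\ box q (\col_i tnth t i)].
rewrite (_ : [set t | _] = \bigcup_q F q); last first.
  apply/seteqP; split=> t /=; last by move=> [q _ [qU qt]]; exact: qU.
  move=> Ut; have [P vP PU] : nbhs (\col_i tnth t i) U by exact: open_nbhs_nbhs.
  have Q i : exists q : rat * rat,
      (tnth t i \in `](ratr q.1), (ratr q.2)[) /\
      [set` `](ratr q.1 : R), (ratr q.2)[] `<=` P i 0.
    have := vP i 0; rewrite mxE => /nbhs_ballP[e /= e0 eP].
    have [q1] : exists q, ratr q \in `](tnth t i - e), (tnth t i)[.
      by apply: rat_in_itvoo; rewrite ltrBlDr ltrDl.
    have [q2] : exists q, ratr q \in `](tnth t i), (tnth t i + e)[.
      by apply: rat_in_itvoo; rewrite ltrDl.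
    rewrite !in_itv /= => /andP[t2 e2] /andP[e1 t1]; exists (q1, q2) => /=.
    rewrite in_itv /= t1 t2; split=> // y; rewrite /= in_itv /= => /andP[y1 y2].
    apply: eP; rewrite /ball /= ltr_distlC.
    by rewrite (lt_trans e1 y1) (lt_trans y2 e2).
  exists [ffun i => projT1 (cid (Q i))] => //; split=> [v bv|i].
    apply: PU => i j; rewrite ord1; have := bv i; rewrite ffunE.
    by case: cid => q /= [_ qP]; exact: qP.
  by rewrite ffunE mxE; case: cid => q /= [].
apply: countable_bigcupT_measurable; first exact: countableP.
move=> q; have [qU|qU] := pselect (box q `<=` U); last first.
  by rewrite (_ : F q = set0) // -subset0 => t [].
rewrite (_ : F q = \big[setI/setT]_(i < d)
    [set t | tnth t i \in `](ratr (q i).1), (ratr (q i).2)[]); last first.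
  rewrite -bigcap_seq; apply/seteqP; split=> t /= => [[_ qt] i _ /=|qt].
    by have := qt i; rewrite mxE.
  by split=> // i; rewrite mxE; apply: (qt i); rewrite /= mem_index_enum.
apply: bigsetI_measurable => i _.
have := @measurable_tnth _ mR d i measurableT
  `](ratr (q i).1), (ratr (q i).2)[%classic (measurable_itv _).
by rewrite setTI; exact.
Qed.

Lemma measurable_cube_proj : measurable_fun setT cube_proj.
Proof.
apply: (@measurability _ _ _ (borel (torus R d)) _ _ (@open (torus R d))) => //.
move=> _ [U oU <-].
rewrite setTI.
exact: (@measurable_open_col (@torus_pi R d @^-1` U) oU).
Qed.

HB.instance Definition _ :=
  isMeasurableFun.Build _ _ _ _ cube_proj measurable_cube_proj.

Definition torus_lebesgue : probability (borel (torus R d)) R :=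
  distribution (cube_measure d) cube_proj.

End LebesgueTorus.

Section Suspension.
Variables (R : realType) (Omega : ptopologicalType) (T : homeomorphism Omega).

Definition susp_rel (p q : Omega * R) : bool :=
  `[< exists n : int, q = (hpow T n p.1, p.2 - n%:~R) >].

Lemma susp_rel_refl : reflexive susp_rel.
Proof. by move=> [w t]; apply/asboolP; exists 0; rewrite subr0. Qed.

Lemma susp_rel_sym : symmetric susp_rel.
Proof.
suff H p q : susp_rel p q -> susp_rel q p.
  by move=> p q; apply/idP/idP; exact: H.
move=> /asboolP[n ->]; apply/asboolP; exists (- n) => /=.
by rewrite -hpowD addNr hpow0 rmorphN /= opprK subrK; case: p.
Qed.

Lemma susp_rel_trans : transitive susp_rel.
Proof.
move=> q p r /asboolP[n ->] /asboolP[m ->]; apply/asboolP; exists (m + n) => /=.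
by rewrite hpowD rmorphD /= opprD addrA addrAC.
Qed.

Canonical susp_equiv :=
  EquivRel susp_rel susp_rel_refl susp_rel_sym susp_rel_trans.

Definition suspension := quotient_topology {eq_quot susp_equiv}.

Definition susp_pi (w : Omega) (t : R) : suspension := \pi_suspension (w, t).

HB.instance Definition _ := Topological.on suspension.
HB.instance Definition _ := isPointed.Build suspension (susp_pi point 0).

Definition susp_flow (t : R) (x : suspension) : suspension :=
  susp_pi (repr x).1 ((repr x).2 + t).

Lemma susp_flow_pi t w s : susp_flow t (susp_pi w s) = susp_pi w (s + t).
Proof.
rewrite /susp_flow; set x := susp_pi w s.
have : susp_rel (repr x) (w, s).
  by apply/(@eqquotP _ susp_equiv suspension); rewrite reprK.
move=> /asboolP[n [-> ->]].
apply/(@eqquotP _ susp_equiv suspension)/asboolP; exists n => /=.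
by rewrite addrAC.
Qed.

(* the defining formula int_X g = int_0^1 int_Omega g[w, s] dmu(w) ds,
   taken at indicator functions g of Borel sets *)
Definition susp_measure (mu : set (borel Omega) -> \bar R)
    (B : set (borel suspension)) : \bar R :=
  (\int[lebesgue_measure]_(s in `[0%R, 1%R]) mu [set w | B (susp_pi w s)])%E.

End Suspension.

Section Schwartzman.
Variable R : realType.

Definition homotopic (X Y : topologicalType) (f g : X -> Y) : Prop :=
  exists h : R * X -> Y,
    [/\ {within `[0, 1]%classic `*` [set: X], continuous h},
        forall x, h (0, x) = f x & forall x, h (1, x) = g x].

Definition homotopy_class (X Y : topologicalType) (f : X -> Y) : set (X -> Y) :=
  [set g | continuous g /\ homotopic f g].

Definition Csharp (X : topologicalType) : set (set (X -> circle R)) :=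
  [set homotopy_class phi | phi in [set phi : X -> circle R | continuous phi]].

Variables (Omega : ptopologicalType) (T : homeomorphism Omega).
Variable mu : set (borel Omega) -> \bar R.
Local Notation X := (suspension R T).

Definition orbit_lift (phi : X -> circle R) (x : X) (u : R -> R) : Prop :=
  continuous u /\ forall t, circle_pi (u t) = phi (susp_flow t x).

Definition is_rotation_number (phi : X -> circle R) (a : R) : Prop :=
  {ae susp_measure mu, forall x : borel X,
    exists2 u, orbit_lift phi x u & u t / t @[t --> +oo] --> a}.

(* 0 is a junk value for a class without rotation number; constant maps have
   rotation number 0, so it cannot enlarge the range *)
Definition schwartzman (c : set (X -> circle R)) : R :=
  xget 0 [set a | forall phi, c phi -> is_rotation_number phi a].

Definition schwartzman_range : set R := schwartzman @` @Csharp X.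

End Schwartzman.

Section Spectrum.
Variable R : realType.
Local Notation C := R[i].
Local Notation seqZ := (int -> C).

Definition l2norm2 (psi : seqZ) : \bar R :=
  (\esum_(n in [set: int]) (Normc.normc (psi n) ^+ 2)%:E)%E.

Definition l2 : set seqZ := [set psi | (l2norm2 psi < +oo)%E].

Definition bounded_operator (B : seqZ -> seqZ) : Prop :=
  [/\ forall psi, l2 psi -> l2 (B psi),
      forall (a : C) phi psi, l2 phi -> l2 psi ->
        B (fun n => a * phi n + psi n) = (fun n => a * B phi n + B psi n)
    & exists M : R, forall psi, l2 psi ->
        (l2norm2 (B psi) <= M%:E * l2norm2 psi)%E].

Definition l2_invertible (L : seqZ -> seqZ) : Prop :=
  exists2 B, bounded_operator B &
    forall psi, l2 psi -> L (B psi) = psi /\ B (L psi) = psi.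

Definition spectrum (H : seqZ -> seqZ) : set C :=
  [set z | ~ l2_invertible (fun psi n => H psi n - z * psi n)].

Variables (Omega : ptopologicalType) (T : homeomorphism Omega) (f : Omega -> R).

Definition schrodinger (w : Omega) (psi : seqZ) : seqZ := fun n =>
  psi (n - 1) + psi (n + 1) + (f (hpow T n w))%:C * psi n.

Definition is_ae_spectrum (mu : set (borel Omega) -> \bar R) (S : set R) : Prop :=
  compact S /\
  {ae mu, forall w : borel Omega, spectrum (schrodinger w) = real_complex R @` S}.

End Spectrum.

(* Main.v *)
(* Let V be the space of column vectors. A continuous map from the suspension to
   the circle pulls back along (v, t) |-> [v, t] to a map on the contractible space
   V x R, hence lifts to F with F(v, t + 1) = F(Av, t) + n for an integer n. The
   increments F(v + k, t) - F(v, t) define an additive function of k invariant under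
   A, which vanishes because 1 is not an eigenvalue of A. Thus F is periodic in v,
   bounded for t in [0, 1], and t |-> F(v, t) has slope n at infinity for every v, not
   just almost every one.

   Let E be outside the spectrum. The Green function of H_w - E depends continuously
   on w, and its tail at -oo spans a line in R^2 which depends continuously on w and is
   invariant under the transfer matrices. Joining these matrices to the identity by
   a rotation followed by a shear, the same lifting argument gives a bounded periodic
   angle Phi for this line, which the transfer matrices map to Phi o A up to a fixed
   multiple j of pi. Following Phi along a recurrent orbit, boundedness forces
   rho = cot Phi to be finite, nonzero and of constant sign. By the Riccati equation
   rho(T w) + 1 / rho(w) = E - f(w), the form <phi, (E - H_w) phi> is a sum of
   squares weighted by rho, so all the spectra lie on the same side of E.

   Almost every orbit is recurrent: the characters exp(2 pi i k.v), k != 0, have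
   infinite orbits under A^T because no eigenvalue is a root of unity, so the
   translates of a trigonometric polynomial along an orbit are nearly uncorrelated and
   its time averages over M steps have variance O(1 / M). *)
From HB Require Import structures.
Require Import Defs.
From mathcomp Require Import all_boot all_order all_algebra.
From mathcomp Require Import generic_quotient complex ring lra zify.
From mathcomp Require Import all_classical all_reals all_analysis.
From mathcomp Require Import measurable_realfun.
Import Order.TTheory GRing.Theory Num.Theory.
Import numFieldNormedType.Exports.
Set Implicit Arguments.
Unset Strict Implicit.
Unset Printing Implicit Defensive.

Local Open Scope classical_set_scope.
Local Open Scope ring_scope.

(** * Continuous angles and lifts *)

Section Polar.
Variable R : realType.
Implicit Types x y a : R.

(** The usual route from the first claim to the second is gap labelling: in a gap the density of
    states takes a value in the range intersected with [0, 1], hence 0 or 1. Here the integer [j]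
    replaces that label and no density of states is constructed: [j >= 0] leads to energies above
    all spectra, [j <= -1] to energies below them. A priori an invariant line over the torus has no
    continuous nonvanishing section. It is therefore given by two parallel vectors that never vanish
    together, and what is lifted is twice its angle; this is why the periods are multiples of [pi].
    Spectral theory enters through one estimate, [c * |phi|^2 <= |(H - E) phi|^2] for finitely
    supported real [phi]. For fixed [phi] it involves finitely many sites, so it passes to limits of
    orbits. By the symmetry of [H] it gives invertibility through a Neumann series whose constants
    do not depend on the base point, which also yields the continuity of the Green function. *)

Definition polar x y a := exists2 r, 0 < r & x = r * cos a /\ y = r * sin a.

Lemma cos_sinD2piz a (k : int) :
  cos (a + k%:~R * (pi *+ 2)) = cos a /\ sin (a + k%:~R * (pi *+ 2)) = sin a.
Proof.
have H b (n : nat) : cos (b + n%:R * (pi *+ 2)) = cos b /\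
    sin (b + n%:R * (pi *+ 2)) = sin b :> R.
  by rewrite mulr_natl (periodicn (@cosD2pi R)) (periodicn (@sinD2pi R)).
case: k => n; first exact: H.
have [<- <-] := H (a + (Negz n)%:~R * (pi *+ 2)) n.+1.
by rewrite -addrA -mulrDl NegzE rmorphN /= addNr mul0r addr0.
Qed.

Lemma polar_exists x y : (x != 0) || (y != 0) -> exists a, polar x y a.
Proof.
move=> xy0; pose r := Num.sqrt (x ^+ 2 + y ^+ 2).
have s0 : 0 < x ^+ 2 + y ^+ 2.
  by rewrite lt_def addr_ge0 ?sqr_ge0// paddr_eq0 ?sqr_ge0// !sqrf_eq0 negb_and xy0.
have r0 : 0 < r by rewrite sqrtr_gt0.
have rr : r ^+ 2 = x ^+ 2 + y ^+ 2 by rewrite sqr_sqrtr// ltW.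
have xr : -1 <= x / r <= 1.
  rewrite -ler_norml normrM normfV (gtr0_norm r0) ler_pdivrMr// mul1r.
  rewrite -[r]ger0_norm ?(ltW r0)// -ler_sqr ?nnegrE//.
  by rewrite !real_normK ?num_real// rr lerDl sqr_ge0.
have sE : sin (acos (x / r)) = `|y| / r.
  rewrite sin_acos// -[RHS]ger0_norm ?divr_ge0 ?(ltW r0)// -sqrtr_sqr.
  congr Num.sqrt; rewrite !expr_div_n real_normK ?num_real//.
  by rewrite rr; field; rewrite gt_eqF.
have cE : cos (acos (x / r)) = x / r by rewrite acosK.
have [y0|y0] := leP 0 y.
  exists (acos (x / r)), r => //; rewrite cE sE ger0_norm//.
  by split; field; rewrite gt_eqF.
exists (- acos (x / r)), r => //; rewrite cosN sinN cE sE ltr0_norm//.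
by split; field; rewrite gt_eqF.
Qed.

Lemma sin_eq0 a : sin a = 0 -> exists k : int, a = k%:~R * pi.
Proof.
move=> sa; pose k := Num.floor (a / pi); exists k.
have p0 := pi_gt0 R.
have /andP[k1 k2] := floor_itv (a / pi).
pose b := a - k%:~R * pi.
have sb : sin b = 0.
  have H (n : nat) c : sin (c + n%:R * pi) = (-1) ^+ n * sin c :> R.
    by rewrite mulr_natl (alternatingn (@sinDpi R)).
  rewrite /b; case: k {k1 k2 b} => n.
    move: sa; rewrite -{1}[a](subrK (n%:R * pi)) H => /eqP.
    by rewrite mulf_eq0 signr_eq0 => /eqP.
  by rewrite NegzE mulrNz mulNr opprK H sa mulr0.
have b0 : 0 <= b by rewrite subr_ge0 -ler_pdivlMr.
have b1 : b < pi by rewrite ltrBlDr -[X in X + _]mul1r -mulrDl addrC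
   -ltr_pdivrMr// -intrD1.
move: b0; rewrite le_eqVlt => /predU1P[b0|b0]; first by rewrite -[LHS](subrK (k%:~R * pi)) -/b -b0 add0r.
by have := @sin_gt0_pi _ b; rewrite b0 b1 => /(_ isT); rewrite sb ltxx.
Qed.

Lemma cos_eq1 a : cos a = 1 -> exists k : int, a = k%:~R * (pi *+ 2).
Proof.
move=> ca; have : sin (a / 2) = 0.
  apply/eqP; rewrite -sqrf_eq0; apply/eqP.
  have : cos (a / 2 *+ 2) = 1 by rewrite -mulr_natr divfK ?pnatr_eq0.
  by rewrite cos_mulr2n cos2sin2 => h; lra.
move=> /sin_eq0[k kE]; exists k; rewrite -[LHS](divfK (_ : 2 != 0)) ?pnatr_eq0//.
by rewrite kE -mulrA mulr_natr.
Qed.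

Lemma polar_uniq x y a b : polar x y a -> polar x y b ->
  exists k : int, b = a + k%:~R * (pi *+ 2).
Proof.
move=> [r r0 [-> ->]] [s s0 [e1 e2]].
have : r ^+ 2 = s ^+ 2.
  rewrite -[LHS]mulr1 -[RHS]mulr1 -{1}(cos2Dsin2 a) -(cos2Dsin2 b) !mulrDr.
  by rewrite -!exprMn e1 e2.
move=> /eqP; rewrite eqrXn2 ?(ltW r0) ?(ltW s0)// => /eqP rs.
move: e1 e2; rewrite -rs => /(mulfI (lt0r_neq0 r0)) e1 /(mulfI (lt0r_neq0 r0)) e2.
have /cos_eq1[k kE] : cos (b - a) = 1.
  by rewrite cosB -e1 -e2 -!expr2 cos2Dsin2.
by exists k; rewrite -kE addrC subrK.
Qed.

(** The signed angle from [(x, y)] to [(x', y')], as the arctangent of cross product over dot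
    product; this principal value is the right one when the dot product is positive. *)
Definition turn (x y x' y' : R) := atan ((x * y' - y * x') / (x * x' + y * y')).

Lemma polar_turn x y x' y' a : polar x y a -> 0 < x * x' + y * y' ->
  polar x' y' (a + turn x y x' y').
Proof.
move=> [r r0 [-> ->]]; set c := r * cos a; set s := r * sin a => d0.
have cs : c ^+ 2 + s ^+ 2 = r ^+ 2.
  by rewrite /c /s !exprMn -mulrDr cos2Dsin2 mulr1.
set t := turn _ _ _ _; have tc : 0 < cos t.
  by rewrite cos_atan invr_gt0 sqrtr_gt0 ltr_wpDr ?sqr_ge0.
have ts : sin t = cos t * ((c * y' - s * x') / (c * x' + s * y')).
  by rewrite -[X in _ = _ * X]atanK -/(turn _ _ _ _) -/t /tan mulrCA divff ?mulr1// gt_eqF.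
exists ((c * x' + s * y') / (r * cos t)).
  by rewrite divr_gt0 ?mulr_gt0.
rewrite cosD sinD ts.
have -> : cos a = c / r by rewrite /c; field; rewrite gt_eqF.
have -> : sin a = s / r by rewrite /s; field; rewrite gt_eqF.
have r2 : (c ^+ 2 + s ^+ 2) / r ^+ 2 = 1.
  by rewrite cs divff// expf_neq0// gt_eqF.
have n1 : c * x' + s * y' != 0 by rewrite gt_eqF.
have n2 : r != 0 by rewrite gt_eqF.
have n3 : cos t != 0 by rewrite gt_eqF.
split.
  transitivity (x' * ((c ^+ 2 + s ^+ 2) / r ^+ 2)); first by rewrite r2 mulr1.
  by field; rewrite n1 n2 n3.
transitivity (y' * ((c ^+ 2 + s ^+ 2) / r ^+ 2)); first by rewrite r2 mulr1.
by field; rewrite n1 n2 n3.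
Qed.

End Polar.

Section DiscreteValued.
Variable R : realType.

(** Otherwise the intermediate value theorem produces the value [(a + 1/2) * p], with [a * p] the
    smaller of the two end values. *)
Lemma continuous_discrete_path (g : R -> R) (p : R) : 0 < p ->
  (forall t, 0 <= t <= 1 -> {for t, continuous g}) ->
  (forall t, 0 <= t <= 1 -> exists k : int, g t = k%:~R * p) ->
  g 1 = g 0.
Proof.
move=> p0 gc gZ.
have gc' : {within `[0, 1], continuous g}.
  apply: continuous_in_subspaceT => t; rewrite inE/= in_itv/= => t01.
  exact: gc.
have [k0 e0] : exists k : int, g 0 = k%:~R * p by apply: gZ; rewrite lexx ler01.
have [k1 e1] : exists k : int, g 1 = k%:~R * p by apply: gZ; rewrite lexx ler01.
suff H (a b : int) : a < b -> Num.min (g 0) (g 1) = a%:~R * p ->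
    Num.max (g 0) (g 1) = b%:~R * p -> False.
  rewrite e0 e1; have [k01|k01|-> //] := ltgtP k0 k1.
    exfalso; apply: (H _ _ k01); rewrite e0 e1.
      by rewrite min_l// ler_pM2r// ler_int ltW.
    by rewrite max_r// ler_pM2r// ler_int ltW.
  exfalso; apply: (H _ _ k01); rewrite e0 e1.
    by rewrite min_r// ler_pM2r// ler_int ltW.
  by rewrite max_l// ler_pM2r// ler_int ltW.
move=> ab mE ME.
have [|t t01 gt] := @IVT _ g 0 1 ((a%:~R + 2^-1) * p) ler01 gc'.
  rewrite mE ME !ler_pM2r// lerDl invr_ge0 ler0n /=.
  have : a + 1 <= b by rewrite lezD1.
  rewrite -(ler_int R) intrD => h; lra.
have [k kE] := gZ t t01.
move: gt; rewrite kE => /(mulIf (lt0r_neq0 p0)) h.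
have : (2 * (k - a) = 1)%Z.
  apply: (@intr_inj R); rewrite rmorphM rmorphB /= h; lra.
lia.
Qed.

End DiscreteValued.

Lemma continuous_at_pair (Z U V : topologicalType) (f : Z -> U) (g : Z -> V) z :
  {for z, continuous f} -> {for z, continuous g} ->
  {for z, continuous (fun z => (f z, g z))}.
Proof. by move=> fc gc; exact: (cvg_pair fc gc). Qed.

Section Lifting.
Variables (R : realType) (W : topologicalType) (w0 : W) (c : R -> W -> W).
Hypothesis c_cont : continuous (fun p : R * W => c p.1 p.2).
Hypothesis c1 : forall w, c 1 w = w.
Hypothesis c0 : forall w, c 0 w = w0.
Variables X Y : W -> R.
Hypothesis Xc : continuous X.
Hypothesis Yc : continuous Y.
Hypothesis XY0 : forall w, (X w != 0) || (Y w != 0).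

Let dot t t' w := X (c t w) * X (c t' w) + Y (c t w) * Y (c t' w).

(** Cutting the contraction path into [M.+1] equal pieces makes consecutive vectors form acute
    angles, the range in which [turn] is exact. *)
Let small_steps (M : nat) w := forall t t', 0 <= t <= 1 ->
  `|t' - t| <= M.+1%:R^-1 -> 0 < dot t t' w.

Let comp_cont (Z : topologicalType) (V : W -> R) (Vc : continuous V)
    (f : Z -> R) (g : Z -> W) z :
  {for z, continuous f} -> {for z, continuous g} ->
  {for z, continuous (fun z => V (c (f z) (g z)))}.
Proof.
move=> fc gc; have fgc : {for z, continuous (fun z => (f z, g z))}.
  exact: continuous_at_pair.
apply: (@continuous_comp _ _ _ (fun z => c (f z) (g z)) V); last exact: Vc.
by apply: (@continuous_comp _ _ _ (fun z => (f z, g z)) (fun p => c p.1 p.2));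
  [exact: fgc|exact: c_cont].
Qed.

(** The dot product is positive on the diagonal [t = t'] and this is an open condition; compactness
    of [0, 1] gives one step size valid on a neighbourhood of [w1]. *)
Let small_steps_near (w1 : W) : exists M : nat, \forall w \near w1, small_steps M w.
Proof.
pose D (p : (R * R) * W) := dot p.1.1 p.1.2 p.2.
have Dc : continuous D.
  have H1 : continuous (fun p : (R * R) * W => p.1.1).
    by move=> p; apply: (@continuous_comp _ _ _ fst fst); exact: cvg_fst.
  have H2 : continuous (fun p : (R * R) * W => p.1.2).
    move=> p; apply: (@continuous_comp _ _ _ fst snd); [exact: cvg_fst|exact: cvg_snd].
  have H3 : continuous (fun p : (R * R) * W => p.2) by move=> p; exact: cvg_snd.
  move=> p; apply: cvgD; apply: cvgM.
  - exact: (@comp_cont _ X Xc (fun p => p.1.1) snd p (H1 p) (H3 p)).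
  - exact: (@comp_cont _ X Xc (fun p => p.1.2) snd p (H2 p) (H3 p)).
  - exact: (@comp_cont _ Y Yc (fun p => p.1.1) snd p (H1 p) (H3 p)).
  - exact: (@comp_cont _ Y Yc (fun p => p.1.2) snd p (H2 p) (H3 p)).
(* The second component of [i] is the step size: letting it tend to 0 together with [w] tending to
   [w1] puts the claim in the form of a near-covering of the compact interval. *)
pose P (i : W * R) t := forall t', `|t' - t| <= `|i.2| -> 0 < dot t t' i.1.

have h1 (t : R) : `[0, 1]%classic t ->
    \forall t' \near t & i \near (w1, 0 : R), P i t'.
  move=> _.
  have : 0 < D ((t, t), w1).
    rewrite /D /dot /= -!expr2 lt_def addr_ge0 ?sqr_ge0// paddr_eq0 ?sqr_ge0//.
    by rewrite !sqrf_eq0 negb_and XY0.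
  move=> /(lt_nbhsr) /(Dc ((t, t), w1)) [[/= A B] [[[A1 A2] /= [A1t A2t] A12] Bw] AB].
  have /nbhs_ballP[e /= e0 eA] : nbhs t (A1 `&` A2) by exact: filterI.
  have e20 : 0 < e / 2 by rewrite divr_gt0.
  exists (ball t (e / 2), B `*` ball 0 (e / 2)) => /=.
    split; first exact: nbhsx_ballx.
    by exists (B, ball 0 (e / 2)) => //=; split => //; exact: nbhsx_ballx.
  move=> [t1 [w d]] /= [tt1 [Bw' dd]] t2 /= t12.
  apply: (AB ((t1, t2), w)); split => //; apply: A12; split; apply eA => /=.
    by apply: (le_ball _ tt1); rewrite ler_pdivrMr// ler_peMr ?(ltW e0)// ler1n.
  move: tt1 dd; rewrite /ball /= sub0r normrN => tt1 dd.
  rewrite (_ : t - t2 = (t - t1) - (t2 - t1)); last by ring.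
  rewrite (le_lt_trans (ler_normB _ _))// [ltRHS]splitr ltrD//.
  exact: le_lt_trans t12 dd.
have [[/= B C] [Bw /nbhs_ballP[e /= e0 eC]] BC]  := (@compact_near_coveringP R `[0, 1]%classic).1
  (@segment_compact R 0 1) _ (nbhs (w1, 0 : R)) P (nbhs_filter _) h1.
have [M Me] : exists M, M.+1%:R^-1 < e.
  exists (Num.truncn e^-1); rewrite invf_plt ?posrE ?ltr0n//.
  by rewrite truncnS_gt.
exists M; apply: filterS Bw => w Bw t t' t01 tt'.
have wd : (B `*` C) (w, M.+1%:R^-1).
  by split => //; apply: eC; rewrite /ball /= sub0r normrN ger0_norm.
apply: (BC _ wd t) => /=; first by rewrite in_itv.
by rewrite [leRHS]ger0_norm.
Qed.

Let base : {a | polar (X w0) (Y w0) a} := cid (polar_exists (XY0 w0)).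

Let partial (M N : nat) t w := sval base + \sum_(j < N)
  turn (X (c (t * (j%:R / M.+1%:R)) w)) (Y (c (t * (j%:R / M.+1%:R)) w))
       (X (c (t * (j.+1%:R / M.+1%:R)) w)) (Y (c (t * (j.+1%:R / M.+1%:R)) w)).

Let step_pos M w t (j : nat) : small_steps M w -> 0 <= t <= 1 -> (j <= M)%N ->
  0 < dot (t * (j%:R / M.+1%:R)) (t * (j.+1%:R / M.+1%:R)) w.
Proof.
move=> sM /andP[t0 t1] jM; have j0 : (0 : R) <= j%:R / M.+1%:R by rewrite divr_ge0.
apply: sM; first apply/andP; first split.
- exact: mulr_ge0.
- rewrite -[leRHS]mulr1 ler_pM// ler_pdivrMr ?ltr0n// mul1r ler_nat.
  by rewrite (leq_trans jM).
rewrite -mulrBr -mulrBl -natrB// subSn// subnn mul1r.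
by rewrite normrM ger0_norm// ger0_norm ?invr_ge0// ler_piMl// invr_ge0.
Qed.

Let partial_polar M w t N : small_steps M w -> 0 <= t <= 1 -> (N <= M.+1)%N ->
  polar (X (c (t * (N%:R / M.+1%:R)) w)) (Y (c (t * (N%:R / M.+1%:R)) w))
    (partial M N t w).
Proof.
move=> sM t01; elim: N => [|N IH] NM.
  by rewrite /partial big_ord0 addr0 mul0r mulr0 c0; exact: svalP base.
rewrite /partial big_ord_recr addrA; apply: polar_turn; first exact: IH (ltnW NM).
exact: step_pos.
Qed.

Let partial_cont (Z : topologicalType) (f : Z -> R) (g : Z -> W) M z :
  {for z, continuous f} -> {for z, continuous g} ->
  small_steps M (g z) -> 0 <= f z <= 1 ->
  {for z, continuous (fun z => partial M M.+1 (f z) (g z))}.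
Proof.
move=> fc gc sM f01; apply: cvgD; first exact: cvg_cst.
apply: cvg_big => [|[j jM] _ /=]; first exact: add_continuous.
have fj (x : R) : {for z, continuous (fun z => f z * x)}.
  by apply: cvgM => //; exact: cvg_cst.
have Xj x := comp_cont Xc (fj x) gc.
have Yj x := comp_cont Yc (fj x) gc.
apply: (@continuous_comp _ _ _
  (fun z => (X (c (f z * (j%:R / M.+1%:R)) (g z)) * Y (c (f z * (j.+1%:R / M.+1%:R)) (g z)) -
   Y (c (f z * (j%:R / M.+1%:R)) (g z)) * X (c (f z * (j.+1%:R / M.+1%:R)) (g z))) /
   (X (c (f z * (j%:R / M.+1%:R)) (g z)) * X (c (f z * (j.+1%:R / M.+1%:R)) (g z)) +
   Y (c (f z * (j%:R / M.+1%:R)) (g z)) * Y (c (f z * (j.+1%:R / M.+1%:R)) (g z)))) (@atan R)); last exact: continuous_atan.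
apply: cvgM; first by apply: cvgB; apply: cvgM; first [exact: Xj|exact: Yj].
apply: cvgV; first by rewrite gt_eqF//; apply: step_pos.
by apply: cvgD; apply: cvgM; first [exact: Xj|exact: Yj].
Qed.

(** Both subdivisions give an argument of the same vector at each time [t], so their difference is a
    multiple of [2 * pi]; it is continuous in [t] and vanishes at [t = 0]. *)
Let partial_indep M M' w : small_steps M w -> small_steps M' w ->
  partial M M.+1 1 w = partial M' M'.+1 1 w.
Proof.
move=> sM sM'; pose g t := partial M M.+1 t w - partial M' M'.+1 t w.
suff : g 1 = g 0.
  have M0 L : partial L L.+1 0 w = sval base.
    rewrite /partial big1 ?addr0// => j _; rewrite !mul0r c0 /turn.
    by rewrite [Y w0 * X w0]mulrC subrr mul0r atan0.
  by rewrite /g !M0 subrr => /eqP; rewrite subr_eq0 => /eqP.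
apply: (@continuous_discrete_path _ _ (pi *+ 2)); first by rewrite mulrn_wgt0// pi_gt0.
  move=> t t01; apply: cvgB; apply: partial_cont => //; exact: cvg_cst.
move=> t t01; rewrite /g.
have := @partial_polar M w t M.+1 sM t01 (leqnn _).
have := @partial_polar M' w t M'.+1 sM' t01 (leqnn _).
rewrite !divff ?pnatr_eq0// => /polar_uniq h /h [k ->].
by exists k; rewrite addrC addKr.
Qed.

(* The angle at [w] is the angle at [w0] plus the sum of the arctangent increments
   along equal small steps of the contraction path from [w0] to [w]. *)
Lemma polar_lift : exists2 F : W -> R, continuous F & forall w, polar (X w) (Y w) (F w).
Proof.
pose M (w : W) := projT1 (cid (small_steps_near w)).
have MP (w1 : W) : \forall w \near w1, small_steps (M w1) w by rewrite /M; case: cid.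
have MPw w : small_steps (M w) w := nbhs_singleton (MP w).
exists (fun w => partial (M w) (M w).+1 1 w) => [w1|w].
  suff : partial (M w1) (M w1).+1 1 w @[w --> w1] --> partial (M w1) (M w1).+1 1 w1.
    apply: cvg_trans; apply: near_eq_cvg; apply: filterS (MP w1) => w sw.
    exact: partial_indep.
  apply: (@partial_cont W (fun=> 1) id (M w1) w1) => //; last by rewrite ler01 lexx.
  exact: cvg_cst.
have := @partial_polar (M w) w 1 (M w).+1 (MPw w).
by rewrite ler01 lexx divff ?pnatr_eq0// mulr1 c1; apply.
Qed.

End Lifting.

Section DiscreteContractible.
Variables (R : realType) (W : topologicalType) (w0 : W) (c : R -> W -> W).
Hypothesis c_cont : continuous (fun p : R * W => c p.1 p.2).
Hypothesis c1 : forall w, c 1 w = w.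
Hypothesis c0 : forall w, c 0 w = w0.

Lemma continuous_discrete (g : W -> R) (p : R) : 0 < p -> continuous g ->
  (forall w, exists k : int, g w = k%:~R * p) -> forall w, g w = g w0.
Proof.
move=> p0 gc gZ w; rewrite -{1}(c1 w) -(c0 w).
apply: (@continuous_discrete_path _ (fun t => g (c t w)) p) => // t _.
apply: (@continuous_comp _ _ _ (fun t => c t w) g); last exact: gc.
apply: (@continuous_comp _ _ _ (fun t => (t, w)) (fun p => c p.1 p.2)); last exact: c_cont.
by apply: continuous_at_pair; [exact: cvg_id|exact: cvg_cst].
Qed.

End DiscreteContractible.

(** * Degrees of lifts that are equivariant under the toral automorphism *)

Section Degree.
Variables (R : realType) (d : nat).
Local Notation V := 'cV[R]_d.

Definition shrink (s : R) (w : V * R) : V * R := (s *: w.1, s * w.2).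

Lemma shrink_continuous : continuous (fun p : R * (V * R) => shrink p.1 p.2).
Proof.
move=> p; apply: (@continuous_at_pair _ _ _
  (fun p : R * (V * R) => p.1 *: p.2.1) (fun p => p.1 * p.2.2) p).
  apply: (@cvgZ _ _ _ _ _ fst (fun q => q.2.1) p.1 p.2.1); first exact: cvg_fst.
  by apply: (@continuous_comp _ _ _ snd fst); [exact: cvg_snd|exact: cvg_fst].
apply: cvgM; first exact: cvg_fst.
by apply: (@continuous_comp _ _ _ snd snd); [exact: cvg_snd|exact: cvg_snd].
Qed.

Lemma shrink1 w : shrink 1 w = w.
Proof. by case: w => v t; rewrite /shrink scale1r mul1r. Qed.

Lemma shrink0 w : shrink 0 w = (0, 0).
Proof. by rewrite /shrink scale0r mul0r. Qed.

(** [h] is multiplication by a row vector [g], and invariance reads [g *m A = g]. As [eigenvalue]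
    refers to row vectors, a nonzero [g] would be an eigenvector for 1. *)
Lemma invariant_additive_eq0 (A : 'M[int]_d) (h : {additive 'cV[int]_d -> R}) :
  ~~ eigenvalue (map_mx intr A : 'M[R[i]]_d) 1 ->
  (forall k, h (A *m k) = h k) -> forall k, h k = 0.
Proof.
move=> A1 hA.
pose g : 'rV[R]_d := \row_j h (delta_mx j 0).
have hE k : h k = \sum_i (k i 0)%:~R * g 0 i.
  rewrite {1}[k]matrix_sum_delta raddf_sum; apply: eq_bigr => i _.
  rewrite big_ord1 -[k i 0 in LHS]intz scaler_int raddfMz mxE.
  by rewrite mulrzl.
have gA : g *m map_mx intr A = g.
  apply/rowP => j; rewrite [RHS]mxE -hA hE mxE; apply: eq_bigr => i _.
  rewrite [in RHS]mxE (bigD1 j)//= big1 ?addr0 => [|l lj].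
    by rewrite !mxE !eqxx mulr1 mulrC.
  by rewrite mxE (negbTE lj) mulr0.
have [g0 k|g0] := eqVneq g 0.
  by rewrite hE big1// => i _; rewrite g0 mxE mulr0.
exfalso; move/negP: A1; apply; apply/eigenvalueP.
exists (map_mx (real_complex R) g); last by rewrite map_mx_eq0.
rewrite scale1r -[in RHS]gA map_mxM; congr (_ *m _).
by apply/matrixP => i j; rewrite !mxE rmorph_int.
Qed.

(** Shared by both lifting arguments: [p = 1], [T = 1] for maps from the suspension to the circle,
    [p = pi], [T = 2] for the angle of a line. All quantities assumed to lie in [p Z] are
    continuous, hence constant. Comparing the increment by [k] at height [T] with the increment by
    [A k] at height 0 shows that [h] is invariant. *)
Lemma degree_eq0 (A : 'M[int]_d) (F : V * R -> R) (p T : R) :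
  ~~ eigenvalue (map_mx intr A : 'M[R[i]]_d) 1 ->
  0 < p -> continuous F ->
  (forall v k t, exists m : int, F (v + map_mx intr k, t) - F (v, t) = m%:~R * p) ->
  (forall v, exists m : int, F (v, T) - F (map_mx intr A *m v, 0) = m%:~R * p) ->
  (forall v k t, F (v + map_mx intr k, t) = F (v, t)) /\
  exists n : int, forall v, F (v, T) = F (map_mx intr A *m v, 0) + n%:~R * p.
Proof.
move=> A1 p0 Fc FZ FA.
have cst (g : V * R -> R) : continuous g ->
    (forall w, exists k : int, g w = k%:~R * p) -> forall w, g w = g (0, 0).
  move=> gc gZ; apply: (continuous_discrete shrink_continuous shrink1 _ p0 gc gZ).
  exact: shrink0.
have snd_cont : continuous (snd : V * R -> R) by move=> w; exact: cvg_snd.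
have fst_cont : continuous (fst : V * R -> V) by move=> w; exact: cvg_fst.
pose h k := F (map_mx intr k, 0) - F (0, 0).
have hE k v t : F (v + map_mx intr k, t) - F (v, t) = h k.
  have := cst (fun w => F (w.1 + map_mx intr k, w.2) - F (w.1, w.2)).
  move=> /(_ _ _ (v, t)); rewrite /= /h add0r; apply => [w|w]; last exact: FZ.
  apply: cvgB; last by apply: (continuous_comp (continuous_at_pair (fst_cont w) (snd_cont w))); exact: Fc.
  apply: (@continuous_comp _ _ _ (fun w : V * R => (w.1 + map_mx intr k, w.2)) F); last exact: Fc.
  apply: continuous_at_pair; last exact: snd_cont.
  by apply: cvgD; [exact: fst_cont|exact: cvg_cst].
have DE v : F (v, T) - F (map_mx intr A *m v, 0) = F (0, T) - F (0, 0).
  have := cst (fun w => F (w.1, T) - F (map_mx intr A *m w.1, 0)).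
  move=> /(_ _ _ (v, 0)); rewrite /= mulmx0; apply => [w|w]; last exact: FA.
  apply: cvgB.
    apply: (@continuous_comp _ _ _ (fun w : V * R => (w.1, T)) F); last exact: Fc.
    by apply: continuous_at_pair; [exact: fst_cont|exact: cvg_cst].
  apply: (@continuous_comp _ _ _ (fun w : V * R => (map_mx intr A *m w.1, 0)) F); last exact: Fc.
  apply: continuous_at_pair; last exact: cvg_cst.
  apply: (@continuous_comp _ _ _ (fst : V * R -> V)
    (fun v : V => map_mx intr A *m v : V) w); first exact: fst_cont.
  exact: continuous_mulmxl.
have hB : zmod_morphism h.
  move=> k l; rewrite -[in RHS](hE k (map_mx intr (- l)) 0).
  rewrite -[in RHS](hE l (map_mx intr (- l)) 0) -!map_mxD addNr map_mx0.
  by rewrite /h [- l + k]addrC; ring.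
pose h' : {additive 'cV[int]_d -> R} := HB.pack h (GRing.isZmodMorphism.Build _ _ h hB).
have h0 : forall k, h k = 0.
  apply: (@invariant_additive_eq0 A h' A1) => k /=; rewrite /h.
  have h2 := hE k 0 T; rewrite /h add0r in h2.
  have h1 := DE (map_mx intr k); rewrite map_mxM; lra.
split => [v k t|]; first by apply/eqP; rewrite -subr_eq0 hE h0.
have [n nE] := FA 0; exists n => v; rewrite -nE mulmx0 -(DE v).
by rewrite addrC subrK.
Qed.

End Degree.

Section PeriodicBounded.
Variables (R : realType) (d : nat).
Local Notation V := 'cV[R]_d.

Lemma trmx_continuous m n : continuous (@trmx R m n).
Proof.
move=> v U [P vP PU]; exists (fun i j => P j i) => [i j|w Pw].
  by have := vP j i; rewrite mxE.
by apply: PU => i j; rewrite mxE; exact: Pw.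
Qed.

Lemma compact_cube : compact [set v : V | forall i, 0 <= v i 0 <= 1].
Proof.
have K : compact [set u : 'rV[R]_d | forall i, `[0, 1]%classic (u 0 i)].
  apply: (@rV_compact R d (fun=> `[0, 1]%classic)) => _.
  exact: segment_compact.
have := continuous_compact (continuous_subspaceT (@trmx_continuous 1 d)) K.
congr compact; apply/seteqP; split => [_ [u uK <-] i|v vK].
  by have := uK i; rewrite mxE /= in_itv.
exists v^T; last by rewrite trmxK.
by move=> i; rewrite /= in_itv /= mxE; exact: vK.
Qed.

Lemma periodic_bounded (G : V * R -> R) (T : R) : continuous G ->
  (forall v k t, G (v + map_mx intr k, t) = G (v, t)) ->
  exists C, forall v t, 0 <= t <= T -> `|G (v, t)| <= C.
Proof.
move=> Gc Gp.
have K := compact_setX compact_cube (@segment_compact R 0 T).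
have := continuous_compact (continuous_subspaceT Gc) K.
move=> /compact_bounded[M [Mr MG]]; exists (M + 1) => v t t01.
pose k : 'cV[int]_d := \col_i Num.floor (v i 0).
rewrite -(subrK (map_mx intr k) v) Gp; apply: (MG (M + 1)); first by rewrite ltrDl.
eexists; last reflexivity; split => /=; last by rewrite in_itv.
move=> i; rewrite !mxE subr_ge0 floor_le /= lerBlDr addrC.
by rewrite -intrD1 ltW// floorD1_gt.
Qed.

End PeriodicBounded.

Section Circle.
Variable R : realType.

Lemma circle_piP (x y : R) : circle_pi x = circle_pi y <-> exists k : int, y = x + k%:~R.
Proof.
split=> [/(@eqquotP _ (circle_equiv R))/asboolP //|xy].
by apply/(@eqquotP _ (circle_equiv R)); exact/asboolP.
Qed.

Lemma circle_pi_continuous : continuous (@circle_pi R).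
Proof. exact: pi_continuous. Qed.

Let circle_fun (f : R -> R) : continuous f -> (forall x (k : int), f (x + k%:~R) = f x) ->
  exists2 g : circle R -> R, continuous g & forall x, g (circle_pi x) = f x.
Proof.
move=> fc fp; pose g (z : circle R) := f (repr z); exists g => [|x].
  apply/quotient_continuous; rewrite (_ : _ \o _ = f)//.
  apply/funext => x; rewrite /g /=.
  have /circle_piP[k kE] : circle_pi (repr (circle_pi x)) = circle_pi x by exact: reprK.
  by rewrite [in RHS]kE fp.
rewrite /g; have /circle_piP[k kE] : circle_pi (repr (circle_pi x)) = circle_pi x by exact: reprK.
by rewrite [in RHS]kE fp.
Qed.

(** An embedding of the circle in the plane, through which [polar_lift] lifts circle-valued maps. *)
Lemma cos_sin2pi : exists cs : (circle R -> R) * (circle R -> R),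
  [/\ continuous cs.1, continuous cs.2 & forall x,
    cs.1 (circle_pi x) = cos (x * (pi *+ 2)) /\ cs.2 (circle_pi x) = sin (x * (pi *+ 2))].
Proof.
have lin (x : R) : {for x, continuous (fun y : R => y * (pi *+ 2))}.
  by apply: cvgM; [exact: cvg_id|exact: cvg_cst].
have perE (x : R) (k : int) : cos ((x + k%:~R) * (pi *+ 2)) = cos (x * (pi *+ 2)) /\
    sin ((x + k%:~R) * (pi *+ 2)) = sin (x * (pi *+ 2)).
  by rewrite mulrDl; exact: cos_sinD2piz.
have [c cc cE] : exists2 g : circle R -> R, continuous g &
    forall x, g (circle_pi x) = cos (x * (pi *+ 2)).
  apply: (@circle_fun (fun x => cos (x * (pi *+ 2)))) => [x|x k]; last exact: (perE x k).1.
  by apply: (@continuous_comp R R R (fun y : R => y * (pi *+ 2)) (@cos R) x);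
    [exact: lin|exact: continuous_cos].
have [s sc sE] : exists2 g : circle R -> R, continuous g &
    forall x, g (circle_pi x) = sin (x * (pi *+ 2)).
  apply: (@circle_fun (fun x => sin (x * (pi *+ 2)))) => [x|x k]; last exact: (perE x k).2.
  by apply: (@continuous_comp R R R (fun y : R => y * (pi *+ 2)) (@sin R) x);
    [exact: lin|exact: continuous_sin].
by exists (c, s).
Qed.

Section Lift.
Variables (W : topologicalType) (w0 : W) (c : R -> W -> W).
Hypothesis c_cont : continuous (fun p : R * W => c p.1 p.2).
Hypothesis c1 : forall w, c 1 w = w.
Hypothesis c0 : forall w, c 0 w = w0.

Lemma circle_lift (phi : W -> circle R) : continuous phi ->
  exists2 F : W -> R, continuous F & forall w, circle_pi (F w) = phi w.
Proof.
move=> phic; have [[co si] /= [coc sic csE]] := cos_sin2pi.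
have phiE w : exists x, phi w = circle_pi x by exists (repr (phi w)); exact/esym/reprK.
have [||w|F Fc FP] := @polar_lift R W w0 c c_cont c1 c0 (co \o phi) (si \o phi).
- by move=> w; apply: continuous_comp; [exact: phic|exact: coc].
- by move=> w; apply: continuous_comp; [exact: phic|exact: sic].
- have [x /= ->] := phiE w; rewrite (csE x).1 (csE x).2 -negb_and.
  apply/negP => /andP[/eqP h1 /eqP h2].
  by have := cos2Dsin2 (x * (pi *+ 2)); rewrite h1 h2 expr0n addr0 => /eqP; rewrite eq_sym oner_eq0.
have p0 : (pi *+ 2 : R) != 0 by rewrite mulrn_eq0 /= gt_eqF// pi_gt0.
exists (fun w => F w / (pi *+ 2)) => [w|w].
  by apply: cvgM; [exact: Fc|exact: cvg_cst].
have := FP w => /=; have [x ->] := phiE w; rewrite (csE x).1 (csE x).2 => h.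
have : polar (cos (x * (pi *+ 2))) (sin (x * (pi *+ 2))) (x * (pi *+ 2)).
  by exists 1; rewrite ?mul1r.
move=> /polar_uniq /(_ h)[k ->]; apply/esym/circle_piP; exists k.
by rewrite mulrDl !mulfK.
Qed.

Lemma circle_lift_uniq (F G : W -> R) : continuous F -> continuous G ->
  (forall w, circle_pi (F w) = circle_pi (G w)) -> forall w, F w - G w = F w0 - G w0.
Proof.
move=> Fc Gc FG; apply: (continuous_discrete c_cont c1 c0 (@ltr01 R)) => [w|w].
  by apply: cvgB; [exact: Fc|exact: Gc].
by have /esym/circle_piP[k ->] := FG w; exists k; rewrite mulr1 addrAC subrr add0r.
Qed.

End Lift.
End Circle.

(** * Rotation numbers on the suspension *)

Section SuspensionLift.
Local Open Scope quotient_scope.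
Variables (R : realType) (d : nat) (A : 'M[int]_d) (detA : \det A = 1).
Hypothesis A1 : ~~ eigenvalue (map_mx intr A : 'M[R[i]]_d) 1.
Local Notation V := 'cV[R]_d.
Local Notation T := (toral_aut R detA).
Local Notation X := (suspension R T).
Local Notation AR := (map_mx intr A : 'M[R]_d).

Let susp_cover (w : V * R) : X := susp_pi T (torus_pi w.1) w.2.

Lemma susp_cover_continuous : continuous susp_cover.
Proof.
move=> w; apply: (@continuous_comp _ _ _ (fun w : V * R => (torus_pi w.1, w.2))
   (\pi_(suspension R T))); last exact: pi_continuous.
apply: continuous_at_pair; last exact: cvg_snd.
by apply: (@continuous_comp _ _ _ fst (@torus_pi R d)); [exact: cvg_fst|exact: pi_continuous].
Qed.

Lemma susp_coverS v t : susp_cover (v, t + 1) = susp_cover (AR *m v, t).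
Proof.
apply/(@eqquotP _ (susp_equiv R T) X)/asboolP; exists 1 => /=.
by rewrite mulr1z addrK torus_map_pi.
Qed.

Lemma susp_coverP x : exists w, x = susp_cover w.
Proof.
exists (repr (repr x).1, (repr x).2); rewrite /susp_cover /= torus_pi_repr.
by rewrite /susp_pi -surjective_pairing; apply/esym/reprK.
Qed.

Let shrinkc := @shrink_continuous R d.
Let shrink1' := @shrink1 R d.
Let shrink0' := @shrink0 R d.

Definition winding (phi : X -> circle R) (F : V * R -> R) (n : int) :=
  [/\ continuous F, (forall w, circle_pi (F w) = phi (susp_cover w)),
    (forall v k t, F (v + map_mx intr k, t) = F (v, t)) &
    forall v t, F (v, t + 1) = F (AR *m v, t) + n%:~R].

Lemma winding_exists phi : continuous phi -> exists F n, winding phi F n.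
Proof.
move=> phic; have [|F Fc FP] := circle_lift shrinkc shrink1' shrink0' (phi := phi \o susp_cover).
  by move=> w; apply: continuous_comp; [exact: susp_cover_continuous|exact: phic].
have [||Fp [n nE]] := @degree_eq0 R d A F 1 1 A1 (@ltr01 R) Fc.
- move=> v k t; have : circle_pi (F (v, t)) = circle_pi (F (v + map_mx intr k, t)).
    rewrite !FP /= /susp_cover; congr (phi (susp_pi _ _ _)).
    by apply/torus_piP; exists k.
  by move=> /circle_piP[m ->]; exists m; rewrite mulr1 addrAC subrr add0r.
- move=> v; have : circle_pi (F (AR *m v, 0)) = circle_pi (F (v, 1)).
    by rewrite !FP /= -susp_coverS add0r.
  by move=> /circle_piP[m ->]; exists m; rewrite mulr1 addrAC subrr add0r.
exists F, n; split => // v t.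
(* [degree_eq0] compares the heights 1 and 0 only. For other [t], both sides lift the same
   circle-valued map, so their difference keeps its value at [t = 0]. *)
have := @circle_lift_uniq R (V * R)%type (0, 0) (@shrink R d) shrinkc shrink1' shrink0'
  (fun w => F (w.1, w.2 + 1)) (fun w => F (AR *m w.1, w.2)).
move=> /(_ _ _ _ (v, t)) /= h.
suff : F (v, t + 1) - F (AR *m v, t) = F (0, 0 + 1) - F (AR *m 0, 0).
  by have := nE 0; rewrite add0r; lra.
apply: h => [w|w|w]; last by rewrite !FP /= -susp_coverS.
  apply: (@continuous_comp _ _ _ (fun w : V * R => (w.1, w.2 + 1)) F); last exact: Fc.
  apply: continuous_at_pair; first exact: cvg_fst.
  by apply: cvgD; [exact: cvg_snd|exact: cvg_cst].
apply: (@continuous_comp _ _ _ (fun w : V * R => (AR *m w.1, w.2)) F); last exact: Fc.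
apply: continuous_at_pair; last exact: cvg_snd.
apply: (@continuous_comp _ _ _ (fst : V * R -> V) (fun v : V => AR *m v : V) w);
  [exact: cvg_fst|exact: continuous_mulmxl].
Qed.

(** The shift law moves height [t + N] down to [t] at the price of [n * N] and of replacing [v] by
    its image under [A ^ N]; periodicity makes the bound on [0, 1] uniform in [v], so this
    replacement costs nothing. *)
Lemma winding_linear_bound phi F n : winding phi F n ->
  exists C, forall v t, 0 <= t -> `|F (v, t) - n%:~R * t| <= C.
Proof.
move=> [Fc _ Fp FS].
have [C CP] := periodic_bounded 1 Fc Fp.
have H (N : nat) v t : 0 <= t <= 1 -> `|F (v, t + N%:R) - n%:~R * N%:R| <= C.
  elim: N v => [|N IH] v t01; first by rewrite mulr0 subr0 addr0 CP.
  rewrite -natr1 addrA FS.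
  by rewrite (_ : _ - _ = F (AR *m v, t + N%:R) - n%:~R * N%:R) ?IH//; ring.
exists (C + `|n%:~R|) => v t t0; pose N := Num.truncn t.
have /andP[N1 N2] : N%:R <= t < N.+1%:R by rewrite /N truncn_itv.
have t01 : 0 <= t - N%:R <= 1.
  by rewrite subr_ge0 N1 lerBlDr addrC natr1 ltW.
have := H N v (t - N%:R) t01; rewrite subrK => h.
rewrite (_ : _ - _ = (F (v, t) - n%:~R * N%:R) - n%:~R * (t - N%:R)); last by ring.
rewrite (le_trans (ler_normB _ _))// lerD// normrM ler_piMr//.
by rewrite ger0_norm; case/andP: t01.
Qed.

Lemma winding_rotation phi F n : winding phi F n -> forall x,
  exists2 u, orbit_lift phi x u & u t / t @[t --> +oo] --> (n%:~R : R).
Proof.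
move=> Fn x; have [[v s] ->] := susp_coverP x.
have [C CP] := winding_linear_bound Fn; have [Fc FP _ _] := Fn.
exists (fun t => F (v, s + t)).
  split => [t|t]; last by rewrite FP /susp_cover /= susp_flow_pi.
  apply: (@continuous_comp _ _ _ (fun t => (v, s + t)) F); last exact: Fc.
  apply: continuous_at_pair; first exact: cvg_cst.
  by apply: cvgD; [exact: cvg_cst|exact: cvg_id].
pose K := C + `|n%:~R * s|.
have K0 : 0 <= C by apply: le_trans (CP 0 0 (lexx _)).
apply/cvgrPdist_le => e e0.
exists (Num.max (`|s|) (K / e)); split => [|t]; first exact: num_real.
rewrite gt_max => /andP[st Ket].
have t0 : 0 < t by rewrite (le_lt_trans _ st).
have st0 : 0 <= s + t by move: st; rewrite ltr_norml => /andP[]; lra.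
rewrite distrC (_ : _ - _ = (F (v, s + t) - n%:~R * (s + t) + n%:~R * s) / t); last first.
  by field; rewrite gt_eqF.
rewrite normrM normfV (gtr0_norm t0) ler_pdivrMr//.
apply: (@le_trans _ _ K); last by rewrite mulrC -ler_pdivrMr// ltW.
by rewrite (le_trans (ler_normD _ _))// lerD2r CP.
Qed.

Lemma orbit_lift_slope_uniq (phi : X -> circle R) x u u' (a b : R) : orbit_lift phi x u -> orbit_lift phi x u' ->
  u t / t @[t --> +oo] --> a -> u' t / t @[t --> +oo] --> b -> a = b.
Proof.
move=> [uc uP] [u'c u'P] ua u'b.
have mc : continuous (fun p : R * R => p.1 * p.2).
  by move=> p; apply: cvgM; [exact: cvg_fst|exact: cvg_snd].
have E : forall t, u t - u' t = u 0 - u' 0.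
  apply: (circle_lift_uniq mc (@mul1r R) (@mul0r R) uc u'c) => t.
  by rewrite uP u'P.
have : (fun t => (u t / t - u' t / t)) t @[t --> +oo] --> a - b by exact: cvgB.
have H : (fun t => (u t / t - u' t / t)) t @[t --> +oo] --> (0 : R).
  apply/cvgrPdist_le => e e0; exists (`|u 0 - u' 0| / e); split; first exact: num_real.
  move=> t ht; have t0 : 0 < t by rewrite (le_lt_trans _ ht)// divr_ge0// ltW.
  rewrite sub0r normrN -mulrBl E normrM normfV (gtr0_norm t0) ler_pdivrMr//.
  by rewrite mulrC -ler_pdivrMr// ltW.
move=> /(cvg_unique (@Rhausdorff R) H) /esym/eqP.
by rewrite subr_eq0 => /eqP.
Qed.

(** [A] fixes the origin, so [t |-> [0, t]] is a closed curve of period 1. The homotopy along this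
    curve lifts to [H] on the plane, and [H(s, t + 1) - H(s, t)] is constant by uniqueness of lifts;
    it equals [n] at [s = 0] and [m] at [s = 1]. *)
Lemma winding_homotopic phi psi F G n m :
  winding phi F n -> winding psi G m -> homotopic R phi psi -> n = m.
Proof.
move=> Fn Gm [h [hc h0 h1]].
(* The homotopy is continuous only over [0, 1]; clamping the parameter extends it to the whole line,
   where the lifting lemma applies. *)
pose cl (s : R) := Num.max 0 (Num.min s 1).
have clc : continuous cl.
  move=> s; apply: (@continuous_max R R (fun=> 0) (fun s => Num.min s 1) s).
    exact: cvg_cst.
  by apply: (@continuous_min R R id (fun=> 1) s); [exact: cvg_id|exact: cvg_cst].
pose g (p : R * R) : R * X := (cl p.1, susp_cover (0, p.2)).
have gc : continuous g.
  move=> p; apply: (@continuous_at_pair (R * R)%type R X (fun p => cl p.1)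
    (fun p => susp_cover (0, p.2)) p).
    by apply: (@continuous_comp _ _ _ fst cl); [exact: cvg_fst|exact: clc].
  apply: (@continuous_comp _ _ _ (fun p : R * R => (0 : V, p.2)) susp_cover);
    last exact: susp_cover_continuous.
  by apply: continuous_at_pair; [exact: cvg_cst|exact: cvg_snd].
have gA p : (`[0, 1]%classic `*` [set: X]) (g p).
  by split => //=; rewrite in_itv /= le_max lexx /= ge_max ler01 ge_min lexx orbT.
have hgc : continuous (h \o g).
  have /subspace_continuousP hc' := hc.
  move=> p U /= hU; have /(gc p) := hc' (g p) (gA p) U hU.
  move=> gU; change (nbhs p ((h \o g) @^-1` U)).
  by apply: (@filterS _ _ (nbhs_filter p) _ _ _ gU) => q; apply; exact: gA.
have c2 : continuous (fun p : R * (R * R) => (p.1 * p.2.1, p.1 * p.2.2)).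
  move=> p; apply: (@continuous_at_pair _ _ _ (fun p : R * (R * R) => p.1 * p.2.1)
    (fun p => p.1 * p.2.2) p); apply: cvgM; first exact: cvg_fst.
    by apply: (@continuous_comp _ _ _ snd fst); [exact: cvg_snd|exact: cvg_fst].
    exact: cvg_fst.
  by apply: (@continuous_comp _ _ _ snd snd); [exact: cvg_snd|exact: cvg_snd].
pose c (r : R) (p : R * R) := (r * p.1, r * p.2).
have c1 p : c 1 p = p by case: p => a b; rewrite /c !mul1r.
have c0 p : c 0 p = (0, 0) by rewrite /c !mul0r.
have [H Hc HP] := circle_lift (c := c) c2 c1 c0 hgc.
have per s t : H (s, t + 1) - H (s, t) = H (0, 0 + 1) - H (0, 0).
  apply: (@circle_lift_uniq _ _ (0, 0) c c2 c1 c0 (fun p => H (p.1, p.2 + 1)) (fun p => H (p.1, p.2)) _ _ _ (s, t)).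
  - move=> w; apply: (@continuous_comp _ _ _ (fun w : R * R => (w.1, w.2 + 1)) H); last exact: Hc.
    apply: continuous_at_pair; first exact: cvg_fst.
    by apply: cvgD; [exact: cvg_snd|exact: cvg_cst].
  - move=> w; apply: (@continuous_comp _ _ _ (fun w : R * R => (w.1, w.2)) H); last exact: Hc.
    by apply: continuous_at_pair; [exact: cvg_fst|exact: cvg_snd].
  - by move=> w; rewrite !HP /= /g susp_coverS mulmx0.
have mc : continuous (fun p : R * R => p.1 * p.2).
  by move=> p; apply: cvgM; [exact: cvg_fst|exact: cvg_snd].
have end_deg s chi K k : winding chi K k -> (forall x, h (cl s, x) = chi x) ->
    k%:~R = H (0, 0 + 1) - H (0, 0).
  move=> [Kc KP _ KS] hchi; rewrite -(per s 0).
  have : forall t, H (s, t) - K (0, t) = H (s, 0) - K (0, 0).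
    apply: (@circle_lift_uniq R R 0 _ mc (@mul1r R) (@mul0r R)
      (fun t => H (s, t)) (fun t => K (0 : V, t))) => t.
    - apply: (@continuous_comp _ _ _ (fun t : R => (s, t)) H); last exact: Hc.
      by apply: continuous_at_pair; [exact: cvg_cst|exact: cvg_id].
    - apply: (@continuous_comp _ _ _ (fun t : R => (0 : V, t)) K); last exact: Kc.
      by apply: continuous_at_pair; [exact: cvg_cst|exact: cvg_id].
    - by rewrite HP KP /= /g hchi.
  move=> /(_ (0 + 1)); rewrite KS mulmx0; lra.
apply: (@intr_inj R); rewrite (end_deg 0 _ _ _ Fn).
  rewrite (end_deg 1 _ _ _ Gm)// => x.
  by rewrite /cl minxx max_r ?ler01// h1.
by move=> x; rewrite /cl min_l ?ler01// maxxx h0.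
Qed.

Lemma linear_winding (n : int) :
  exists phi F, continuous phi /\ winding phi F n.
Proof.
pose phi (x : X) := circle_pi (n%:~R * (repr x).2 : R).
have phiE w t : phi (susp_pi T w t) = circle_pi (n%:~R * t).
  rewrite /phi; set x := susp_pi T w t.
  have /asboolP[k [_ /= tE]] : susp_rel T (repr x) (w, t).
    by apply/(@eqquotP _ (susp_equiv R T) X); rewrite reprK.
  apply/circle_piP; exists (- (n * k)); rewrite tE rmorphN rmorphM /=; ring.
have phic : continuous phi.
  apply/quotient_continuous.
  rewrite (_ : _ \o _ = (fun p : torus R d * R => circle_pi (n%:~R * p.2))); last first.
    by apply/funext => -[w t]; exact: phiE.
  move=> p; apply: (@continuous_comp _ _ _ (fun p : torus R d * R => n%:~R * p.2) (@circle_pi R));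
    last exact: circle_pi_continuous.
  by apply: cvgM; [exact: cvg_cst|exact: cvg_snd].
exists phi, (fun w => n%:~R * w.2); split => //; split => //.
- move=> w; apply: cvgM; [exact: cvg_cst|exact: cvg_snd].
- by move=> w; rewrite /susp_cover phiE.
- by move=> v t; rewrite /= mulrDr mulr1.
Qed.

Section Range.
Variable P : probability (borel (torus R d)) R.

Let susp_measure0 : @susp_measure R _ T P set0 = 0%E.
Proof. by rewrite /susp_measure integral0_eq// => s _; rewrite measure0. Qed.

Let susp_measureT : @susp_measure R _ T P setT = 1%E.
Proof.
rewrite /susp_measure (eq_integral (cst 1%E)); last first.
  by move=> s _; exact: probability_setT.
rewrite integral_cst// mul1e; apply: etrans (lebesgue_measure_itv `[0, 1]) _.
by rewrite /= lte_fin ltr01 oppr0 adde0.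
Qed.

Let rotation_number_all (phi : X -> circle R) (a : R) :
  (forall x, exists2 u, orbit_lift phi x u & u t / t @[t --> +oo] --> a) ->
  is_rotation_number P phi a.
Proof. by move=> h; exists set0; split => // x; apply; exact: h. Qed.

(** The suspension has mass 1, so a property that holds almost everywhere holds somewhere. *)
Let rotation_number_ex (phi : X -> circle R) (a : R) : is_rotation_number P phi a ->
  exists x u, orbit_lift phi x u /\ u t / t @[t --> +oo] --> a.
Proof.
move=> [B [_ B0 nB]]; apply: contrapT => nex.
have BT : B = setT.
  apply/seteqP; split => // x _; apply: nB => /= -[u ux ua].
  by apply: nex; exists x, u.
by move: B0; rewrite BT susp_measureT => /eqP; rewrite onee_eq0.
Qed.

(** By homotopy invariance each member of the class has slope [n] along all orbits, and a competing
    number agrees with [n] on one orbit. The choice made by [xget] is thus forced and the default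
    value is not reached. *)
Lemma schwartzman_class phi F n : continuous phi -> winding phi F n ->
  schwartzman P (homotopy_class R phi) = n%:~R.
Proof.
move=> phic Fn; have refl : homotopic R phi phi.
  exists (phi \o snd); split => //; apply: continuous_subspaceT => x.
  by apply: (@continuous_comp _ _ _ snd phi); [exact: cvg_snd|exact: phic].
apply: xget_unique => [psi [psic hpsi]|a aP].
  have [G [m Gm]] := winding_exists psic.
  rewrite (winding_homotopic Fn Gm hpsi); apply: rotation_number_all.
  exact: winding_rotation Gm.
have [x [u [ux ua]]] := rotation_number_ex (aP phi (conj phic refl)).
have [u' u'x u'n] := winding_rotation Fn x.
exact: orbit_lift_slope_uniq ux u'x ua u'n.
Qed.

Lemma schwartzman_range_int : schwartzman_range T P = range (intr : int -> R).
Proof.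
apply/seteqP; split => [_ [_ [phi phic <-] <-]|_ [n _ <-]].
  have [F [n Fn]] := winding_exists phic.
  by exists n => //; rewrite (schwartzman_class phic Fn).
have [phi [F [phic Fn]]] := linear_winding n.
by exists (homotopy_class R phi); [exists phi|exact: schwartzman_class Fn].
Qed.

End Range.
End SuspensionLift.

(** * Jacobi operators on square-summable sequences *)

Section Windows.
Variable R : realType.
Implicit Types (u phi psi : int -> R) (N M : nat).

Definition wsum N u := \sum_(i < N.*2.+1) u (i%:Z - N%:Z).

Definition supp N u := forall n : int, (N < `|n|)%N -> u n = 0.

Lemma wsum_shift N u :
  wsum N (fun n => u (n + 1)) = wsum N u + u (N%:Z + 1) - u (- N%:Z).
Proof.
rewrite /wsum big_ord_recr [in RHS]big_ord_recl /= sub0r.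
rewrite (_ : (N.*2)%:Z - N%:Z + 1 = N%:Z + 1); last by lia.
rewrite (eq_bigr (fun i : 'I__ => u ((bump 0 i)%:Z - N%:Z))); last first.
  by move=> i _; congr u; rewrite /bump /=; lia.
by ring.
Qed.

Lemma wsumS N u : wsum N.+1 u = u (- N.+1%:Z) + wsum N u + u N.+1%:Z.
Proof.
rewrite /wsum doubleS big_ord_recr big_ord_recl /= sub0r; congr (_ + _ + _).
  by apply: eq_bigr => i _; congr u; rewrite /bump /=; lia.
by congr u; lia.
Qed.

Lemma eq_wsum N u v : (forall n, (`|n| <= N)%N -> u n = v n) -> wsum N u = wsum N v.
Proof. by move=> uv; apply: eq_bigr => -[i /= iN] _; apply: uv; lia. Qed.

Lemma ler_wsum N u v : (forall n, u n <= v n) -> wsum N u <= wsum N v.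
Proof. by move=> uv; apply: ler_sum. Qed.

Lemma wsumD N u v : wsum N (fun n => u n + v n) = wsum N u + wsum N v.
Proof. exact: big_split. Qed.

Lemma wsumZ N (a : R) u : wsum N (fun n => a * u n) = a * wsum N u.
Proof. by rewrite /wsum mulr_sumr. Qed.

Lemma wsum_ge0 N u : (forall n, 0 <= u n) -> 0 <= wsum N u.
Proof. by move=> u0; apply: sumr_ge0. Qed.

Lemma le_wsum N M u : (forall n, 0 <= u n) -> (N <= M)%N -> wsum N u <= wsum M u.
Proof.
move=> u0 /subnKC <-; elim: (M - N)%N => [|k IH]; first by rewrite addn0.
by rewrite addnS wsumS (le_trans IH)// -addrA addrC -!addrA lerDl addr_ge0.
Qed.

Lemma wsum_supp N M u : supp N u -> (N <= M)%N -> wsum M u = wsum N u.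
Proof.
move=> su /subnKC <-; elim: (M - N)%N => [|k IH]; first by rewrite addn0.
rewrite addnS wsumS IH !su ?add0r ?addr0//; lia.
Qed.

Lemma ler_term_wsum u n : (forall n, 0 <= u n) -> u n <= wsum `|n| u.
Proof.
move=> u0; case: n => [[|n]|n]; rewrite ?NegzE ?abszN /=.
- by rewrite /wsum big_ord1 subrr.
- by rewrite wsumS lerDr addr_ge0// wsum_ge0.
- by rewrite wsumS -addrA lerDl addr_ge0// wsum_ge0.
Qed.

Definition trunc N u n := if (`|n| <= N)%N then u n else 0.

Lemma supp_trunc N u : supp N (trunc N u).
Proof. by move=> n; rewrite /trunc ltnNge => /negbTE ->. Qed.

Lemma wsum_trunc N M u : (N <= M)%N ->
  wsum M (fun n => trunc N u n ^+ 2) = wsum N (fun n => u n ^+ 2).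
Proof.
move=> NM; rewrite (@wsum_supp N)//; last by move=> n nN; rewrite supp_trunc ?expr0n.
by apply: eq_wsum => n; rewrite /trunc => ->.
Qed.

(* The squared l2 norm of [u] is at most [m]; finite windows avoid infinite sums. *)
Definition nle u (m : R) := forall N, wsum N (fun n => u n ^+ 2) <= m.

Lemma nle_ge0 u m : nle u m -> 0 <= m.
Proof. by move=> /(_ 0%N); apply: le_trans; apply: wsum_ge0 => n; exact: sqr_ge0. Qed.

Lemma nle_term u m n : nle u m -> `|u n| <= Num.sqrt m.
Proof.
move=> um; rewrite -sqrtr_sqr ler_wsqrtr// (le_trans _ (um `|n|%N))//.
by apply: (@ler_term_wsum (fun n => u n ^+ 2)) => k; exact: sqr_ge0.
Qed.

Lemma nleZ u m (a : R) : nle u m -> nle (fun n => a * u n) (a ^+ 2 * m).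
Proof.
move=> um N; have := um N; under [X in _ -> X <= _]eq_bigr do rewrite exprMn.
by rewrite -mulr_sumr => h; rewrite ler_wpM2l ?sqr_ge0.
Qed.

(** The convexity inequality [(u + v)^2 <= u^2 / (1 - s) + v^2 / s]. The free weight [s] is tuned in
    [nle_S] so that a recursion closes. *)
Lemma nle_split u v m m' (s : R) : 0 < s < 1 -> nle u m -> nle v m' ->
  nle (fun n => u n + v n) (m / (1 - s) + m' / s).
Proof.
move=> /andP[s0 s1] um vm N; have s1' : 0 < 1 - s by rewrite subr_gt0.
apply: (@le_trans _ _ ((1 - s)^-1 * wsum N (fun n => u n ^+ 2) +
    s^-1 * wsum N (fun n => v n ^+ 2))); last first.
  by rewrite lerD// mulrC ler_wpM2r ?invr_ge0 ?um ?vm ?(ltW s0)// ltW.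
rewrite -!wsumZ -wsumD; apply: ler_wsum => n.
rewrite -subr_ge0.
have -> : (1 - s)^-1 * u n ^+ 2 + s^-1 * v n ^+ 2 - (u n + v n) ^+ 2 =
    (s * u n - (1 - s) * v n) ^+ 2 / ((1 - s) * s).
  by field; rewrite !gt_eqF.
by rewrite divr_ge0 ?sqr_ge0// mulr_ge0// ltW.
Qed.

Lemma nleD u v m m' : nle u m -> nle v m' -> nle (fun n => u n + v n) (2 * (m + m')).
Proof.
move=> um vm; have := @nle_split u v m m' 2^-1 _ um vm.
have -> : m / (1 - 2^-1) + m' / 2^-1 = 2 * (m + m') by field.
by apply; lra.
Qed.

Lemma nleW u m m' : m <= m' -> nle u m -> nle u m'.
Proof. by move=> mm um N; exact: le_trans (um N) mm. Qed.

End Windows.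

Section Jacobi.
Variables (R : realType) (b : int -> R).
Implicit Types (u phi psi h : int -> R) (N M : nat).

Definition jacobi u (n : int) := u (n - 1) + u (n + 1) + b n * u n.
Local Notation L := jacobi.

Lemma supp_jacobi N u : supp N u -> supp N.+1 (L u).
Proof. by move=> su n Nn; rewrite /L !su ?mulr0 ?addr0//; lia. Qed.

Lemma jacobi_local N u v n : (`|n| <= N)%N ->
  (forall k, (`|k| <= N.+1)%N -> u k = v k) -> L u n = L v n.
Proof. by move=> nN uv; rewrite /L !uv//; lia. Qed.

Lemma jacobi_lin (a a' : R) u v n :
  L (fun k => a * u k + a' * v k) n = a * L u n + a' * L v n.
Proof. rewrite /L; ring. Qed.

(** Summation by parts; the margin [N < M] makes the boundary terms vanish. *)
Lemma jacobi_sym N M phi psi : supp N phi -> (N < M)%N ->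
  wsum M (fun n => phi n * L psi n) = wsum M (fun n => L phi n * psi n).
Proof.
move=> sphi NM.
have e1 : wsum M (fun n => phi n * psi (n - 1)) = wsum M (fun n => phi (n + 1) * psi n).
  have := wsum_shift M (fun n => phi n * psi (n - 1)).
  under eq_wsum do rewrite addrK.
  by rewrite !sphi ?mul0r ?addr0 ?subr0//; lia.
have e2 : wsum M (fun n => phi n * psi (n + 1)) = wsum M (fun n => phi (n - 1) * psi n).
  have := wsum_shift M (fun n => phi (n - 1) * psi n).
  under eq_wsum do rewrite addrK.
  by rewrite !sphi ?mul0r ?addr0 ?subr0//; lia.
rewrite (@eq_wsum _ _ _ (fun n => phi n * psi (n - 1) + phi n * psi (n + 1)
  + b n * phi n * psi n)); last by move=> n _; rewrite /L; ring.
rewrite !wsumD e1 e2 -!wsumD; apply: eq_wsum => n _; rewrite /L; ring.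
Qed.

Hypothesis (B : R) (bB : forall n, `|b n| <= B).

(** A bound for the squared norm of [jacobi], from [(x + y + z)^2 <= 3 (x^2 + y^2 + z^2)] applied to
    two shifts and a multiplication by at most [B]. *)
Definition Lam := 3 * (2 + B ^+ 2).

Lemma Lam_gt0 : 0 < Lam.
Proof. by rewrite mulr_gt0// ltr_wpDr ?sqr_ge0. Qed.

Lemma jacobi_le N M u : supp N u -> (N < M)%N ->
  wsum M (fun n => L u n ^+ 2) <= Lam * wsum M (fun n => u n ^+ 2).
Proof.
move=> su NM.
have e1 : wsum M (fun n => u (n + 1) ^+ 2) = wsum M (fun n => u n ^+ 2).
  by rewrite (wsum_shift M (fun n => u n ^+ 2)) !su ?expr0n ?addr0 ?subr0//; lia.
have e2 : wsum M (fun n => u (n - 1) ^+ 2) = wsum M (fun n => u n ^+ 2).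
  have := wsum_shift M (fun n => u (n - 1) ^+ 2).
  under eq_wsum do rewrite addrK.
  by move=> ->; rewrite !su ?expr0n ?addr0 ?subr0//; lia.
have -> : Lam * wsum M (fun n => u n ^+ 2) =
    wsum M (fun n => 3 * (u (n - 1) ^+ 2 + u (n + 1) ^+ 2 + B ^+ 2 * u n ^+ 2)).
  by rewrite wsumZ !wsumD wsumZ e1 e2 /Lam; ring.
apply: ler_wsum => n; rewrite /L.
have h1 : (b n * u n) ^+ 2 <= B ^+ 2 * u n ^+ 2.
  rewrite exprMn ler_wpM2r ?sqr_ge0// -[leLHS]real_normK ?num_real//.
  by rewrite ler_sqr ?nnegrE// (le_trans _ (bB 0)).
set x := u (n - 1); set y := u (n + 1); move: h1; set z := b n * u n; set w := _ * u n ^+ 2.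
move=> h1; have := sqr_ge0 (x - y); have := sqr_ge0 (y - z); have := sqr_ge0 (x - z).
by rewrite !expr2 in h1 *; nra.
Qed.

Lemma nle_jacobi u m : nle u m -> nle (L u) (Lam * m).
Proof.
move=> um N.
rewrite (@eq_wsum _ N _ (fun n => L (trunc N.+1 u) n ^+ 2)); last first.
  move=> n nN; congr (_ ^+ 2); apply: (jacobi_local nN) => k kN.
  by rewrite /trunc kN.
apply: (@le_trans _ _ (wsum N.+2 (fun n => L (trunc N.+1 u) n ^+ 2))).
  by apply: le_wsum; [move=> n; exact: sqr_ge0|lia].
apply: le_trans (jacobi_le (@supp_trunc _ _ _) (ltnSn _)) _.
by rewrite wsum_trunc// ler_wpM2l ?um// ltW// Lam_gt0.
Qed.

Variables (c y2 : R).
Hypotheses (c0 : 0 <= c) (y20 : 0 <= y2) (cy : 0 < c + y2).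
Hypothesis LB : forall N phi, supp N phi ->
  c * wsum N (fun n => phi n ^+ 2) <= wsum N.+1 (fun n => L phi n ^+ 2).

(* [ksq] is the product of [jacobi - i y] and [jacobi + i y] for [y2 = y ^ 2], so that
   inverting it on real sequences inverts [jacobi - i y] on complex ones; the inverse
   is the Neumann series of [1 - t K]. *)
Definition ksq u n := L (L u) n + y2 * u n.
Local Notation K := ksq.
Local Notation t := (Lam + 2 * y2)^-1.
Let q := 1 - t * (c + y2).
Let P u n := u n - t * K u n.

Let den_gt0 : 0 < Lam + 2 * y2.
Proof. by rewrite ltr_wpDr ?Lam_gt0// mulr_ge0. Qed.

Let t_gt0 : 0 < t. Proof. by rewrite invr_gt0. Qed.

Lemma ksq_lin (a a' : R) u v n :
  K (fun k => a * u k + a' * v k) n = a * K u n + a' * K v n.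
Proof.
rewrite /K; rewrite (_ : L (fun k => a * u k + a' * v k) = fun k => a * L u k + a' * L v k).
  by rewrite jacobi_lin; ring.
by apply/funext => k; rewrite jacobi_lin.
Qed.

Lemma ksq_local N u v n : (`|n| <= N)%N ->
  (forall k, (`|k| <= N.+2)%N -> u k = v k) -> K u n = K v n.
Proof.
move=> nN uv; rewrite /K; congr (_ + _ * _); last by apply: uv; lia.
by apply: (jacobi_local nN) => k kN; apply: (jacobi_local kN).
Qed.

(** By symmetry of [L], [|P u|^2 = (1 - t y2)^2 |u|^2 - 2 t (1 - t y2) |L u|^2 + t^2 |L L u|^2].
    Since [|L L u|^2 <= Lam |L u|^2] and [t (Lam + 2 y2) = 1], the last two terms add up to at most
    [- t |L u|^2], and [LB] bounds this by [- t c |u|^2]. The choice of [t] is made for this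
    cancellation. *)
Let P_le N M u : supp N u -> (N.+2 < M)%N ->
  wsum M (fun n => P u n ^+ 2) <= q * wsum M (fun n => u n ^+ 2).
Proof.
move=> su NM.
rewrite (@eq_wsum _ _ _ (fun n => (1 - t * y2) ^+ 2 * u n ^+ 2
   + (- (2 * t * (1 - t * y2)) * (u n * L (L u) n)
   + t ^+ 2 * (L (L u) n) ^+ 2))); last first.
  by move=> n _; rewrite /P /K; ring.
rewrite !wsumD !wsumZ (jacobi_sym _ su); last by lia.
rewrite (@eq_wsum _ M (fun n => L u n * L u n) (fun n => L u n ^+ 2)); last by move=> n _; rewrite expr2.
have := jacobi_le (supp_jacobi su) (ltnW NM).
have := LB su; rewrite -(wsum_supp (M := M) (N := N)); last by lia.
  rewrite -(wsum_supp (M := M) (N := N.+1)); last by lia.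
    set S := wsum _ _; set D := wsum _ _; set D2 := wsum _ _ => h1 h2.
    have S0 : 0 <= S by apply: wsum_ge0 => n; exact: sqr_ge0.
    have tE : t * (Lam + 2 * y2) = 1 by rewrite mulVf// gt_eqF.
    have ty : t * y2 <= 1.
      by have := ler_pM2l t_gt0 y2 (Lam + 2 * y2); rewrite tE => ->; move: Lam_gt0 (y20); lra.
    have ty0 : 0 <= t * y2 by rewrite mulr_ge0// ltW.
    apply: (@le_trans _ _ ((1 - t * y2) ^+ 2 * S + (- (2 * t * (1 - t * y2)) * D
      + t ^+ 2 * (Lam * D)))).
      by rewrite !lerD2l ler_wpM2l ?sqr_ge0.
    have -> : - (2 * t * (1 - t * y2)) * D + t ^+ 2 * (Lam * D) = - (t * D).
      transitivity (t * D * (t * (Lam + 2 * y2) - 2)); first by ring.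
      by rewrite tE; ring.
    have h3 : t * (c * S) <= t * D by rewrite ler_pM2l.
    have h4 : (1 - t * y2) ^+ 2 * S <= (1 - t * y2) * S.
      by rewrite ler_wpM2r// expr2 ler_piMl ?subr_ge0// lerBlDr lerDl.
    apply: (le_trans (lerD h4 (lexx _))); rewrite -subr_ge0.
    rewrite (_ : _ - _ = t * D - t * (c * S)) ?subr_ge0//.
    by rewrite /q; ring.
  by move=> n nN; rewrite (supp_jacobi su)// expr0n.
by move=> n nN; rewrite su// expr0n.
Qed.

(** [P_le] is tested on a unit mass, where its right-hand side is [q] itself. *)
Let q_ge0 : 0 <= q.
Proof.
pose d (n : int) : R := (n == 0)%:R.
have sd : supp 0 d by move=> n; rewrite /d; case: eqP => [->|].
have := P_le sd (isT : (2 < 3)%N).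
rewrite (@wsum_supp _ 0 3 (fun n => d n ^+ 2)) //; last first.
  by move=> n n0; rewrite sd// expr0n.
rewrite {2}/wsum big_ord1 subrr /d eqxx expr1n mulr1; apply: le_trans.
by apply: wsum_ge0 => n; exact: sqr_ge0.
Qed.

Let q_lt1 : q < 1.
Proof. by rewrite /q ltrBlDr ltrDl mulr_gt0. Qed.

Let nle_P u m : nle u m -> nle (P u) (q * m).
Proof.
move=> um N.
rewrite (@eq_wsum _ N _ (fun n => P (trunc N.+2 u) n ^+ 2)); last first.
  move=> n nN; congr (_ ^+ 2); rewrite /P; congr (_ - _ * _).
    by rewrite /trunc ifT//; lia.
  by apply: (ksq_local nN) => k kN; rewrite /trunc kN.
apply: (@le_trans _ _ (wsum N.+2.+3 (fun n => P (trunc N.+2 u) n ^+ 2))).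
  by apply: le_wsum; [move=> n; exact: sqr_ge0|lia].
apply: le_trans (P_le (@supp_trunc _ _ _) (ltnSn _)) _.
by rewrite wsum_trunc; [rewrite ler_wpM2l|lia].
Qed.

Let pw h j := iter j P h.

Let nle_pw h m j : nle h m -> nle (pw h j) (q ^+ j * m).
Proof.
move=> hm; elim: j => [|j IH]; first by rewrite mul1r.
by rewrite exprS -mulrA; exact: nle_P.
Qed.

Definition neumann_rate := Num.sqrt q.
Local Notation r := neumann_rate.

Lemma neumann_rate_bounds : 0 <= r < 1.
Proof. by rewrite sqrtr_ge0 -sqrtr1 ltr_sqrt. Qed.

Let rate_cvg0 (x : R) : (fun j => r ^+ j * x) @ \oo --> (0 : R).
Proof.
have /andP[r0 r1] := neumann_rate_bounds.
suff : (fun j => r ^+ j * x) @ \oo --> 0 * x by rewrite mul0r.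
apply: cvgM; last exact: cvg_cst.
by apply: cvg_expr; rewrite ger0_norm.
Qed.

Let pw_term h m j n : nle h m -> `|pw h j n| <= r ^+ j * Num.sqrt m.
Proof.
move=> hm; apply: le_trans (nle_term n (nle_pw j hm)) _.
rewrite sqrtrM ?exprn_ge0// /r.
rewrite (_ : Num.sqrt (q ^+ j) = Num.sqrt q ^+ j)//.
elim: j => [|j IH]; first by rewrite !expr0 sqrtr1.
by rewrite !exprS sqrtrM// IH.
Qed.

Definition neumann_sum h J n := \sum_(j < J) t * pw h j n.
Local Notation S := neumann_sum.

Let S_step h J n : S h J.+1 n = S h J n + t * pw h J n.
Proof. by rewrite /S big_ord_recr. Qed.

Let K_S h J n : K (S h J) n = h n - pw h J n.
Proof.
elim: J n => [|J IH] n.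
  rewrite (_ : S h 0 = fun k => 0 * h k + 0 * h k).
    by rewrite ksq_lin /pw /= !mul0r subrr addr0.
  by apply/funext => k; rewrite /S big_ord0 !mul0r addr0.
rewrite (_ : S h J.+1 = fun k => 1 * S h J k + t * pw h J k).
  by rewrite ksq_lin IH /= /P; ring.
by apply/funext => k; rewrite S_step mul1r.
Qed.

Let S_dist h m J k n : nle h m ->
  `|S h (J + k) n - S h J n| <= t * Num.sqrt m / (1 - r) * r ^+ J.
Proof.
move=> hm; have /andP[r0 r1] := neumann_rate_bounds.
apply: (@le_trans _ _ (t * Num.sqrt m / (1 - r) * (r ^+ J - r ^+ (J + k)))); last first.
  rewrite ler_wpM2l ?divr_ge0 ?mulr_ge0 ?sqrtr_ge0 ?subr_ge0 ?(ltW t_gt0) ?(ltW r1)//.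
  by rewrite lerBlDr lerDl exprn_ge0.
elim: k => [|k IH]; first by rewrite addn0 !subrr mulr0 normr0.
rewrite addnS S_step -addrAC (le_trans (ler_normD _ _))//.
apply: le_trans (lerD IH (_ : _ <= t * (r ^+ (J + k) * Num.sqrt m))) _.
  by rewrite normrM (gtr0_norm t_gt0) ler_pM2l// pw_term.
rewrite le_eqVlt; apply/orP; left; apply/eqP; rewrite exprS.
have n1 : 1 - r != 0 by rewrite subr_eq0 gt_eqF.
by field; rewrite n1 gt_eqF.
Qed.

(** Partial sums satisfy [S (J + 1) = t h + P (S J)]. Splitting with [s] halfway between [q] and 1,
    a bound [X] is preserved when [t^2 m / (1 - s) = X (1 - s)]; as [1 - s = t (c + y2) / 2], this
    gives [X = 4 m / (c + y2)^2], the same for all [J]. *)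
Let nle_S h m J : nle h m -> nle (S h J) (4 * m / (c + y2) ^+ 2).
Proof.
move=> hm; have m0 := nle_ge0 hm; elim: J => [|J IH].
  move=> N; rewrite /wsum big1 => [|i _]; last by rewrite /S big_ord0 expr0n.
  by rewrite divr_ge0 ?sqr_ge0// mulr_ge0.
pose s := (1 + q) / 2.
have s01 : 0 < s < 1 by rewrite /s; move: q_ge0 q_lt1; lra.
have -> : S h J.+1 = fun n => t * h n + P (S h J) n.
  by apply/funext => n; rewrite S_step /P K_S; ring.
apply: nleW (nle_split s01 (nleZ t hm) (nle_P IH)).
have s0 : 0 < s by case/andP: s01.
have -> : 1 - s = t * (c + y2) / 2 by rewrite /s /q; field; rewrite gt_eqF.
set X := 4 * m / (c + y2) ^+ 2.
have X0 : 0 <= X by rewrite divr_ge0 ?sqr_ge0// mulr_ge0.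
have -> : t ^+ 2 * m / (t * (c + y2) / 2) = X * (t * (c + y2) / 2).
  rewrite /X; field; rewrite !gt_eqF//.
have -> : t * (c + y2) / 2 = s - q by rewrite /s /q; field; rewrite gt_eqF.
rewrite -subr_ge0.
have -> : X - (X * (s - q) + q * X / s) = X * (s - q) * (1 - s) / s.
  by field; rewrite gt_eqF.
rewrite divr_ge0 ?(ltW s0)// mulr_ge0//; last by move: s01; lra.
by rewrite mulr_ge0// /s; move: q_lt1; lra.
Qed.

(** The error bound in the last clause depends on the coefficients only through [B], [c] and [y2]:
    for a family of coefficients the solution is a uniform limit of finite expressions, hence
    continuous in the parameter. *)
Lemma ksq_solve h m : nle h m -> exists u,
  [/\ nle u (4 * m / (c + y2) ^+ 2), forall n, K u n = h n &
    forall J n, `|S h J n - u n| <= t * Num.sqrt m / (1 - r) * r ^+ J].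
Proof.
move=> hm; have /andP[r0 r1] := neumann_rate_bounds.
set C := t * Num.sqrt m / (1 - r).
have C0 : 0 <= C.
  by rewrite divr_ge0 ?mulr_ge0 ?sqrtr_ge0 ?subr_ge0 ?(ltW t_gt0) ?(ltW r1).
have SE n : (fun J => S h J n) = series (fun j => t * pw h j n).
  by apply/funext => J; rewrite /series /= big_mkord.
have Scvg n : cvg ((fun J => S h J n) @ \oo).
  rewrite SE; apply: normed_cvg.
  apply: (@series_le_cvg _ _ (geometric (t * Num.sqrt m) r)) => [j|j|j|].
  - exact: normr_ge0.
  - by rewrite /geometric /= !mulr_ge0 ?exprn_ge0 ?sqrtr_ge0 ?(ltW t_gt0).
  - rewrite /geometric /= normrM (gtr0_norm t_gt0) -mulrA ler_pM2l//.
    by rewrite [leRHS]mulrC pw_term.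
  - by apply: is_cvg_geometric_series; rewrite ger0_norm.
pose u n := lim ((fun J => S h J n) @ \oo).
have Su n : (fun J => S h J n) @ \oo --> u n by exact: Scvg.
exists u; split.
- move=> N; have : (fun J => wsum N (fun n => S h J n ^+ 2)) @ \oo -->
      wsum N (fun n => u n ^+ 2).
    apply: cvg_big => [|i _]; first exact: add_continuous.
    by apply: (@cvgM _ _ _ _ (fun J => S h J (i%:Z - N%:Z))); exact: Su.
  by move=> /cvgr_to_le; apply; apply: nearW => J; exact: nle_S.
- move=> n.
  have Lc (f : nat -> int -> R) (g : int -> R) : (forall n, (fun J => f J n) @ \oo --> g n) ->
      forall n, (fun J => L (f J) n) @ \oo --> L g n.
    move=> fg k; apply: cvgD; last by apply: cvgM; [exact: cvg_cst|exact: fg].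
    by apply: cvgD; exact: fg.
  have H1 : (fun J => K (S h J) n) @ \oo --> K u n.
    apply: cvgD; last by apply: cvgM; [exact: cvg_cst|exact: Su].
    by apply: (Lc (fun J => L (S h J))); apply: Lc.
  have H2 : (fun J => K (S h J) n) @ \oo --> h n.
    under eq_fun do rewrite K_S.
    suff : (fun J => h n - pw h J n) @ \oo --> h n - 0 by rewrite subr0.
    apply: cvgB; first exact: cvg_cst.
    apply/norm_cvg0P/(@squeeze_cvgr _ _ _ _ (fun=> 0) (fun J => r ^+ J * Num.sqrt m)).
    + by apply: nearW => J; rewrite normr_ge0 pw_term.
    + exact: cvg_cst.
    + exact: rate_cvg0.
  exact: (cvg_unique (@Rhausdorff R) H1 H2).
- move=> J n; rewrite distrC.
  have : (fun J' => `|S h J' n - S h J n|) @ \oo --> `|u n - S h J n|.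
    by apply: cvg_norm; apply: cvgB; [exact: Su|exact: cvg_cst].
  move=> /cvgr_to_le; apply; exists J => //= J' JJ'.
  by rewrite -(subnKC JJ'); exact: S_dist.
Qed.

(** A solution of [K u = 0] is fixed by [P], whose iterates tend to 0. *)
Lemma ksq_inj u m : nle u m -> (forall n, K u n = 0) -> forall n, u n = 0.
Proof.
move=> um Ku n; have uP j : pw u j = u.
  by elim: j => //= j ->; apply/funext => k; rewrite /P Ku mulr0 subr0.
apply/eqP; rewrite -normr_le0; apply: (cvgr_to_ge (rate_cvg0 (Num.sqrt m))).
by apply: nearW => j; have := pw_term j n um; rewrite uP.
Qed.

End Jacobi.

(** * Invertibility of operators on complex square-summable sequences *)

Section SquareSummable.
Variable R : realType.
Local Notation C := R[i].
Implicit Types (psi phi h : int -> C) (z w : C).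

Definition sqmod z : R := complex.Re z ^+ 2 + complex.Im z ^+ 2.

Lemma sqmodE z : Normc.normc z ^+ 2 = sqmod z.
Proof. by case: z => x y; rewrite /Normc.normc sqr_sqrtr// addr_ge0 ?sqr_ge0. Qed.

Lemma sqmod_ge0 z : 0 <= sqmod z.
Proof. by rewrite addr_ge0 ?sqr_ge0. Qed.

Lemma sqmodM z w : sqmod (z * w) = sqmod z * sqmod w.
Proof. by case: z => a b; case: w => x y; rewrite /sqmod /=; ring. Qed.

Lemma sqmodD_le z w : sqmod (z + w) <= 2 * (sqmod z + sqmod w).
Proof.
case: z => a b; case: w => x y; rewrite /sqmod /= -subr_ge0.
rewrite (_ : _ - _ = (a - x) ^+ 2 + (b - y) ^+ 2); first by rewrite addr_ge0 ?sqr_ge0.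
by ring.
Qed.

Definition nlec psi (m : R) := forall N, wsum N (fun n => sqmod (psi n)) <= m.

Lemma nlec_ge0 psi m : nlec psi m -> 0 <= m.
Proof. by move=> /(_ 0%N); apply: le_trans; apply: wsum_ge0 => n; exact: sqmod_ge0. Qed.

Lemma nlec_Re psi m : nlec psi m -> nle (fun n => complex.Re (psi n)) m.
Proof.
move=> h N; apply: le_trans (h N); apply: ler_wsum => n.
by rewrite lerDl sqr_ge0.
Qed.

Lemma nlec_Im psi m : nlec psi m -> nle (fun n => complex.Im (psi n)) m.
Proof.
move=> h N; apply: le_trans (h N); apply: ler_wsum => n.
by rewrite lerDr sqr_ge0.
Qed.

Lemma nlec_mk psi m m' : nle (fun n => complex.Re (psi n)) m ->
  nle (fun n => complex.Im (psi n)) m' -> nlec psi (m + m').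
Proof. by move=> h h' N; rewrite wsumD lerD. Qed.

Lemma nlec_lin (a : C) psi phi m m' : nlec psi m -> nlec phi m' ->
  nlec (fun n => a * psi n + phi n) (2 * (sqmod a * m + m')).
Proof.
move=> h h' N; apply: (@le_trans _ _ (wsum N (fun n => 2 * (sqmod a * sqmod (psi n) + sqmod (phi n))))).
  by apply: ler_wsum => n; rewrite (le_trans (sqmodD_le _ _))// sqmodM.
by rewrite wsumZ wsumD wsumZ ler_pM2l// lerD// ler_wpM2l// sqmod_ge0.
Qed.

Let window (N : nat) : seq int := [seq i%:Z - N%:Z | i <- index_iota 0 N.*2.+1].

Let window_uniq N : uniq (window N).
Proof.
by rewrite map_inj_in_uniq ?iota_uniq// => i j _ _ /eqP; rewrite subr_eq subrK => /eqP [].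
Qed.

Let mem_window N (n : int) : (n \in window N) = (`|n| <= N)%N.
Proof.
apply/mapP/idP => [[i ] | nN]; first by rewrite mem_index_iota => iN ->; lia.
exists (absz (n + N%:Z)); rewrite ?mem_index_iota; lia.
Qed.

Let wsum_window N (u : int -> R) :
  (\sum_(n \in [set` window N]) (u n)%:E)%E = (wsum N u)%:E.
Proof. by rewrite -fsbig_seq// big_map sumEFin big_mkord. Qed.

(** The norm is a supremum over finite sets of integers, and each finite set lies in a symmetric
    window. *)
Lemma l2norm2_le psi m : (l2norm2 psi <= m%:E)%E <-> nlec psi m.
Proof.
rewrite /l2norm2; split => [h N|h].
  rewrite -lee_fin -wsum_window; apply: le_trans h.
  apply: esum_ge; exists [set` window N]; first by split => //; exact: finite_seq.
  by under eq_fsbigr do rewrite -sqmodE.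
apply: ge_ereal_sup => _ [A [fA _] <-].
have /finite_seqP[s As] := fA.
pose N := (\max_(n <- s) absz n)%N.
apply: (@le_trans _ _ (\sum_(n \in [set` window N]) (sqmod (psi n))%:E)%E); last first.
  by rewrite wsum_window lee_fin.
under eq_fsbigr do rewrite sqmodE.
apply: lee_fsum_nneg_subset => //; first exact: finite_seq.
  move=> n; rewrite As !inE /= mem_window /N => ns.
  exact: (@leq_bigmax_seq _ _ xpredT absz).
by move=> n _; rewrite lee_fin sqmod_ge0.
Qed.

Lemma l2P psi : l2 psi <-> exists m, nlec psi m.
Proof.
rewrite /l2 /=; split => [h|[m /l2norm2_le h]]; last exact: le_lt_trans h (ltry _).
have h0 : (0 <= l2norm2 psi)%E by apply: esum_ge0 => n _; rewrite lee_fin sqr_ge0.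
have hf : l2norm2 psi \is a fin_num by rewrite ge0_fin_numE.
by exists (fine (l2norm2 psi)); apply/l2norm2_le; rewrite fineK.
Qed.

(** The inverse chooses a solution for each right-hand side; injectivity makes the choice unique
    among square-summable sequences, and linearity and the norm bound follow from uniqueness. *)
Lemma l2_invertible_of_solve (Lop : (int -> C) -> int -> C) (M : R) :
  (forall a phi psi n, Lop (fun n => a * phi n + psi n) n = a * Lop phi n + Lop psi n) ->
  (forall psi, l2 psi -> l2 (Lop psi)) ->
  (forall h m, nlec h m -> exists psi, nlec psi (M * m) /\ forall n, Lop psi n = h n) ->
  (forall psi, l2 psi -> (forall n, Lop psi n = 0) -> forall n, psi n = 0) ->
  l2_invertible Lop.
Proof.
move=> lin l2L solve inj.
have uniq_sol psi phi : l2 psi -> l2 phi -> (forall n, Lop psi n = Lop phi n) -> psi = phi.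
  move=> /l2P[m hm] /l2P[m' hm'] e; apply/funext => n; apply/eqP; rewrite -subr_eq0.
  have := inj (fun n => (-1) * phi n + psi n) _ _ n.
  rewrite mulN1r addrC => ->//; first by apply/l2P; eexists; exact: nlec_lin hm' hm.
  by move=> k; rewrite lin e mulN1r addNr.
pose B h := xget h [set psi | l2 psi /\ forall n, Lop psi n = h n].
have BP h : l2 h -> l2 (B h) /\ forall n, Lop (B h) n = h n.
  move=> /l2P[m hm]; have [psi [hpsi psih]] := solve h m hm.
  by apply: (@xgetPex _ h [set psi | l2 psi /\ _]); exists psi; split => //; apply/l2P; eexists; exact: hpsi.
exists B; last first.
  move=> psi hpsi; split; first by apply/funext; exact: (BP psi hpsi).2.
  have := BP _ (l2L _ hpsi) => -[h1 h2]; exact: uniq_sol.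
split => [psi /BP[]//|a phi psi hphi hpsi|].
  have [h1 h2] := BP _ hphi; have [h3 h4] := BP _ hpsi.
  have l2lin f g : l2 f -> l2 g -> l2 (fun n => a * f n + g n).
    move=> /l2P[m hm] /l2P[m' hm']; apply/l2P; eexists; exact: nlec_lin hm hm'.
  have [h5 h6] := BP _ (l2lin _ _ hphi hpsi).
  apply: uniq_sol => //; first exact: l2lin.
  by move=> n; rewrite h6 lin h2 h4.
exists M => psi hpsi; have [h1 h2] := BP _ hpsi.
have h0 : (0 <= l2norm2 psi)%E by apply: esum_ge0 => n _; rewrite lee_fin sqr_ge0.
have hf : l2norm2 psi \is a fin_num by rewrite ge0_fin_numE.
rewrite -(fineK hf) -EFinM; apply/l2norm2_le.
have /solve[chi [hchi chiE]] : nlec psi (fine (l2norm2 psi)).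
  by apply/l2norm2_le; rewrite fineK.
by rewrite (uniq_sol (B psi) chi)// ?h2//; [apply/l2P; eexists; exact: hchi|move=> n; rewrite h2].
Qed.

End SquareSummable.

Section SpectrumCriterion.
Variables (R : realType) (V : int -> R) (Bv : R) (VB : forall n, `|V n| <= Bv).
Local Notation C := R[i].
Implicit Types (psi phi h : int -> C).

Definition hop psi (n : int) : C := psi (n - 1) + psi (n + 1) + (V n)%:C%C * psi n.

Definition coercive (E c : R) := forall N (phi : int -> R), supp N phi ->
  c * wsum N (fun n => phi n ^+ 2) <=
  wsum N.+1 (fun n => jacobi (fun k => V k - E) phi n ^+ 2).

Let bound (E : R) n : `|V n - E| <= Bv + `|E|.
Proof. by rewrite (le_trans (ler_normB _ _))// lerD2r. Qed.

Let hop_Re z psi n : complex.Re (hop psi n - z * psi n) =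
  jacobi (fun k => V k - complex.Re z) (fun k => complex.Re (psi k)) n +
  complex.Im z * complex.Im (psi n).
Proof.
case: z => x y; rewrite /hop /jacobi.
by case: (psi (n - 1)) => ? ?; case: (psi (n + 1)) => ? ?; case: (psi n) => ? ? /=; ring.
Qed.

Let hop_Im z psi n : complex.Im (hop psi n - z * psi n) =
  jacobi (fun k => V k - complex.Re z) (fun k => complex.Im (psi k)) n -
  complex.Im z * complex.Re (psi n).
Proof.
case: z => x y; rewrite /hop /jacobi.
by case: (psi (n - 1)) => ? ?; case: (psi (n + 1)) => ? ?; case: (psi n) => ? ? /=; ring.
Qed.

Lemma l2_hop z psi : l2 psi -> l2 (fun n => hop psi n - z * psi n).
Proof.
move=> /l2P[m hm]; apply/l2P; eexists; apply: nlec_mk.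
  under eq_fun do rewrite hop_Re.
  apply: nleD; first exact: (nle_jacobi (bound (complex.Re z)) (nlec_Re hm)).
  exact: nleZ (nlec_Im hm).
under eq_fun do rewrite hop_Im -mulNr.
apply: nleD; first exact: (nle_jacobi (bound (complex.Re z)) (nlec_Im hm)).
exact: nleZ (nlec_Re hm).
Qed.

(** Write [z = x + i y] and let [L] be the real operator at energy [x]. The inverse of [L - i y] is
    [(L + i y) (L^2 + y^2)^-1], where the second factor is real and acts separately on real and
    imaginary parts, giving [k1] and [k2]. Allowing [c = 0] covers nonreal [z], where [y ^ 2] alone
    is positive. *)
Lemma coercive_invertible z (c : R) : 0 <= c -> 0 < c + complex.Im z ^+ 2 ->
  coercive (complex.Re z) c -> l2_invertible (fun psi n => hop psi n - z * psi n).
Proof.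
move=> c0 cy LB; set x := complex.Re z; set y := complex.Im z.
pose b k := V k - x; pose B := Bv + `|x|.
have bB n : `|b n| <= B by exact: bound.
have y20 : 0 <= y ^+ 2 by exact: sqr_ge0.
have sol := ksq_solve bB c0 y20 cy LB.
have inj := ksq_inj bB c0 y20 cy LB.
pose D := c + y ^+ 2.
pose M1 := 4 / D ^+ 2.
apply: (@l2_invertible_of_solve _ _ (4 * (Lam B * M1 + y ^+ 2 * M1))).
- move=> a phi psi n; rewrite /hop; ring.
- by move=> psi; exact: l2_hop.
- move=> h m hm.
  have [k1 [k1m k1h _]] := sol _ _ (nlec_Re hm).
  have [k2 [k2m k2h _]] := sol _ _ (nlec_Im hm).
  have e1 n : complex.Re (h n) = jacobi b (jacobi b k1) n + y ^+ 2 * k1 n by rewrite -k1h.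
  have e2 n : complex.Im (h n) = jacobi b (jacobi b k2) n + y ^+ 2 * k2 n by rewrite -k2h.
  exists (fun n => (jacobi b k1 n + (- y) * k2 n) +i* (jacobi b k2 n + y * k1 n))%C.
  split.
    have -> : 4 * (Lam B * M1 + y ^+ 2 * M1) * m =
        2 * (Lam B * (4 * m / D ^+ 2) + (- y) ^+ 2 * (4 * m / D ^+ 2)) +
        2 * (Lam B * (4 * m / D ^+ 2) + y ^+ 2 * (4 * m / D ^+ 2)).
      by rewrite sqrrN /M1; set d := D ^- 2; ring.
    apply: nlec_mk => /=.
      by apply: nleD; [exact: nle_jacobi|exact: nleZ].
    by apply: nleD; [exact: nle_jacobi|exact: nleZ].
  move=> n; set psi := (X in hop X n).
  suff : complex.Re (hop psi n - z * psi n) = complex.Re (h n) /\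
      complex.Im (hop psi n - z * psi n) = complex.Im (h n).
    by case: (hop psi n - _) => ? ?; case: (h n) => ? ? /= [-> ->].
  rewrite hop_Re hop_Im e1 e2 /psi /= /jacobi -/x -/y /b; split; ring.
- move=> psi /l2P[m hm] psi0.
  have r1 n : jacobi b (fun k => complex.Re (psi k)) n = - (y * complex.Im (psi n)).
    have := hop_Re z psi n; rewrite psi0 /= -/x -/y => /esym/eqP.
    by rewrite addr_eq0 => /eqP.
  have r2 n : jacobi b (fun k => complex.Im (psi k)) n = y * complex.Re (psi n).
    have := hop_Im z psi n; rewrite psi0 /= -/x -/y => /esym/eqP.
    by rewrite subr_eq0 => /eqP.
  have z1 := inj _ _ (nlec_Re hm); have z2 := inj _ _ (nlec_Im hm).
  move=> n; have : complex.Re (psi n) = 0 /\ complex.Im (psi n) = 0.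
    split.
      apply: z1 => k; rewrite /ksq (_ : jacobi b (fun k => complex.Re (psi k)) = fun k => (- y) * complex.Im (psi k) + 0 * complex.Im (psi k)).
        by rewrite (jacobi_lin b (- y) 0 (fun k => complex.Im (psi k))) r2; ring.
      by apply/funext => l; rewrite r1; ring.
    apply: z2 => k; rewrite /ksq (_ : jacobi b (fun k => complex.Im (psi k)) = fun k => y * complex.Re (psi k) + 0 * complex.Re (psi k)).
      by rewrite jacobi_lin r1; ring.
    by apply/funext => l; rewrite r2; ring.
  by case: (psi n) => ? ? /= [-> ->].
Qed.

Lemma invertible_coercive (E : R) :
  l2_invertible (fun psi n => hop psi n - E%:C%C * psi n) ->
  exists2 c, 0 < c & coercive E c.
Proof.
(* The maximum with 1 makes the constant positive whatever the sign of [M]. *)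
move=> [B [_ _ [M BM]] inv]; exists (Num.max M 1)^-1.
  by rewrite invr_gt0 lt_max ltr01 orbT.
move=> N phi sphi; have M0 : 0 < Num.max M 1 by rewrite lt_max ltr01 orbT.
rewrite mulrC ler_pdivrMr// mulrC.
pose psi n := (phi n)%:C%C.
have hpsi : l2 psi.
  apply/l2P; exists (wsum N (fun n => phi n ^+ 2) + 0); apply: nlec_mk => /=.
    move=> K; have [KN|/ltnW NK] := leqP K N; first by apply: le_wsum => // n; exact: sqr_ge0.
    by rewrite (@wsum_supp _ N K) => // n nN; rewrite sphi ?expr0n.
  by move=> K; rewrite /wsum big1// => i _; rewrite expr0n.
have [_ Bpsi] := inv _ hpsi.
set L := jacobi _ phi; set m := wsum N.+1 _.
have Lm : nlec (fun n => hop psi n - E%:C%C * psi n) m.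
  rewrite -[m]addr0; apply: nlec_mk; under eq_fun do rewrite ?hop_Re ?hop_Im /=.
    move=> K; under eq_wsum do rewrite mul0r addr0.
    have [KN|/ltnW NK] := leqP K N.+1; first by apply: le_wsum => // n; exact: sqr_ge0.
    by rewrite (@wsum_supp _ N.+1 K) => // n nN;
      rewrite [X in X ^+ 2](_ : _ = 0) ?expr0n//; exact: supp_jacobi sphi _ nN.
  by move=> K; rewrite /wsum big1// => i _; rewrite /jacobi; ring.
have m0 := nlec_ge0 Lm.
have := BM _ (l2_hop E%:C%C hpsi); rewrite Bpsi => h.
have : (l2norm2 psi <= (Num.max M 1 * m)%:E)%E.
  apply: le_trans h _; have h1 := (l2norm2_le _ m).2 Lm.
  apply: (@le_trans _ _ ((Num.max M 1)%:E * l2norm2 (fun n => (hop psi n - E%:C%C * psi n)%R))%E).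
    apply: lee_wpmul2r; last by rewrite lee_fin le_max lexx.
    by apply: esum_ge0 => n _; rewrite lee_fin sqr_ge0.
  by rewrite EFinM; apply: lee_wpmul2l => //; rewrite lee_fin ltW.
by move=> /l2norm2_le/nlec_Re/(_ N).
Qed.

End SpectrumCriterion.

(** * The decaying line in a gap *)

Section Green.
Variables (R : realType) (Z : topologicalType) (b : Z -> int -> R) (B c : R).
Hypothesis b_cont : forall n, continuous (fun z => b z n).
Hypothesis b_bound : forall z n, `|b z n| <= B.
Hypothesis c0 : 0 < c.
Hypothesis LB : forall z N (phi : int -> R), supp N phi ->
  c * wsum N (fun n => phi n ^+ 2) <= wsum N.+1 (fun n => jacobi (b z) phi n ^+ 2).

Let delta (n : int) : R := (n == 0)%:R.

Let jacobi_cont (u : Z -> int -> R) : (forall n, continuous (fun z => u z n)) ->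
  forall n, continuous (fun z => jacobi (b z) (u z) n).
Proof.
move=> uc n z; apply: cvgD; first by apply: cvgD; exact: uc.
by apply: cvgM; [exact: b_cont|exact: uc].
Qed.

Let neumann_cont J n : continuous (fun z => neumann_sum (b z) B 0 delta J n).
Proof.
move=> z; apply: cvg_big => [|[j /= _] _]; first exact: add_continuous.
apply: cvgM; first exact: cvg_cst.
elim: j n z => [|j IH] n z /=; first exact: cvg_cst.
apply: cvgB; first exact: IH.
apply: cvgM; first exact: cvg_cst.
apply: cvgD; last by apply: cvgM; [exact: cvg_cst|exact: IH].
by apply: (jacobi_cont (u := fun z => jacobi (b z) _)); apply: jacobi_cont.
Qed.

(** With [y2 = 0] the previous section solves [L (L u) = delta], so [L u] is the Green function.
    Each Neumann sum depends on finitely many coefficients, hence continuously on [z], and the rate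
    of convergence does not depend on [z]. *)
Lemma green_exists : exists g : Z -> int -> R,
  [/\ forall n, continuous (fun z => g z n), forall z, exists m, nle (g z) m &
    forall z n, jacobi (b z) (g z) n = (n == 0)%:R].
Proof.
have hd : nle delta 1.
  move=> N; rewrite (_ : 1 = wsum 0 (fun n => delta n ^+ 2)); last first.
    by rewrite /wsum big_ord1 subrr /delta eqxx expr1n.
  rewrite (@wsum_supp _ 0 N)// => n n0; rewrite /delta.
  by case: eqP n0 => [->|]// _ _; rewrite expr0n.
have c0' : 0 < c + 0 by rewrite addr0.
pose r := neumann_rate B c (0 : R).
have /andP[r0 r1] : 0 <= r < 1 := neumann_rate_bounds B (lexx 0) c0'.
pose C := (Lam B + 2 * 0)^-1 * Num.sqrt 1 / (1 - r) : R.
have sol z : exists u, [/\ nle u (4 * 1 / (c + 0) ^+ 2),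
    forall n, ksq (b z) 0 u n = delta n &
    forall J n, `|neumann_sum (b z) B 0 delta J n - u n| <= C * r ^+ J].
  exact: (ksq_solve (b_bound z) (ltW c0) (lexx 0) c0' (@LB z) hd).
pose u z := projT1 (cid (sol z)).
have uP z : [/\ nle (u z) (4 * 1 / (c + 0) ^+ 2), forall n, ksq (b z) 0 (u z) n = delta n &
    forall J n, `|neumann_sum (b z) B 0 delta J n - u z n| <= C * r ^+ J].
  by rewrite /u; case: cid.
have uc n : continuous (fun z => u z n).
  move=> z; apply/cvgrPdist_lt => e e0.
  have : (fun J => C * r ^+ J) @ \oo --> C * 0.
    apply: cvgM; first exact: cvg_cst.
    by apply: cvg_expr; rewrite ger0_norm.
  rewrite mulr0 => /cvgr0Pnorm_lt /(_ (e / 3)) [|J _ /(_ J (leqnn J)) /= CJ].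
    by rewrite divr_gt0.
  have {}CJ : C * r ^+ J < e / 3 := le_lt_trans (ler_norm _) CJ.
  have /cvgrPdist_lt /(_ (e / 3)) := @neumann_cont J n z.
  move=> /(_ (divr_gt0 e0 (ltr0Sn _ 2))); apply: filterS => z' h.
  have [_ _ /(_ J n) h1] := uP z; have [_ _ /(_ J n) h2] := uP z'.
  rewrite (_ : u z n - u z' n = - (neumann_sum (b z) B 0 delta J n - u z n) +
    ((neumann_sum (b z) B 0 delta J n - neumann_sum (b z') B 0 delta J n) +
    (neumann_sum (b z') B 0 delta J n - u z' n))); last by ring.
  apply: le_lt_trans (ler_normD _ _) _; rewrite normrN.
  apply: le_lt_trans (lerD (lexx _) (ler_normD _ _)) _.
  by move: h1 h2 h CJ; lra.
exists (fun z => jacobi (b z) (u z)); split.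
- by move=> n; exact: jacobi_cont.
- by move=> z; eexists; apply: (nle_jacobi (b_bound z)); case: (uP z) => h _ _; exact: h.
- by move=> z n; have [_ /(_ n) + _] := uP z; rewrite /ksq mul0r addr0.
Qed.

End Green.

Section Wronskian.
Variable R : realType.

Lemma nle_cvg0 (u : int -> R) (m : R) : nle u m ->
  (fun k : nat => u k%:Z) @ \oo --> (0 : R) /\ (fun k : nat => u (- k%:Z)) @ \oo --> (0 : R).
Proof.
move=> um; have H (v : nat -> R) :
    (forall N, \sum_(k < N.+1) v k ^+ 2 <= wsum N (fun n => u n ^+ 2)) -> v @ \oo --> (0 : R).
  move=> vu; have : cvgn (series (fun k => v k ^+ 2)).
    apply: nondecreasing_is_cvgn.
      by apply: nondecreasing_series => k _ _; exact: sqr_ge0.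
    exists m => _ [N _ <-]; rewrite /series /= big_mkord.
    case: N => [|N]; first by rewrite big_ord0 (nle_ge0 um).
    exact: le_trans (vu N) (um N).
  move=> /cvg_series_cvg_0 h; apply/cvgr0Pnorm_lt => e e0.
  move/cvgr0Pnorm_lt : h => /(_ (e ^+ 2)) [|N _ NP]; first by rewrite exprn_gt0.
  exists N => // k Nk; have := NP k Nk => /=.
  by rewrite normrX ltr_sqr ?nnegrE// ltW.
split; apply: H; elim=> [|N IH].
- by rewrite /wsum !big_ord1 subrr.
- by rewrite wsumS big_ord_recr /= lerD// (le_trans IH)// lerDr sqr_ge0.
- by rewrite /wsum !big_ord1 subrr oppr0.
- rewrite wsumS big_ord_recr /= addrC -addrA lerD// (le_trans IH)// lerDl.
  exact: sqr_ge0.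
Qed.

Definition wronskian_null (beta psi phi : nat -> R) : Prop :=
  [/\ psi @ \oo --> (0 : R), phi @ \oo --> (0 : R),
    forall k, psi k + psi k.+2 = beta k * psi k.+1 &
    forall k, phi k + phi k.+2 = beta k * phi k.+1].

(** The Wronskian of two solutions of the same recurrence is constant, and here it tends to 0. *)
Lemma wronskian_eq0 beta psi phi : wronskian_null beta psi phi ->
  psi 0%N * phi 1%N = psi 1%N * phi 0%N.
Proof.
move=> [psi0 phi0 ePsi ePhi].
pose W k := psi k * phi k.+1 - psi k.+1 * phi k.
have WE k : W k = W 0%N.
  elim: k => // k <-; rewrite /W.
  have -> : psi k.+2 = beta k * psi k.+1 - psi k by rewrite -ePsi addrC addKr.
  have -> : phi k.+2 = beta k * phi k.+1 - phi k by rewrite -ePhi addrC addKr.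
  ring.
have shift (v : nat -> R) : v @ \oo --> (0 : R) -> (fun k => v k.+1) @ \oo --> (0 : R).
  by rewrite -(cvg_shiftS v (nbhs (0 : R))).
have : W @ \oo --> 0 * 0 - 0 * (0 : R).
  by apply: cvgB; apply: cvgM => //; exact: shift.
rewrite mul0r subrr (_ : W = fun=> W 0%N); last by apply/funext => k.
move=> W0; have : W 0%N = 0.
  by apply: (cvg_unique (@Rhausdorff R) _ W0); exact: cvg_cst.
by rewrite /W => /eqP; rewrite subr_eq0 => /eqP.
Qed.

(* [x] and [y] are the values at [0] and [-1] of a solution tending to [0] at [-oo];
   [psi k] is its value at [- k]. *)
Definition decays (bb : int -> R) (x y : R) := exists psi : nat -> R,
  [/\ psi 0%N = x, psi 1%N = y, psi @ \oo --> (0 : R) &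
    forall k, psi k + psi k.+2 = - bb (- k.+1%:Z) * psi k.+1].

Lemma decays_parallel bb x y x' y' : decays bb x y -> decays bb x' y' -> x * y' = y * x'.
Proof.
move=> [psi [<- <- p0 pE]] [phi [<- <- q0 qE]].
exact: (@wronskian_eq0 (fun k => - bb (- k.+1%:Z))).
Qed.

Lemma decays_step bb bb' x y : (forall n, bb' n = bb (n + 1)) -> decays bb x y ->
  decays bb' (- bb 0 * x - y) x.
Proof.
move=> bbE [psi [px py p0 pE]].
exists (fun k => if k is k'.+1 then psi k' else - bb 0 * x - y); split => //.
  by rewrite -(cvg_shiftS _ (nbhs (0 : R))).
case=> [|k]; first by rewrite px py bbE addNr subrK.
by rewrite pE bbE; congr (- bb _ * _); lia.
Qed.

Lemma green_decays bb g m : nle g m -> (forall n, (n < 0)%R -> jacobi bb g n = 0) ->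
  decays bb (g 0) (g (-1)).
Proof.
move=> gm gE; exists (fun k => g (- k%:Z)); split => //; first exact: (nle_cvg0 gm).2.
move=> k; have := gE (- k.+1%:Z) isT; rewrite /jacobi.
rewrite (_ : - k.+1%:Z - 1 = - k.+2%:Z); last by lia.
rewrite (_ : - k.+1%:Z + 1 = - k%:Z); last by lia.
by move=> /eqP; rewrite addr_eq0 mulNr => /eqP <-; rewrite addrC.
Qed.

End Wronskian.

(** * Winding of an invariant line field *)

Section LineAngle.
Variable R : realType.
Implicit Types x y a : R.

(** The two numbers are the real and imaginary parts of the sum of the squares [(p i + 'i s i)^2].
    Its squared modulus is [N^2 - 4 D^2], with [N] the total squared length and [D] the determinant
    of the two vectors; parallel vectors have [D = 0], so their squares cannot cancel. *)
Lemma line_angle_neq0 (p s : bool -> R) :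
  p true * s false = s true * p false -> (exists i, (p i != 0) || (s i != 0)) ->
  (p true ^+ 2 - s true ^+ 2 + (p false ^+ 2 - s false ^+ 2) != 0) ||
  (2 * (p true * s true + p false * s false) != 0).
Proof.
move=> par [i nz]; rewrite -negb_and; apply/negP => /andP[/eqP X0 /eqP Y0].
have : (p true ^+ 2 + s true ^+ 2 + (p false ^+ 2 + s false ^+ 2)) ^+ 2 = 0.
  transitivity ((p true ^+ 2 - s true ^+ 2 + (p false ^+ 2 - s false ^+ 2)) ^+ 2
    + (2 * (p true * s true + p false * s false)) ^+ 2
    + 4 * (p true * s false - s true * p false) ^+ 2); first by ring.
  by rewrite X0 Y0 par subrr !expr0n /= mulr0 !addr0.
move/eqP; rewrite sqrf_eq0 !paddr_eq0 ?addr_ge0 ?sqr_ge0// !sqrf_eq0.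
by move: nz; case: i => /orP[] /negbTE ->; rewrite ?andbF.
Qed.

(* The complex number [(p i + 'i s i)^2] only depends on the line spanned by
   [(p i, s i)] up to a positive factor, and its argument is twice that of the line. *)
Lemma line_angle (p s : bool -> R) a :
  p true * s false = s true * p false ->
  polar (p true ^+ 2 - s true ^+ 2 + (p false ^+ 2 - s false ^+ 2))
    (2 * (p true * s true + p false * s false)) (a *+ 2) ->
  forall i, p i * sin a = s i * cos a.
Proof.
move=> par [r r0 [eX eY]].
set c := cos a in eX eY *; set sn := sin a in eX eY *.
have cs : c ^+ 2 + sn ^+ 2 = 1 by exact: cos2Dsin2.
have X : p true ^+ 2 - s true ^+ 2 + (p false ^+ 2 - s false ^+ 2) = r * (c ^+ 2 - sn ^+ 2).
  by rewrite eX cos_mulr2n -/c -cs; ring.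
have Y : 2 * (p true * s true + p false * s false) = r * (2 * c * sn).
  by rewrite eY sin_mulr2n -/c -/sn; ring.
set N := p true ^+ 2 + s true ^+ 2 + (p false ^+ 2 + s false ^+ 2).
have N0 : 0 <= N by rewrite !addr_ge0 ?sqr_ge0.
have rN : r = N.
  apply/eqP; rewrite -(eqrXn2 (n := 2)) ?(ltW r0)//; apply/eqP.
  transitivity ((r * (c ^+ 2 - sn ^+ 2)) ^+ 2 + (r * (2 * c * sn)) ^+ 2).
    by transitivity (r ^+ 2 * (c ^+ 2 + sn ^+ 2) ^+ 2); [rewrite cs expr1n mulr1|ring].
  rewrite -X -Y.
  transitivity (N ^+ 2 - 4 * (p true * s false - s true * p false) ^+ 2).
    by rewrite /N; ring.
  by rewrite par subrr expr0n mulr0 subr0.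
have : (p true * sn - s true * c) ^+ 2 + (p false * sn - s false * c) ^+ 2 = 0.
  transitivity (N * (c ^+ 2 + sn ^+ 2) / 2 - (c ^+ 2 - sn ^+ 2) *
    (p true ^+ 2 - s true ^+ 2 + (p false ^+ 2 - s false ^+ 2)) / 2 -
    c * sn * (2 * (p true * s true + p false * s false))).
    by rewrite /N; field.
  rewrite X Y -rN.
  transitivity (r * (c ^+ 2 + sn ^+ 2) / 2 * (1 - (c ^+ 2 + sn ^+ 2))); first by field.
  by rewrite cs subrr mulr0.
move/eqP; rewrite paddr_eq0 ?sqr_ge0// !sqrf_eq0 !subr_eq0 => /andP[/eqP h1 /eqP h2].
by case.
Qed.

Lemma on_line x y a : x * sin a = y * cos a ->
  exists r, x = r * cos a /\ y = r * sin a.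
Proof.
move=> e; have cs := cos2Dsin2 a; exists (x * cos a + y * sin a); split.
  transitivity (x * cos a ^+ 2 + (y * cos a) * sin a); last by ring.
  by rewrite -e -[LHS]mulr1 -cs; ring.
transitivity ((x * sin a) * cos a + y * sin a ^+ 2); last by ring.
by rewrite e -[LHS]mulr1 -cs; ring.
Qed.

Lemma line_angle_uniq x y x' y' a a' : x * sin a = y * cos a -> x' * sin a' = y' * cos a' ->
  (x != 0) || (y != 0) -> (x' != 0) || (y' != 0) -> x * y' = y * x' ->
  exists k : int, a - a' = k%:~R * pi.
Proof.
move=> /on_line[r [ex ey]] /on_line[r' [ex' ey']].
have nz u v (q t : R) : (u != 0) || (v != 0) -> u = q * cos t -> v = q * sin t -> q != 0.
  by move=> + uE vE; apply: contraTneq => q0; rewrite uE vE q0 !mul0r eqxx.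
move=> /nz/(_ ex ey) r0 /nz/(_ ex' ey') r'0; rewrite ex ey ex' ey' => h.
apply: sin_eq0; rewrite sinB; apply: (mulfI (mulf_neq0 r0 r'0)).
rewrite mulr0; transitivity (r * sin a * (r' * cos a') - r * cos a * (r' * sin a')).
  by ring.
by rewrite -h subrr.
Qed.

(** The sine of [G] vanishes at all times or at none: [G] then stays at one multiple of [pi], or
    inside one interval between consecutive multiples. This is used along the shear, which moves no
    line onto or off the horizontal axis. *)
Lemma path_stays_between_zeros (G : R -> R) (k : int) (t0 t1 : R) : t0 <= t1 ->
  (forall t, {for t, continuous G}) ->
  (forall t, t0 <= t <= t1 -> (sin (G t) == 0) = (sin (G t0) == 0)) ->
  (k%:~R * pi < G t0 -> k%:~R * pi < G t1) /\ (G t0 < k%:~R * pi -> G t1 < k%:~R * pi) /\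
  (G t0 = k%:~R * pi -> G t1 = k%:~R * pi).
Proof.
move=> t01 Gc Gs.
have Gc' : {within `[t0, t1], continuous G} by apply: continuous_subspaceT.
have sink : sin (k%:~R * pi) = 0 :> R.
  have H (n : nat) : sin (n%:R * pi) = 0 :> R.
    by rewrite -[_ * _]add0r mulr_natl (alternatingn (@sinDpi R)) sin0 mulr0.
  by case: k => n; [exact: H|rewrite NegzE mulrNz mulNr sinN H oppr0].
have [s0|s0] := boolP (sin (G t0) == 0).
  suff -> : G t1 = G t0 by [].
  have := @continuous_discrete_path R (fun t => G (t0 + t * (t1 - t0))) pi (pi_gt0 R).
  rewrite mul1r mul0r addr0 subrKC; apply => t /andP[h0 h1].
    apply: (@continuous_comp R R R (fun t => t0 + t * (t1 - t0)) G); last exact: Gc.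
    by apply: cvgD; [exact: cvg_cst|apply: cvgM; [exact: cvg_id|exact: cvg_cst]].
  apply: sin_eq0; apply/eqP; rewrite Gs ?s0//.
  rewrite lerDl mulr_ge0 ?subr_ge0//= addrC -lerBrDr ler_piMl// subr_ge0//.
have noc t : t0 <= t <= t1 -> G t != k%:~R * pi.
  move=> tt; apply/negP => /eqP Gt; move: s0; rewrite -(Gs t tt) Gt sink eqxx//.
split; last split.
- move=> lt0; rewrite ltNge; apply/negP => le1.
  have [|t] := @IVT _ G t0 t1 (k%:~R * pi) t01 Gc'.
    by rewrite ge_min le_max le1 (ltW lt0) orbT.
  by rewrite in_itv /= => /noc/eqP.
- move=> lt0; rewrite ltNge; apply/negP => le1.
  have [|t] := @IVT _ G t0 t1 (k%:~R * pi) t01 Gc'.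
    by rewrite ge_min le_max le1 (ltW lt0) orbT.
  by rewrite in_itv /= => /noc/eqP.
- by move=> e; have := noc t0; rewrite lexx t01 e eqxx => /(_ isT).
Qed.

End LineAngle.

Section LineBundle.
Variables (R : realType) (d : nat) (A : 'M[int]_d).
Hypothesis A1 : ~~ eigenvalue (map_mx intr A : 'M[R[i]]_d) 1.
Local Notation V := 'cV[R]_d.
Local Notation AR := (map_mx intr A : 'M[R]_d).
Variables (x y : bool -> V -> R) (e : V -> R).
Hypotheses (xc : forall i, continuous (x i)) (yc : forall i, continuous (y i)).
Hypothesis ec : continuous e.
Hypotheses (xp : forall i v k, x i (v + map_mx intr k) = x i v)
  (yp : forall i v k, y i (v + map_mx intr k) = y i v)
  (ep : forall v k, e (v + map_mx intr k) = e v).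
Hypothesis par : forall v, x true v * y false v = y true v * x false v.
Hypothesis nz : forall v, exists i, (x i v != 0) || (y i v != 0).
Hypothesis inv : forall i j v,
  (e v * x i v - y i v) * y j (AR *m v) = x i v * x j (AR *m v).

Let al (t : R) : R := pi / 2 * Num.min t 1.
Let ta v (t : R) : R := e v * Num.max (t - 1) 0.
(* [(p i, s i)] at [(v, t)] is the image of [(x i v, y i v)] under the rotation of
   angle [al t] followed by the shear of slope [ta v t]; at [t = 2] this is the
   transfer matrix [[e v, -1], [1, 0]]. *)
Let s i (w : V * R) := sin (al w.2) * x i w.1 + cos (al w.2) * y i w.1.
Let p i (w : V * R) := cos (al w.2) * x i w.1 - sin (al w.2) * y i w.1
  + ta w.1 w.2 * s i w.

Let ps_par w : p true w * s false w = s true w * p false w.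
Proof.
rewrite /p; have cs := cos2Dsin2 (al w.2).
apply/eqP; rewrite -subr_eq0; apply/eqP.
transitivity ((cos (al w.2) ^+ 2 + sin (al w.2) ^+ 2) *
  (x true w.1 * y false w.1 - y true w.1 * x false w.1)); first by rewrite /s; ring.
by rewrite par subrr mulr0.
Qed.

Let ps_nz w i : (x i w.1 != 0) || (y i w.1 != 0) -> (p i w != 0) || (s i w != 0).
Proof.
apply: contraTT; rewrite -!negb_and !negbK => /andP[/eqP p0 /eqP s0].
have cs := cos2Dsin2 (al w.2).
have q0 : cos (al w.2) * x i w.1 - sin (al w.2) * y i w.1 = 0.
  by move: p0; rewrite /p s0 mulr0 addr0.
apply/andP; split; apply/eqP.
  transitivity (cos (al w.2) * (cos (al w.2) * x i w.1 - sin (al w.2) * y i w.1)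
    + sin (al w.2) * s i w); last by rewrite q0 s0 !mulr0 addr0.
  by rewrite -[LHS]mul1r -cs /s; ring.
transitivity (cos (al w.2) * s i w - sin (al w.2) *
  (cos (al w.2) * x i w.1 - sin (al w.2) * y i w.1)); last by rewrite q0 s0 !mulr0 subr0.
by rewrite -[LHS]mul1r -cs /s; ring.
Qed.

Let fstc : continuous (fst : V * R -> V). Proof. by move=> w; exact: cvg_fst. Qed.
Let sndc : continuous (snd : V * R -> R). Proof. by move=> w; exact: cvg_snd. Qed.

Let alc : continuous (fun w : V * R => al w.2).
Proof.
move=> w; apply: cvgM; first exact: cvg_cst.
apply: (@continuous_comp _ _ _ snd (fun t : R => Num.min t 1)); first exact: sndc.
by apply: (@continuous_min R R id (fun=> 1)); [exact: cvg_id|exact: cvg_cst].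
Qed.

Let sc i : continuous (s i).
Proof.
move=> w; apply: cvgD; apply: cvgM.
- by apply: (@continuous_comp _ R R (fun w : V * R => al w.2) (@sin R)); [exact: alc|exact: continuous_sin].
- by apply: (@continuous_comp _ _ _ (fst : V * R -> V) (x i)); [exact: fstc|exact: xc].
- by apply: (@continuous_comp _ R R (fun w : V * R => al w.2) (@cos R)); [exact: alc|exact: continuous_cos].
- by apply: (@continuous_comp _ _ _ (fst : V * R -> V) (y i)); [exact: fstc|exact: yc].
Qed.

Let pc i : continuous (p i).
Proof.
move=> w; apply: cvgD; first apply: cvgB; try apply: cvgM.
- by apply: (@continuous_comp _ R R (fun w : V * R => al w.2) (@cos R)); [exact: alc|exact: continuous_cos].
- by apply: (@continuous_comp _ _ _ (fst : V * R -> V) (x i)); [exact: fstc|exact: xc].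
- by apply: (@continuous_comp _ R R (fun w : V * R => al w.2) (@sin R)); [exact: alc|exact: continuous_sin].
- by apply: (@continuous_comp _ _ _ (fst : V * R -> V) (y i)); [exact: fstc|exact: yc].
- apply: cvgM.
    by apply: (@continuous_comp _ _ _ (fst : V * R -> V) e); [exact: fstc|exact: ec].
  apply: (@continuous_comp _ _ _ (snd : V * R -> R) (fun t : R => Num.max (t - 1) 0)); first exact: sndc.
  apply: (@continuous_max R R (fun t => t - 1) (fun=> 0)); last exact: cvg_cst.
  by apply: cvgB; [exact: cvg_id|exact: cvg_cst].
- exact: sc.
Qed.

Lemma angle_lift : exists2 F : V * R -> R, continuous F &
  (forall w i, p i w * sin (F w) = s i w * cos (F w)) /\
  (forall v k t, F (v + map_mx intr k, t) = F (v, t)) /\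
  exists j : int, forall v, F (v, 2) = F (AR *m v, 0) + j%:~R * pi.
Proof.
pose X w := p true w ^+ 2 - s true w ^+ 2 + (p false w ^+ 2 - s false w ^+ 2).
pose Y w := 2 * (p true w * s true w + p false w * s false w).
have Xc : continuous X.
  by move=> w; apply: cvgD; apply: cvgB; apply: (@cvgM _ _ _ _ _ _ _ _); first [exact: pc|exact: sc].
have Yc : continuous Y.
  move=> w; apply: cvgM; first exact: cvg_cst.
  by apply: cvgD; apply: cvgM; first [exact: pc|exact: sc].
have XY0 w : (X w != 0) || (Y w != 0).
  apply: (@line_angle_neq0 _ (p ^~ w) (s ^~ w)); first exact: ps_par.
  by have [i h] := nz w.1; exists i; exact: ps_nz.
have [G Gc GP] := polar_lift (@shrink_continuous R d) (@shrink1 R d) (@shrink0 R d) Xc Yc XY0.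
pose F w := G w / 2.
have GF w : G w = F w *+ 2 by rewrite -mulr_natr /F divfK.
have Fc : continuous F by move=> w; apply: cvgM; [exact: Gc|exact: cvg_cst].
have FP w i : p i w * sin (F w) = s i w * cos (F w).
  by apply: (@line_angle _ (p ^~ w) (s ^~ w)); [exact: ps_par|rewrite -GF; exact: GP].
exists F => //; split => //.
apply: (degree_eq0 A1 (pi_gt0 R) Fc) => [v k t|v].
  have [i h] := nz v.
  have := ps_nz (w := (v, t)) h; have := ps_nz (w := (v + map_mx intr k, t)) (i := i).
  rewrite /= xp yp => /(_ h) h1 h2; apply: line_angle_uniq (FP _ i) (FP _ i) h1 h2 _.
  by rewrite /p /s /ta /= xp yp ep; ring.
have [i h] := nz v; have [j h'] := nz (AR *m v).
have h1 := ps_nz (w := (v, 2)) h; have h2 := ps_nz (w := (AR *m v, 0)) h'.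
apply: line_angle_uniq (FP _ i) (FP _ j) h1 h2 _.
have al2 : al 2 = pi / 2 by rewrite /al min_r ?mulr1// ler1n.
have al0 : al 0 = 0 by rewrite /al min_l ?mulr0.
have ta2 : ta v 2 = e v.
  by rewrite /ta max_l ?subr_ge0 ?ler1n// (_ : 2 - 1 = 1) ?mulr1//; ring.
have ta0 : ta (AR *m v) 0 = 0 by rewrite /ta max_r ?mulr0// subr_le0.
rewrite /p /s /= al2 al0 ta2 ta0 sin0 cos0 cos_pihalf sin_pihalf.
transitivity ((e v * x i v - y i v) * y j (AR *m v)); first by ring.
by rewrite inv; ring.
Qed.

(** The rotation part of the path adds exactly [pi / 2] to the angle, and the shear part cannot
    carry it across a multiple of [pi]. So the angle at [A v] is located relative to the multiples
    of [pi], although its value is not determined by that at [v]. The integer is opposite to the one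
    in [angle_lift], where the end of the path is expressed through [Phi (A v)]. *)
Lemma angle_cocycle : exists (Phi : V -> R) (j : int),
  [/\ continuous Phi, (forall v k, Phi (v + map_mx intr k) = Phi v),
    (exists C, forall v, `|Phi v| <= C),
    (forall v (k : int),
      [/\ k%:~R * pi < Phi v + pi / 2 -> (k + j)%:~R * pi < Phi (AR *m v),
        Phi v + pi / 2 < k%:~R * pi -> Phi (AR *m v) < (k + j)%:~R * pi &
        Phi v + pi / 2 = k%:~R * pi -> Phi (AR *m v) = (k + j)%:~R * pi]) &
    forall v, (e v * cos (Phi v) - sin (Phi v)) * sin (Phi (AR *m v)) =
      cos (Phi v) * cos (Phi (AR *m v))].
Proof.
have [F Fc [FP [Fp [j FA]]]] := angle_lift.
pose Phi v := F (v, 0).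
have al0 : al 0 = 0 by rewrite /al min_l ?mulr0.
have ta0 v : ta v 0 = 0 by rewrite /ta max_r ?mulr0// subr_le0.
have PhiP v i : x i v * sin (Phi v) = y i v * cos (Phi v).
  have := FP (v, 0) i; rewrite /p /s /= al0 ta0 sin0 cos0.
  by rewrite !mul0r !mul1r subr0 add0r addr0.
have Fvc v t : {for t, continuous (fun t => F (v, t))}.
  apply: (@continuous_comp _ _ _ (fun t : R => (v, t)) F); last exact: Fc.
  by apply: continuous_at_pair; [exact: cvg_cst|exact: cvg_id].
(* For [t] in [0, 1] the shear is trivial, so [F(v, t)] and [Phi v + pi / 2 * t] are angles of the
   same line and differ by a constant multiple of [pi]. *)
have F1 v : F (v, 1) = Phi v + pi / 2.
  have := @continuous_discrete_path R (fun t => F (v, t) - (Phi v + pi / 2 * t)) pi (pi_gt0 R).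
  rewrite mulr1 mulr0 addr0 subrr => h; apply/eqP; rewrite -subr_eq0; apply/eqP.
  apply: h => [t _|t /andP[t0 t1]].
    apply: cvgB; first exact: Fvc.
    by apply: cvgD; [exact: cvg_cst|apply: cvgM; [exact: cvg_cst|exact: cvg_id]].
  have [i h] := nz v; apply: (line_angle_uniq (FP (v, t) i)) (ps_nz (w := (v, t)) h) (ps_nz (w := (v, t)) h) _.
    have -> : pi / 2 * t = al t by rewrite /al min_l.
    have tat : ta v t = 0 by rewrite /ta max_r ?mulr0// subr_le0.
    rewrite /p /s /= tat mul0r addr0 sinD cosD.
    have [r [-> ->]] := on_line (PhiP v i).
    by rewrite /=; ring.
  by rewrite mulrC.
(* The line is horizontal exactly when both second coordinates vanish, and for [t >= 1] these no
   longer depend on [t]. *)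
have sin_s v t : (sin (F (v, t)) == 0) = (s true (v, t) == 0) && (s false (v, t) == 0).
  have [i h] := nz v.
  have [r [ep1 es1]] := on_line (FP (v, t) i).
  have r0 : r != 0.
    apply: contraTneq (ps_nz (w := (v, t)) h) => r0.
    by rewrite ep1 es1 r0 !mul0r eqxx.
  apply/idP/idP => [/eqP s0|/andP[/eqP s1 /eqP s2]].
    have c0 : cos (F (v, t)) != 0.
      apply: contraTneq (oner_neq0 R) => c0.
      by rewrite -(cos2Dsin2 (F (v, t))) c0 s0 expr0n /= addr0 eqxx.
    have H i' : s i' (v, t) == 0.
      by have /eqP := FP (v, t) i'; rewrite s0 mulr0 eq_sym mulf_eq0 (negbTE c0) orbF.
    by rewrite !H.
  have : s i (v, t) = 0 by case: i {h ep1 es1}.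
  by rewrite es1 => /eqP; rewrite mulf_eq0 (negbTE r0).
exists Phi, (- j); split.
- move=> v; apply: (@continuous_comp _ _ _ (fun v : V => (v, 0 : R)) F); last exact: Fc.
  by apply: (@continuous_at_pair V V R id (fun=> 0) v); [exact: cvg_id|exact: cst_continuous].
- by move=> v k; exact: Fp.
- have [C CP] := periodic_bounded 1 Fc Fp; exists C => v.
  by apply: CP; rewrite lexx ler01.
- move=> v k.
  have [|t /andP[t1 t2]|h1 [h2 h3]] :=
      @path_stays_between_zeros R (fun t => F (v, t)) k 1 2 _ (Fvc v); first by rewrite ler1n.
    have alt : al t = al 1 by rewrite /al !min_r.
    by rewrite !sin_s /s /= alt.
  have FAE : Phi (AR *m v) = F (v, 2) - j%:~R * pi by rewrite FA addrK.
  rewrite -F1 FAE rmorphD rmorphN /= mulrDl mulNr; split => h.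
  + by rewrite ltrD2r h1.
  + by rewrite ltrD2r h2.
  + by rewrite h3.
- move=> v; have [i h] := nz v; have [i' h'] := nz (AR *m v).
  have [r [er es]] := on_line (PhiP v i); have [r' [er' es']] := on_line (PhiP (AR *m v) i').
  have r0 : r != 0 by apply: contraTneq h => r0; rewrite er es r0 !mul0r eqxx.
  have r'0 : r' != 0 by apply: contraTneq h' => r0'; rewrite er' es' r0' !mul0r eqxx.
  apply: (mulfI (mulf_neq0 r0 r'0)).
  transitivity ((e v * x i v - y i v) * y i' (AR *m v)); first by rewrite er es es'; ring.
  by rewrite inv er er'; ring.
Qed.

End LineBundle.

(** * Sign of the invariant line and the Riccati equation *)

Section Recurrence.
Variables (R : realType) (d : nat) (A : 'M[int]_d).
Local Notation V := 'cV[R]_d.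
Local Notation AR := (map_mx intr A : 'M[R]_d).

(** The forward orbit of the image of [v0] in the torus visits each nonempty open set at arbitrarily
    late times; open sets of the torus are written as periodic open sets of vectors. *)
Definition recurrent (v0 : V) := forall U : set V, open U -> U !=set0 ->
  (forall v k, U v -> U (v + map_mx intr k)) ->
  forall N, exists2 n, (N <= n)%N & U (iter n (fun v => AR *m v) v0).

(** Let [k] be the largest integer with [Phi + pi / 2 > k * pi] somewhere, which exists because
    [Phi] is bounded. If [j > 0], one more step would exceed [k]. If [j = 0], the region above
    [k * pi] is forward invariant, so recurrence excludes points strictly below it; pushing the
    resulting closed bounds forward makes them strict. This confines [Phi] to
    [k * pi < Phi < k * pi + pi / 2], where sine and cosine have the same sign. *)
Lemma rotation_monotone (v0 : V) (Phi : V -> R) (j : int) :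
  recurrent v0 -> \det A = 1 -> 0 <= j -> continuous Phi ->
  (forall v k, Phi (v + map_mx intr k) = Phi v) ->
  (exists C, forall v, `|Phi v| <= C) ->
  (forall v (k : int),
      [/\ k%:~R * pi < Phi v + pi / 2 -> (k + j)%:~R * pi < Phi (AR *m v),
        Phi v + pi / 2 < k%:~R * pi -> Phi (AR *m v) < (k + j)%:~R * pi &
        Phi v + pi / 2 = k%:~R * pi -> Phi (AR *m v) = (k + j)%:~R * pi]) ->
  forall v, 0 < cos (Phi v) * sin (Phi v).
Proof.
move=> rec detA j0 Phic Phip [C CP] rel.
have p0 := pi_gt0 R.
have [K KC] : exists K : nat, C < K%:R * pi.
  by exists (Num.truncn (C / pi)).+1; rewrite -ltr_pdivrMr// truncnS_gt.
pose above (k : int) v := k%:~R * pi < Phi v + pi / 2.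
(* The maximum is taken over natural numbers, hence the shift by [K], chosen with
   [|Phi| < K * pi]. *)
pose Pn (n : nat) := `[< exists v, above (n%:Z - K%:Z) v >].
have exP : exists n, Pn n.
  exists 0%N; apply/asboolP; exists 0; rewrite /above sub0r rmorphN /=.
  have := CP 0; rewrite ler_norml => /andP[h _].
  by move: h KC p0; rewrite mulNr; lra.
have ubP n : Pn n -> (n <= K.*2.+1)%N.
  move=> /asboolP[v]; rewrite /above rmorphB /= -!pmulrn mulrBl => h1.
  have := CP v; rewrite ler_norml => /andP[_ h2].
  have : n%:R * pi < (K.*2.+1)%:R * pi :> R.
    rewrite -addnn -natr1 natrD.
    rewrite (mulrDl (K%:R + K%:R) 1) (mulrDl K%:R K%:R) mul1r.
    by move: h1 h2 KC p0; lra.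
  by rewrite ltr_pM2r// ltr_nat => /ltnW.
case: (ex_maxnP exP ubP) => n /asboolP[v1 v1P] nmax.
set k : int := n%:Z - K%:Z in v1P.
have kmax v : Phi v + pi / 2 <= (k + 1)%:~R * pi.
  rewrite leNgt; apply/negP => h.
  have : Pn n.+1 by apply/asboolP; exists v; rewrite /above (_ : _ - _ = k + 1)//; lia.
  by move=> /nmax; rewrite ltnn.
have [j0' | {}j0] : 0 < j \/ j = 0.
    by move: j0; rewrite le_eqVlt => /predU1P[]; [right|left].
  have [/(_ v1P) h _ _] := rel v1 k.
  have := kmax (AR *m v1); rewrite leNgt => /negP[].
  have : (k + 1)%:~R <= (k + j)%:~R :> R by rewrite ler_int; lia.
  rewrite -(ler_pM2r p0) => h'.
  by rewrite (le_lt_trans h')// (lt_trans h)// ltrDl divr_gt0.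
have {}rel v : [/\ above k v -> k%:~R * pi < Phi (AR *m v),
    Phi v + pi / 2 = k%:~R * pi -> Phi (AR *m v) = k%:~R * pi &
    Phi v + pi / 2 = (k + 1)%:~R * pi -> Phi (AR *m v) = (k + 1)%:~R * pi].
  by have [h1 _ h3] := rel v k; have [_ _ h3'] := rel v (k + 1); rewrite j0 !addr0 in h1 h3 h3'.
have stay v m : above k v -> above k (iter m (fun v => AR *m v) v).
  move=> va; elim: m => //= m IH; have [/(_ IH) h _ _] := rel (iter m (fun v => AR *m v) v).
  by rewrite /above (lt_trans h)// ltrDl divr_gt0.
have Phi2c : continuous (fun v : V => Phi v + pi / 2).
  move=> v; apply: (@continuous_comp V R R Phi (fun t => t + pi / 2) v (Phic v)).
  by apply: cvgD; [exact: cvg_id|exact: cvg_cst].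
(* Otherwise the recurrent orbit enters the forward invariant set [above k] and later visits the
   open set strictly below level [k * pi]. *)
have low v : k%:~R * pi <= Phi v + pi / 2.
  rewrite leNgt; apply/negP => vlow.
  have [|||N _ NP] := rec [set v | above k v] _ _ _ 0%N.
  - exact: (@open_comp V R (fun v : V => Phi v + pi / 2) [set y | k%:~R * pi < y] (fun v _ => Phi2c v) (@open_gt _ _)).
  - by exists v1.
  - by move=> w l; rewrite /above /= Phip.
  have [|||n' Nn'] := rec [set v | Phi v + pi / 2 < k%:~R * pi] _ _ _ N.
  - exact: (@open_comp V R (fun v : V => Phi v + pi / 2) [set y | y < k%:~R * pi] (fun v _ => Phi2c v) (@open_lt _ _)).
  - by exists v.
  - by move=> w l; rewrite /= Phip.
  rewrite /= -(subnK Nn') iterD => h.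
  by have := stay _ (n' - N)%N NP; rewrite /above ltNge (ltW h).
have kD : (k + 1)%:~R * pi = k%:~R * pi + pi :> R by rewrite rmorphD /= mulrDl mul1r.
(* Equality at the upper end would give [Phi (A v) = (k + 1) * pi], which exceeds by [pi / 2] what
   maximality of [k] allows. *)
have hi_strict v : Phi v < k%:~R * pi + pi / 2.
  have : Phi v + pi / 2 != (k + 1)%:~R * pi.
    apply/negP => /eqP h; have [_ _ /(_ h) h'] := rel v.
    by have := kmax (AR *m v); rewrite h'; move: p0; lra.
  by have := kmax v; rewrite le_eqVlt => /predU1P[->|+ _]; rewrite ?eqxx// kD; lra.
have lo_strict v : k%:~R * pi < Phi v.
  have -> : v = AR *m (map_mx intr (\adj A) *m v).
    by rewrite mulmxA -map_mxM mul_mx_adj detA map_mx1 mul1mx.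
  set w := _ *m v; have [h1 _ _] := rel w.
  have := low w; rewrite le_eqVlt => /predU1P[e|]; last exact: h1.
  have [_ /(_ (esym e)) h _] := rel w.
  (* the predecessor of [w] would have to satisfy [Phi <= k * pi - pi / 2 < Phi] *)
  pose u := map_mx intr (\adj A) *m w.
  have wE : w = AR *m u by rewrite mulmxA -map_mxM mul_mx_adj detA map_mx1 mul1mx.
  have [g1 g2 _] := rel u; have := low u; rewrite le_eqVlt => /predU1P[e'|/g1].
    by have := g2 (esym e'); rewrite -wE; move: e p0; lra.
  by rewrite -wE; move: e p0; lra.
move=> v; pose b := Phi v - k%:~R * pi.
have b2 : 0 < b *+ 2 < pi.
  by have := hi_strict v; have := lo_strict v; rewrite /b -mulr_natr; lra.
have := sin_gt0_pi b2.
have -> : sin (b *+ 2) = (cos (Phi v) * sin (Phi v)) *+ 2.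
  rewrite -sin_mulr2n -(cos_sinD2piz (b *+ 2) k).2; congr sin.
  by rewrite (mulrnAr k%:~R pi 2) -mulrnDl /b subrK.
by rewrite pmulrn_lgt0.
Qed.

End Recurrence.

Section Riccati.
Variables (R : realType) (d : nat) (A : 'M[int]_d).
Hypothesis A1 : ~~ eigenvalue (map_mx intr A : 'M[R[i]]_d) 1.
Hypothesis detA : \det A = 1.
Local Notation V := 'cV[R]_d.
Local Notation AR := (map_mx intr A : 'M[R]_d).
Variables (x y : bool -> V -> R) (e : V -> R).
Hypotheses (xc : forall i, continuous (x i)) (yc : forall i, continuous (y i)).
Hypothesis ec : continuous e.
Hypotheses (xp : forall i v k, x i (v + map_mx intr k) = x i v)
  (yp : forall i v k, y i (v + map_mx intr k) = y i v)
  (ep : forall v k, e (v + map_mx intr k) = e v).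
Hypothesis par : forall v, x true v * y false v = y true v * x false v.
Hypothesis nz : forall v, exists i, (x i v != 0) || (y i v != 0).
Hypothesis inv : forall i j v,
  (e v * x i v - y i v) * y j (AR *m v) = x i v * x j (AR *m v).

(** [rho] is the cotangent of [Phi]. A negative [j] is reduced to the other case by the reflection
    [Phi |-> - Phi]: since [- Phi + pi / 2 = pi - (Phi + pi / 2)], it turns [j] into [-1 - j], which
    is nonnegative, and reverses the sign of [rho]. *)
Lemma riccati (v0 : V) : recurrent A v0 -> exists (sg : R) (rho : V -> R),
  [/\ sg ^+ 2 = 1, forall v, 0 < sg * rho v,
    forall v k, rho (v + map_mx intr k) = rho v &
    forall v, rho (AR *m v) + (rho v)^-1 = e v].
Proof.
move=> rec; have [Phi [j [Phic Phip [C CP] rel PhiE]]] :=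
  angle_cocycle A1 xc yc ec xp yp ep par nz inv.
suff [sg [sg2 sgP]] : exists sg : R, sg ^+ 2 = 1 /\
    forall v, 0 < sg * (cos (Phi v) * sin (Phi v)).
  have c0 v : cos (Phi v) != 0.
    by apply: contraTneq (sgP v) => ->; rewrite mul0r mulr0 ltxx.
  have s0 v : sin (Phi v) != 0.
    by apply: contraTneq (sgP v) => ->; rewrite !mulr0 ltxx.
  exists sg, (fun v => cos (Phi v) / sin (Phi v)); split => //.
  - move=> v; have -> : sg * (cos (Phi v) / sin (Phi v)) =
        sg * (cos (Phi v) * sin (Phi v)) / sin (Phi v) ^+ 2 by field.
    by rewrite divr_gt0// lt_def sqr_ge0 sqrf_eq0 s0.
  - by move=> v k; rewrite Phip.
  move=> v; apply: (mulfI (mulf_neq0 (c0 v) (s0 (AR *m v)))).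
  transitivity (cos (Phi v) * cos (Phi (AR *m v)) + sin (Phi v) * sin (Phi (AR *m v))).
    by field; rewrite c0 !s0.
  by rewrite -PhiE; ring.
have [j0|j0] := leP 0 j.
  exists 1; split; first by rewrite expr1n.
  move=> v; rewrite mul1r; apply: (rotation_monotone rec detA j0 Phic Phip _ rel).
  by exists C.
exists (-1); split; first by rewrite sqrrN expr1n.
move=> v; rewrite mulN1r -mulrN -sinN -(cosN (Phi v)).
apply: (@rotation_monotone R d A v0 (fun v => - Phi v) (-1 - j) rec detA).
- by rewrite -opprD oppr_ge0 addrC lezD1.
- move=> w; apply: (@continuous_comp V R R Phi (fun t => - t) w (Phic w)).
  by apply: cvgN; exact: cvg_id.
- by move=> w k; rewrite Phip.
- by exists C => w; rewrite normrN.
move=> w k; have [h1 h2 h3] := rel w (1 - k).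
have kE : (1 - k)%:~R * pi = pi - k%:~R * pi :> R by rewrite rmorphB /= mulrBl mul1r.
have kjE : (1 - k + j)%:~R * pi = - ((k + (-1 - j))%:~R * pi) :> R.
  by rewrite -mulNr -rmorphN /=; congr (_%:~R * _); ring.
rewrite kE kjE in h1 h2 h3; split => h.
- by rewrite ltrNr h2//; move: h; lra.
- by rewrite ltrNl h1//; move: h; lra.
- by rewrite h3 ?opprK//; move: h; lra.
Qed.

End Riccati.

(** * The spectrum is an interval *)

Section Forms.
Variables (R : realType) (b : int -> R).
Implicit Types (phi : int -> R) (N : nat).

(** Expansion of [0 <= |L phi + sg dl phi|^2]: a definite form with margin [dl] bounds the norm of
    the operator below by [dl]. *)
Lemma coercive_of_form (sg dl : R) : sg ^+ 2 = 1 ->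
  forall N phi, supp N phi ->
  dl * wsum N (fun n => phi n ^+ 2) <= - sg * wsum N.+1 (fun n => phi n * jacobi b phi n) ->
  0 <= dl ->
  dl ^+ 2 * wsum N (fun n => phi n ^+ 2) <= wsum N.+1 (fun n => jacobi b phi n ^+ 2).
Proof.
move=> sg2 N phi sphi h dl0.
have : 0 <= wsum N.+1 (fun n => (jacobi b phi n + sg * dl * phi n) ^+ 2).
  by apply: wsum_ge0 => n; exact: sqr_ge0.
rewrite (@eq_wsum _ _ _ (fun n => jacobi b phi n ^+ 2 +
  (2 * sg * dl * (phi n * jacobi b phi n) + sg ^+ 2 * dl ^+ 2 * phi n ^+ 2))); last first.
  by move=> n _; ring.
rewrite sg2 mul1r !wsumD !wsumZ (@wsum_supp _ N N.+1 (fun n => phi n ^+ 2))//; last first.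
  by move=> n nN; rewrite sphi ?expr0n.
move: h; set S := wsum N _; set P := wsum _ (fun n => phi n * _); set J := wsum _ _ => h.
have h2 : dl * (dl * S) <= dl * (- sg * P) by rewrite ler_wpM2l.
have -> : 2 * sg * dl * P = - (2 * (dl * (- sg * P))) by ring.
have -> : dl ^+ 2 * S = dl * (dl * S) by ring.
by move: h2; lra.
Qed.

(** Completing squares, the form is minus the sum of [r n * (phi n - phi (n + 1) / r n)^2]. *)
Lemma riccati_form (sg : R) (r : int -> R) : (forall n, 0 < sg * r n) ->
  (forall n, r n + (r (n - 1))^-1 = - b n) ->
  forall N phi, supp N phi -> sg * wsum N.+1 (fun n => phi n * jacobi b phi n) <= 0.
Proof.
move=> sr rb N phi sphi.
have r0 n : r n != 0 by apply: contraTneq (sr n) => ->; rewrite mulr0 ltxx.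
have e1 : wsum N.+1 (fun n => phi n * phi (n - 1)) = wsum N.+1 (fun n => phi n * phi (n + 1)).
  have := wsum_shift N.+1 (fun n => phi n * phi (n - 1)).
  under eq_wsum do rewrite addrK mulrC.
  by rewrite !sphi ?mul0r ?addr0 ?subr0//; lia.
have e2 : wsum N.+1 (fun n => (r (n - 1))^-1 * phi n ^+ 2) =
    wsum N.+1 (fun n => (r n)^-1 * phi (n + 1) ^+ 2).
  have := wsum_shift N.+1 (fun n => (r (n - 1))^-1 * phi n ^+ 2).
  under eq_wsum do rewrite addrK.
  by move=> ->; rewrite !sphi ?expr0n ?mulr0 ?addr0 ?subr0//; lia.
rewrite (@eq_wsum _ _ _ (fun n => phi n * phi (n - 1) + (phi n * phi (n + 1) +
  (- 1 * (r n * phi n ^+ 2) + - 1 * ((r (n - 1))^-1 * phi n ^+ 2))))); last first.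
  by move=> n _; rewrite /jacobi -[b n]opprK -rb; ring.
rewrite !wsumD !wsumZ e1 e2.
have : 0 <= wsum N.+1 (fun n => sg * r n * (phi n - phi (n + 1) / r n) ^+ 2).
  by apply: wsum_ge0 => n; rewrite mulr_ge0 ?sqr_ge0// ltW.
rewrite (@eq_wsum _ _ _ (fun n => sg * (r n * phi n ^+ 2) +
  (sg * ((r n)^-1 * phi (n + 1) ^+ 2) + (- (2 * sg)) * (phi n * phi (n + 1))))).
  rewrite !wsumD !wsumZ.
  set a := wsum _ _; set a' := wsum _ _; set a'' := wsum _ _ => h.
  rewrite -oppr_ge0; apply: le_trans h _; rewrite le_eqVlt; apply/orP; left; apply/eqP.
  by ring.
by move=> n _; field.
Qed.

Lemma jacobi_form_shift (a : R) N phi : supp N phi ->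
  wsum N.+1 (fun n => phi n * jacobi (fun k => b k - a) phi n) =
  wsum N.+1 (fun n => phi n * jacobi b phi n) - a * wsum N (fun n => phi n ^+ 2).
Proof.
move=> sphi; rewrite -(@wsum_supp _ N N.+1 (fun n => phi n ^+ 2))//; last first.
  by move=> n nN; rewrite sphi ?expr0n.
rewrite -mulNr -wsumZ -wsumD; apply: eq_wsum => n _; rewrite /jacobi; ring.
Qed.

Lemma free_form_le N phi : supp N phi ->
  `|wsum N.+1 (fun n => phi n * jacobi (fun=> 0) phi n)| <= 2 * wsum N (fun n => phi n ^+ 2).
Proof.
move=> sphi.
have e1 : wsum N.+1 (fun n => phi n * phi (n - 1)) = wsum N.+1 (fun n => phi (n + 1) * phi n).
  have := wsum_shift N.+1 (fun n => phi n * phi (n - 1)).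
  under eq_wsum do rewrite addrK.
  by rewrite !sphi ?mul0r ?addr0 ?subr0//; lia.
have e2 : wsum N.+1 (fun n => phi (n + 1) ^+ 2) = wsum N (fun n => phi n ^+ 2).
  rewrite (wsum_shift _ (fun n => phi n ^+ 2)) !sphi ?expr0n ?addr0 ?subr0; try by lia.
  by apply: wsum_supp => // n nN; rewrite sphi ?expr0n.
have e3 : wsum N.+1 (fun n => phi n ^+ 2) = wsum N (fun n => phi n ^+ 2).
  by apply: wsum_supp => // n nN; rewrite sphi ?expr0n.
rewrite (@eq_wsum _ _ _ (fun n => phi n * phi (n - 1) + phi n * phi (n + 1))); last first.
  by move=> n _; rewrite /jacobi; ring.
rewrite wsumD e1 -wsumD mulr_natl mulr2n -{1}e2 -e3 -wsumD ler_norml; apply/andP; split.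
  rewrite -mulN1r -wsumZ; apply: ler_wsum => n; rewrite -subr_ge0.
  rewrite (_ : _ - _ = (phi n + phi (n + 1)) ^+ 2) ?sqr_ge0//; ring.
apply: ler_wsum => n; rewrite -subr_ge0.
by rewrite (_ : _ - _ = (phi n - phi (n + 1)) ^+ 2) ?sqr_ge0//; ring.
Qed.

End Forms.

Section GapLabelling.
Variables (R : realType) (d : nat) (A : 'M[int]_d) (detA : \det A = 1).
Hypothesis A1 : ~~ eigenvalue (map_mx intr A : 'M[R[i]]_d) 1.
Local Notation V := 'cV[R]_d.
Local Notation T := (toral_aut R detA).
Local Notation AR := (map_mx intr A : 'M[R]_d).
Variables (f : torus R d -> R).
Hypothesis fc : continuous f.

Definition potential (w : torus R d) (n : int) := f (hpow T n w).

Lemma hpow_continuous n : continuous (hpow T n).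
Proof.
have it (g : torus R d -> torus R d) k : continuous g -> continuous (iter k g).
  move=> gc; elim: k => [w|k IH w] /=; first exact: cvg_id.
  by apply: (@continuous_comp _ _ _ (iter k g) g); [exact: IH|exact: gc].
case: n => k; first by apply: it; exact: (@hfun_continuous _ T).
by apply: (it (hinv T) k.+1); exact: (@hinv_continuous _ T).
Qed.

Lemma potential_continuous n : continuous (fun w => potential w n).
Proof.
by move=> w; apply: (@continuous_comp _ _ _ (hpow T n) f); [exact: hpow_continuous|exact: fc].
Qed.

Lemma potentialS w n : potential (T w) n = potential w (n + 1).
Proof. by rewrite /potential hpowD. Qed.

Lemma potential_bounded : exists B, forall w n, `|potential w n| <= B.
Proof.
have Gc : continuous (fun v : V * R => f (torus_pi v.1)).
  move=> v; apply: (@continuous_comp _ _ _ (fun v : V * R => torus_pi v.1) f); last exact: fc.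
  by apply: (@continuous_comp _ _ _ fst (@torus_pi R d)); [exact: cvg_fst|exact: pi_continuous].
have [|B BP] := periodic_bounded 1 Gc.
  by move=> v k t /=; congr f; apply/esym/torus_piP; exists k.
exists B => w n; rewrite /potential -(torus_pi_repr (hpow T n w)).
by apply: (BP _ 0); rewrite lexx ler01.
Qed.

(** The source at site 0 of the shifted operator is site 1 of the original one, so the values at -1
    and -2 belong to sites 0 and -1, left of the source. *)
Lemma green_decays_tail (bb bb' g : int -> R) m : nle g m ->
  (forall n, bb' n = bb (n + 1)) -> (forall n, (n < 0)%R -> jacobi bb' g n = 0) ->
  decays bb (g (-1)) (g (-2)).
Proof.
move=> gm bbE gE; exists (fun k => g (- k.+1%:Z)); split => //.
  have := (nle_cvg0 gm).2.
  by rewrite -(cvg_shiftS _ (nbhs (0 : R))).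
move=> k; have := gE (- k.+2%:Z) isT; rewrite /jacobi bbE.
rewrite (_ : - k.+2%:Z - 1 = - k.+3%:Z); last by lia.
rewrite (_ : - k.+2%:Z + 1 = - k.+1%:Z); last by lia.
by move=> /eqP; rewrite addr_eq0 mulNr => /eqP <-; rewrite addrC.
Qed.

Lemma gap_riccati (E c : R) (v0 : V) : recurrent A v0 -> 0 < c ->
  (forall w, coercive (potential w) E c) ->
  exists (sg : R) (rho : torus R d -> R),
  [/\ sg ^+ 2 = 1, forall w, 0 < sg * rho w &
    forall w, rho (T w) + (rho w)^-1 = E - f w].
Proof.
move=> rec c0 LB; have [B BP] := potential_bounded.
pose b (w : torus R d) (n : int) := potential w n - E.
have bc n : continuous (fun w => b w n).
  move=> w; apply: (@continuous_comp _ R R (fun w => potential w n) (fun t => t - E)).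
    exact: potential_continuous.
  by apply: cvgB; [exact: cvg_id|exact: cvg_cst].
have bB w n : `|b w n| <= B + `|E| by rewrite (le_trans (ler_normB _ _))// lerD2r.
have bS w n : b (T w) n = b w (n + 1) by rewrite /b potentialS.
have [g [gc gm gE]] := green_exists bc bB c0 LB.
(* The Green function with source at 0 may vanish on the whole left half line. The second vector
   comes from the source one site further, also read at the sites 0 and -1 of the first operator. *)
pose x (i : bool) (v : V) := if i then g (torus_pi v) 0 else g (T (torus_pi v)) (-1).
pose y (i : bool) (v : V) := if i then g (torus_pi v) (-1) else g (T (torus_pi v)) (-2).
pose e (v : V) := E - f (torus_pi v).
have piT v : torus_pi (AR *m v) = T (torus_pi v) by rewrite /= torus_map_pi.
have gE0 w n : (n < 0)%R -> jacobi (b w) (g w) n = 0.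
  by move=> n0; rewrite gE lt_eqF.
have D v i : decays (b (torus_pi v)) (x i v) (y i v).
  case: i; rewrite /x /y.
    have [m hm] := gm (torus_pi v); exact: green_decays hm (gE0 _).
  have [m hm] := gm (T (torus_pi v)); apply: green_decays_tail hm _ (gE0 _).
  by move=> n; exact: bS.
have gpc n : continuous (fun v : V => g (torus_pi v) n).
  move=> v; apply: (@continuous_comp _ _ _ (@torus_pi R d) (fun w => g w n)).
    exact: pi_continuous.
  exact: gc.
have gTpc n : continuous (fun v : V => g (T (torus_pi v)) n).
  move=> v; apply: (@continuous_comp _ _ _ (@torus_pi R d) (fun w => g (T w) n)).
    exact: pi_continuous.
  apply: (@continuous_comp _ _ _ T (fun w => g w n)); last exact: gc.
  exact: hfun_continuous.
have pip v k : @torus_pi R d (v + map_mx intr k) = torus_pi v.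
  by apply/esym/torus_piP; exists k.
have [|||||||||sg [rho [sg2 sgr rhop rhoE]]] :=
    @riccati R d A A1 detA x y e _ _ _ _ _ _ _ _ _ v0 rec.
- by case; [exact: gpc|exact: gTpc].
- by case; [exact: gpc|exact: gTpc].
- move=> v; apply: (@continuous_comp _ R R (fun v : V => f (torus_pi v)) (fun t => E - t)).
    by apply: (@continuous_comp _ _ _ (@torus_pi R d) f); [exact: pi_continuous|exact: fc].
  by apply: cvgB; [exact: cvg_cst|exact: cvg_id].
- by move=> i v k; rewrite /x pip.
- by move=> i v k; rewrite /y pip.
- by move=> v k; rewrite /e pip.
- by move=> v; exact: decays_parallel (D v true) (D v false).
(* If both vectors vanish, both Green functions live to the right of their sources. Read at the same
   sites they solve one recurrence there and decay, so their Wronskian is 0; but the values next to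
   the sources, 1 for one and 0, 1 for the other, make it 1. *)
- move=> v; set w := torus_pi v; apply: contrapT => nex.
  have z i : x i v = 0 /\ y i v = 0.
    apply: contrapT => ni; apply: nex; exists i; rewrite -negb_and.
    by apply/negP => /andP[/eqP h1 /eqP h2]; apply: ni.
  have [/= g0 gN1] := z true; have [/= gTN1 gTN2] := z false.
  rewrite -/w in g0 gN1 gTN1 gTN2.
  have g1 : g w 1 = 1.
    by have := gE w 0; rewrite /jacobi sub0r add0r gN1 g0 mulr0 add0r addr0.
  have gT0 : g (T w) 0 = 0.
    have := gE (T w) (-1); rewrite /jacobi addNr gTN1 mulr0 addr0.
    by rewrite (_ : -1 - 1 = -2)//= gTN2 add0r.
  have gT1 : g (T w) 1 = 1.
    by have := gE (T w) 0; rewrite /jacobi sub0r add0r gTN1 gT0 mulr0 add0r addr0.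
  have [m hm] := gm w; have [m' hm'] := gm (T w).
  have wn : wronskian_null (fun k => - b w k.+2%:Z) (fun k => g w k.+1%:Z) (fun k => g (T w) k%:Z).
    split.
    - have := (nle_cvg0 hm).1; by rewrite -(cvg_shiftS _ (nbhs (0 : R))).
    - exact: (nle_cvg0 hm').1.
    - move=> k; have := gE w k.+2%:Z; rewrite /jacobi.
      rewrite (_ : k.+2%:Z - 1 = k.+1%:Z); last by lia.
      rewrite (_ : k.+2%:Z + 1 = k.+3%:Z); last by lia.
      by move=> /eqP; rewrite addr_eq0 mulNr => /eqP.
    - move=> k; have := gE (T w) k.+1%:Z; rewrite /jacobi bS.
      rewrite (_ : k.+1%:Z - 1 = k%:Z); last by lia.
      rewrite (_ : k.+1%:Z + 1 = k.+2%:Z); last by lia.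
      by move=> /eqP; rewrite addr_eq0 mulNr => /eqP.
  by have := wronskian_eq0 wn; rewrite g1 gT1 gT0 mulr0 mulr1 => /eqP; rewrite oner_eq0.
- move=> i j v; have := decays_step (bS (torus_pi v)) (D v i).
  have <- : e v = - b (torus_pi v) 0 by rewrite /b /e opprB.
  by move=> /decays_parallel; apply; rewrite -piT; exact: D.
have rhoE' v : rho (repr (torus_pi v)) = rho v.
  have [k kE] := (torus_piP (repr (torus_pi v)) v).1 (torus_pi_repr _).
  by rewrite [in RHS]kE rhop.
exists sg, (fun w => rho (repr w)); split => // w.
by rewrite -(torus_pi_repr w) -piT !rhoE' rhoE.
Qed.

End GapLabelling.

Lemma continuous_wsum_jacobi (R : realType) (Z : topologicalType) (b : Z -> int -> R)
    N (phi : int -> R) : (forall n, continuous (fun z => b z n)) ->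
  continuous (fun z => wsum N (fun n => jacobi (b z) phi n ^+ 2)).
Proof.
move=> bc z; apply: cvg_big => [|i _]; first exact: add_continuous.
pose n := i%:Z - N%:Z.
have H : {for z, continuous (fun z => jacobi (b z) phi n)}.
  apply: cvgD; first exact: cvg_cst.
  by apply: cvgM; [exact: bc|exact: cvg_cst].
exact: (cvgM H H).
Qed.

(** * The common spectrum over recurrent points *)

Section SpectralSet.
Variables (R : realType) (d : nat) (A : 'M[int]_d) (detA : \det A = 1).
Hypothesis A1 : ~~ eigenvalue (map_mx intr A : 'M[R[i]]_d) 1.
Local Notation V := 'cV[R]_d.
Local Notation T := (toral_aut R detA).
Local Notation AR := (map_mx intr A : 'M[R]_d).
Variables (f : torus R d -> R).
Hypothesis fc : continuous f.
Local Notation pot := (potential detA f).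

(* For finitely supported [phi] a lower bound involves finitely many sites, so it
   propagates from one recurrent point to all of the torus: hence this set, which does
   not depend on a point, is the spectrum at every recurrent point. *)
Definition spectral_set : set R :=
  [set E | ~ exists2 c, 0 < c & forall w, coercive (pot w) E c].

Let wsum_shift1 N (u : int -> R) : supp N u ->
  wsum N.+1 (fun n => u (n - 1)) = wsum N u.
Proof.
move=> su; have := wsum_shift N.+1 (fun n => u (n - 1)).
under eq_wsum do rewrite addrK.
by rewrite !su ?addr0 ?subr0; [move=> <-; apply: wsum_supp|lia|lia].
Qed.

Lemma coercive_step w (E c : R) : coercive (pot w) E c -> coercive (pot (T w)) E c.
Proof.
move=> h N phi sphi; pose phi' n := phi (n - 1).
have sphi' : supp N.+1 phi' by move=> n nN; rewrite /phi' sphi//; lia.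
have := h _ _ sphi'.
have -> : wsum N.+1 (fun n => phi' n ^+ 2) = wsum N (fun n => phi n ^+ 2).
  by apply: (wsum_shift1 (u := fun n => phi n ^+ 2)) => n nN; rewrite sphi ?expr0n.
set L := jacobi (fun k => pot (T w) k - E) phi.
have sL : supp N.+1 L by exact: supp_jacobi.
have -> : wsum N.+2 (fun n => jacobi (fun k => pot w k - E) phi' n ^+ 2) =
    wsum N.+2 (fun n => L (n - 1) ^+ 2).
  apply: eq_wsum => n _; congr (_ ^+ 2).
  by rewrite /L /jacobi /phi' potentialS subrK addrK.
by rewrite (wsum_shift1 (u := fun n => L n ^+ 2))// => n nN; rewrite sL ?expr0n.
Qed.

Lemma coercive_recurrent (v0 : V) (E c : R) : recurrent A v0 ->
  coercive (pot (torus_pi v0)) E c -> forall w, coercive (pot w) E c.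
Proof.
move=> rec h w N phi sphi; rewrite leNgt; apply/negP => lt.
pose Q (w : torus R d) := wsum N.+1 (fun n => jacobi (fun k => pot w k - E) phi n ^+ 2).
have Qc : continuous Q.
  apply: (@continuous_wsum_jacobi R (torus R d) (fun w k => pot w k - E)) => n w'.
  apply: (@continuous_comp _ R R (fun w => pot w n) (fun t => t - E)).
    exact: potential_continuous.
  by apply: cvgB; [exact: cvg_id|exact: cvg_cst].
have Qpc : continuous (fun v : V => Q (torus_pi v)).
  by move=> v; apply: (@continuous_comp _ _ _ (@torus_pi R d) Q); [exact: pi_continuous|exact: Qc].
have [|||n _ nU] := rec [set v | Q (torus_pi v) < c * wsum N (fun n => phi n ^+ 2)] _ _ _ 0%N.
- exact: (@open_comp _ _ (fun v : V => Q (torus_pi v)) [set y | y < _] (fun v _ => Qpc v) (@open_lt _ _)).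
- by exists (repr w); rewrite /= torus_pi_repr.
- by move=> v k; rewrite /= (_ : torus_pi (v + map_mx intr k) = torus_pi v)//;
    apply/esym/torus_piP; exists k.
move: nU => /=; rewrite /Q ltNge => /negP; apply.
suff : coercive (pot (torus_pi (iter n (fun v => AR *m v) v0))) E c by apply.
elim: n => //= n IH.
rewrite (_ : torus_pi _ = T (torus_pi (iter n (fun v => AR *m v) v0))).
  exact: coercive_step.
by rewrite /= torus_map_pi.
Qed.

Let potB : exists B, forall w n, `|pot w n| <= B := potential_bounded detA fc.

Lemma spectrum_recurrent (v0 : V) : recurrent A v0 ->
  spectrum (schrodinger T f (torus_pi v0)) = real_complex R @` spectral_set.
Proof.
move=> rec; have [B BP] := potB; have BPw := BP (torus_pi v0).
apply/seteqP; split => [z zspec|_ [E ES <-] inv].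
  have inv c : 0 <= c -> 0 < c + complex.Im z ^+ 2 ->
      coercive (pot (torus_pi v0)) (complex.Re z) c -> False.
    by move=> c0 cy LB; apply: zspec; exact: coercive_invertible BPw _ _ c0 cy LB.
  have Im0 : complex.Im z = 0.
    apply: contrapT => /eqP Im0; apply: (inv 0) => //.
      by rewrite add0r lt_def sqrf_eq0 Im0 sqr_ge0.
    by move=> N phi _; rewrite mul0r; apply: wsum_ge0 => n; exact: sqr_ge0.
  exists (complex.Re z); last by case: z Im0 {zspec inv} => x y /= ->.
  move=> [c c0 cP]; apply: (inv c (ltW c0)); last exact: cP.
  by rewrite Im0 expr0n addr0.
have [c c0 cP] := invertible_coercive BPw inv.
by apply: ES; exists c => //; exact: coercive_recurrent rec cP.
Qed.

(** The two shifts contribute at most 2 to the quadratic form and the potential at most [B], which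
    leaves the margin [|E| - (B + 2)]. *)
Lemma spectral_set_bounded (B E : R) : (forall w n, `|pot w n| <= B) ->
  B + 2 < `|E| -> ~ spectral_set E.
Proof.
move=> BP BE; rewrite /spectral_set /=; apply; pose dl := `|E| - (B + 2).
have dl0 : 0 < dl by rewrite subr_gt0.
exists (dl ^+ 2); first by rewrite exprn_gt0.
move=> w N phi sphi.
pose sg : R := if 0 <= E then 1 else -1.
have sgE : sg * E = `|E| by rewrite /sg; case: (ger0P E) => _; rewrite ?mul1r ?mulN1r.
have sg2 : sg ^+ 2 = 1 by rewrite /sg; case: ifP; rewrite ?sqrrN expr1n.
apply: (coercive_of_form sg2) => //; last exact: ltW.
have e1 : wsum N.+1 (fun n => phi n * jacobi (fun k => pot w k - E) phi n) =
    wsum N.+1 (fun n => phi n * jacobi (fun=> 0) phi n) +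
    wsum N.+1 (fun n => (pot w n - E) * phi n ^+ 2).
  by rewrite -wsumD; apply: eq_wsum => n _; rewrite /jacobi; ring.
have e2 : wsum N.+1 (fun n => phi n ^+ 2) = wsum N (fun n => phi n ^+ 2).
  by apply: wsum_supp => // n nN; rewrite sphi ?expr0n.
have h3 : (`|E| - B) * wsum N (fun n => phi n ^+ 2) <=
    - sg * wsum N.+1 (fun n => (pot w n - E) * phi n ^+ 2).
  rewrite -e2 -!wsumZ; apply: ler_wsum => n; rewrite mulrA ler_wpM2r ?sqr_ge0//.
  have -> : - sg * (pot w n - E) = `|E| - sg * pot w n by rewrite -sgE; ring.
  rewrite lerD2l lerNl opprK (le_trans (ler_norm _))// normrM.
  have -> : `|sg| = 1 by rewrite /sg; case: ifP; rewrite ?normrN normr1.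
  by rewrite mul1r.
have h4 := free_form_le sphi; rewrite e1 mulrDr.
have h5 : - (2 * wsum N (fun n => phi n ^+ 2)) <=
    - sg * wsum N.+1 (fun n => phi n * jacobi (fun=> 0) phi n).
  rewrite mulNr lerN2 (le_trans (ler_norm _))// normrM.
  have -> : `|sg| = 1 by rewrite /sg; case: ifP; rewrite ?normrN normr1.
  by rewrite mul1r.
apply: le_trans (lerD h5 h3); rewrite /dl le_eqVlt; apply/orP; left; apply/eqP; ring.
Qed.

Lemma spectral_set_closed : closed spectral_set.
Proof.
rewrite -[spectral_set]setCK; apply: open_closedC; rewrite openE => E /= /contrapT[c c0 cP].
(* With [a] the operator at [E] and [d] the perturbation, [(a + d)^2 >= a^2 / 2 - d^2];
   [eta ^ 2 <= c / 4] then leaves [c / 2 - c / 4 = c / 4]. *)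
pose eta := Num.min 1 c / 2.
have m0 : 0 < Num.min 1 c by rewrite lt_min ltr01.
have eta0 : 0 < eta by rewrite divr_gt0.
have eta2 : eta ^+ 2 <= c / 4.
  have h1 : Num.min 1 c <= 1 by rewrite ge_min lexx.
  have h2 : Num.min 1 c <= c by rewrite ge_min lexx orbT.
  have : Num.min 1 c * Num.min 1 c <= 1 * c by rewrite ler_pM// ltW.
  by rewrite /eta expr_div_n expr2; lra.
apply/nbhs_ballP; exists eta => //= E' EE'; apply.
exists (c / 4); first by rewrite divr_gt0.
move=> w N phi sphi.
have a2 : (E - E') ^+ 2 <= c / 4.
  apply: le_trans eta2; rewrite -[leLHS]real_normK ?num_real//.
  by rewrite ler_sqr ?nnegrE ?(ltW eta0)// ltW.
have e2 : wsum N.+1 (fun n => phi n ^+ 2) = wsum N (fun n => phi n ^+ 2).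
  by apply: wsum_supp => // n nN; rewrite sphi ?expr0n.
have h := cP w N phi sphi.
apply: (@le_trans _ _ (wsum N.+1 (fun n =>
    2^-1 * jacobi (fun k => pot w k - E) phi n ^+ 2 - (E - E') ^+ 2 * phi n ^+ 2))).
  have -> : wsum N.+1 (fun n => 2^-1 * jacobi (fun k => pot w k - E) phi n ^+ 2
      - (E - E') ^+ 2 * phi n ^+ 2) =
      2^-1 * wsum N.+1 (fun n => jacobi (fun k => pot w k - E) phi n ^+ 2) -
      (E - E') ^+ 2 * wsum N (fun n => phi n ^+ 2).
    by rewrite -e2 -mulNr -!wsumZ -wsumD; apply: eq_wsum => n _; ring.
  have S0 : 0 <= wsum N (fun n => phi n ^+ 2) by apply: wsum_ge0 => n; exact: sqr_ge0.
  have h' := ler_wpM2r S0 a2.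
  by move: h h'; lra.
apply: ler_wsum => n; rewrite -subr_ge0.
have -> : jacobi (fun k => pot w k - E') phi n ^+ 2 -
   (2^-1 * jacobi (fun k => pot w k - E) phi n ^+ 2 - (E - E') ^+ 2 * phi n ^+ 2) =
   2^-1 * (jacobi (fun k => pot w k - E) phi n + 2 * (E - E') * phi n) ^+ 2.
  by rewrite /jacobi; field.
by rewrite mulr_ge0 ?invr_ge0 ?sqr_ge0.
Qed.

Lemma spectral_set_compact : compact spectral_set.
Proof.
have [B BP] := potB.
apply: (subclosed_compact spectral_set_closed (@segment_compact R (- (B + 2)) (B + 2))).
move=> E ES; rewrite /= in_itv /= -ler_norml leNgt; apply/negP => h.
exact: spectral_set_bounded BP h ES.
Qed.

(** At a missing point [z] the form has a sign. Moving the energy from [z] to [E'] on the side given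
    by [sg] adds the margin [sg * (E' - z)], so that whole side is missing; it contains [x] or
    [y]. *)
Lemma spectral_set_interval (v0 : V) : recurrent A v0 -> is_interval spectral_set.
Proof.
move=> rec x y xS yS z /andP[xz zy]; apply: contrapT => /contrapT[c c0 cP].
have [sg [rho [sg2 sgr rhoE]]] := gap_riccati A1 fc rec c0 cP.
have form w N phi : supp N phi ->
    sg * wsum N.+1 (fun n => phi n * jacobi (fun k => pot w k - z) phi n) <= 0.
  (* The index is shifted to [n + 1] because the Riccati equation at [T ^ n w] relates [rho] at
     [T ^ (n + 1) w] to [rho] at [T ^ n w]. *)
  apply: (@riccati_form _ (fun k => pot w k - z) sg (fun n => rho (hpow T (n + 1) w))) => n.
    exact: sgr.
  by rewrite subrK hpowS rhoE opprB.
have out E' : 0 < sg * (E' - z) -> ~ spectral_set E'.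
  move=> dl0; apply; exists ((sg * (E' - z)) ^+ 2); first by rewrite exprn_gt0.
  move=> w N phi sphi.
  apply: (coercive_of_form sg2) => //; last exact: ltW.
  have := jacobi_form_shift (fun k => pot w k - z) (E' - z) sphi.
  rewrite (_ : (fun k => pot w k - z - (E' - z)) = fun k => pot w k - E').
    by move=> ->; rewrite mulrBr; have := form w N phi sphi; lra.
  by apply/funext => k; ring.
have zS : ~ spectral_set z by apply; exists c.
have xz' : x < z by rewrite lt_neqAle xz andbT; apply: contra_notN zS => /eqP <-.
have zy' : z < y by rewrite lt_neqAle zy andbT; apply: contra_notN zS => /eqP ->.
move/eqP: sg2; rewrite sqrf_eq1 => /orP[] /eqP sgE.
  by apply: (out y) yS; rewrite sgE mul1r subr_gt0.
by apply: (out x) xS; rewrite sgE mulN1r oppr_gt0 subr_lt0.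
Qed.

End SpectralSet.

(** * Recurrence of almost every orbit *)

Section BoundedMeasurable.
Variables (dd : measure_display) (S : measurableType dd) (R : realType).
Variable P : probability S R.
Implicit Types g h : S -> R.

Definition bmeas g := measurable_fun setT g /\ exists C, forall t, `|g t| <= C.

Lemma bmeas_int g : bmeas g -> P.-integrable setT (EFin \o g).
Proof.
move=> [mg [C gC]]; apply: measurable_bounded_integrable => //.
  by apply: le_lt_trans (probability_le1 P measurableT) _; rewrite ltry.
by exists C; split; [exact: num_real|move=> x Cx y _; exact: le_trans (gC y) (ltW Cx)].
Qed.

Lemma bmeas_cst (r : R) : bmeas (fun=> r).
Proof. by split; [exact: measurable_cst|exists `|r|]. Qed.

Lemma bmeasD g h : bmeas g -> bmeas h -> bmeas (fun t => g t + h t).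
Proof.
move=> [mg [C gC]] [mh [D hD]]; split; first exact: measurable_funD.
by exists (C + D) => t; rewrite (le_trans (ler_normD _ _))// lerD.
Qed.

Lemma bmeasM g h : bmeas g -> bmeas h -> bmeas (fun t => g t * h t).
Proof.
move=> [mg [C gC]] [mh [D hD]]; split; first exact: measurable_funM.
by exists (C * D) => t; rewrite normrM ler_pM.
Qed.

Lemma bmeas_sum (I : Type) (s : seq I) (g : I -> S -> R) :
  (forall i, bmeas (g i)) -> bmeas (fun t => \sum_(i <- s) g i t).
Proof.
move=> gb; elim: s => [|i s IH].
  by under eq_fun do rewrite big_nil; exact: bmeas_cst.
by under eq_fun do rewrite big_cons; exact: bmeasD.
Qed.

Definition mean g := (\int[P]_t g t)%R.

Lemma meanD g h : bmeas g -> bmeas h -> mean (fun t => g t + h t) = mean g + mean h.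
Proof. by move=> hg hh; apply: RintegralD => //; exact: bmeas_int. Qed.

Lemma meanZ (r : R) g : bmeas g -> mean (fun t => r * g t) = r * mean g.
Proof. by move=> hg; apply: RintegralZl => //; exact: bmeas_int. Qed.

Lemma integral_cst_prob (r : \bar R) : (\int[P]_x cst r x = r)%E.
Proof.
apply: etrans (integral_cst P measurableT r) _.
by rewrite -[RHS]mule1; congr (_ * _)%E; exact: probability_setT.
Qed.

Lemma mean_cst (r : R) : mean (fun=> r) = r.
Proof. by rewrite /mean /Rintegral integral_cst_prob. Qed.

Lemma mean_sum (I : Type) (s : seq I) (g : I -> S -> R) : (forall i, bmeas (g i)) ->
  mean (fun t => \sum_(i <- s) g i t) = \sum_(i <- s) mean (g i).
Proof.
move=> gb; elim: s => [|i s IH].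
  by under [X in mean X]eq_fun do rewrite big_nil; rewrite mean_cst big_nil.
under [X in mean X]eq_fun do rewrite big_cons.
by rewrite meanD ?IH ?big_cons//; exact: bmeas_sum.
Qed.

Lemma le_mean g h : bmeas g -> bmeas h -> (forall t, g t <= h t) -> mean g <= mean h.
Proof. by move=> hg hh gh; apply: le_Rintegral => //; exact: bmeas_int. Qed.

Lemma bmeas_indic (B : set S) : measurable B -> bmeas (\1_B : S -> R).
Proof.
move=> mB; split; first exact: measurable_indic.
by exists 1 => t; rewrite indicE; case: (_ \in _); rewrite ?normr1 ?normr0.
Qed.

Lemma mean_indic (B : set S) : measurable B -> mean (\1_B : S -> R) = fine (P B).
Proof. by move=> mB; rewrite /mean /Rintegral integral_indic// setIT. Qed.

Lemma chebyshev_sq (B : set S) g (a : R) : measurable B -> bmeas g ->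
  (forall t, B t -> a ^+ 2 <= g t ^+ 2) ->
  a ^+ 2 * fine (P B) <= mean (fun t => g t ^+ 2).
Proof.
move=> mB hg Ba; rewrite -mean_indic// -meanZ; last exact: bmeas_indic.
apply: le_mean.
- by apply: bmeasM; [exact: bmeas_cst|exact: bmeas_indic].
- by under eq_fun do rewrite expr2; exact: bmeasM.
move=> t; rewrite indicE; case: (boolP (t \in B)) => [/set_mem/Ba|_].
  by rewrite mulr1.
by rewrite mulr0 sqr_ge0.
Qed.

End BoundedMeasurable.

(** * Integrals of characters over the unit cube *)

Section CubeIntegrals.
Variable R : realType.
Local Notation mR := (measurableTypeR R).

Definition tcol d (t : d.-tuple mR) : 'cV[R]_d := \col_i tnth t i.

Definition phase d (k : 'cV[int]_d) (v : 'cV[R]_d) : R :=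
  \sum_i (k i 0)%:~R * v i 0 * (pi *+ 2).

(** The real part of the character of frequency [k] rotated by [th]. With a free phase, products of
    waves are again combinations of waves. *)
Definition wave d (k : 'cV[int]_d) (th : R) (v : 'cV[R]_d) : R := cos (phase k v + th).

Lemma measurable_phase d (k : 'cV[int]_d) :
  measurable_fun setT (fun t : d.-tuple mR => phase k (tcol t)).
Proof.
apply: measurable_sum => i; apply: measurable_funM; last exact: measurable_cst.
apply: measurable_funM; first exact: measurable_cst.
by under eq_fun do rewrite mxE; exact: measurable_tnth.
Qed.

Lemma measurable_wave d (k : 'cV[int]_d) th :
  measurable_fun setT (fun t : d.-tuple mR => wave k th (tcol t)).
Proof.
apply: (@measurableT_comp _ _ _ _ _ _ (@cos R)).
  by apply: continuous_measurable_fun; exact: continuous_cos.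
by apply: measurable_funD; [exact: measurable_phase|exact: measurable_cst].
Qed.

Lemma bmeas_wave d (k : 'cV[int]_d) th : bmeas (fun t : d.-tuple mR => wave k th (tcol t)).
Proof. by split; [exact: measurable_wave|exists 1 => t; exact: cos_max]. Qed.

(** The added 1 keeps the integrand nonnegative, as the formula for the uniform law and Tonelli's
    theorem require. The phase [th] is arbitrary since it will absorb the other coordinates. *)
Lemma uniform_wave (k : int) (th : R) : k != 0 ->
  (\int[uniform_prob (@ltr01 R)]_x (1 + cos (k%:~R * x * (pi *+ 2) + th))%:E = 1)%E.
Proof.
move=> k0; set w : R := k%:~R * (pi *+ 2).
have w0 : w != 0 by rewrite mulf_neq0 ?intr_eq0// mulrn_eq0 /= gt_eqF// pi_gt0.
have sinw : sin (w + th) = sin th by rewrite addrC (cos_sinD2piz th k).2.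
have gE x : 1 + cos (k%:~R * x * (pi *+ 2) + th) = 1 + cos (w * x + th).
  by rewrite /w mulrAC.
under eq_integral do rewrite gE.
clearbody w.
pose F : R -> R := id + w^-1 \*: (@sin R \o (w \*: id + cst th)).
pose g (x : R) := 1 + cos (w * x + th).
have lin (x : R) : {for x, continuous (fun x : R => w * x + th)}.
  apply: cvgD; last exact: cvg_cst.
  by apply: cvgM; [exact: cvg_cst|exact: cvg_id].
have gc : continuous g.
  move=> x; apply: cvgD; first exact: cvg_cst.
  by apply: (@continuous_comp R R R (fun x => w * x + th) (@cos R) x); [exact: lin|exact: continuous_cos].
have Fc : continuous F.
  move=> x; apply: cvgD; first exact: cvg_id.
  apply: cvgM; first exact: cvg_cst.
  by apply: (@continuous_comp R R R (fun x => w * x + th) (@sin R) x); [exact: lin|exact: continuous_sin].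
have Fd (x : R) : is_derive x 1 F (g x).
  rewrite /F; apply: is_derive_eq.
  rewrite /g /= addr0; congr (_ + _).
  rewrite /GRing.scale /= mulr1 mulrCA mulVf// mulr1.
  by [].
rewrite integral_uniform; last 2 first.
- by apply/measurable_EFinP; exact: continuous_measurable_fun.
- by move=> x; rewrite lee_fin -lerBlDl sub0r cos_geN1.
rewrite subr0 invr1 mul1e (continuous_FTC2 (f := g) (F := F) (@ltr01 R)).
- have FE x : F x = x + w^-1 * sin (w * x + th) by [].
  by rewrite -EFinB !FE mulr1 mulr0 !add0r sinw addrK.
- exact: continuous_subspaceT.
- split; first by move=> x _; exact: ex_derive.
  + by apply: cvg_at_right_filter; exact: Fc.
  + by apply: cvg_at_left_filter; exact: Fc.
- by move=> x _; rewrite derive1E; apply: derive_val.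
Qed.

End CubeIntegrals.

Section CubeWaves.
Variable R : realType.
Local Notation mR := (measurableTypeR R).

Definition ktail n (k : 'cV[int]_n.+1) : 'cV[int]_n := \col_i k (lift ord0 i) 0.

Lemma phase_tcons n (k : 'cV[int]_n.+1) (x : R) (t : n.-tuple mR) :
  phase k (tcol (tcons (x, t))) = (k 0 0)%:~R * x * (pi *+ 2) + phase (ktail k) (tcol t).
Proof.
rewrite /phase big_ord_recl; congr (_ + _); first by rewrite mxE (tnth_nth x).
by apply: eq_bigr => i _; rewrite !mxE tnthS.
Qed.

(** The first coordinate is integrated for fixed others: a nonzero first frequency gives 1 at once,
    a zero one leaves the same integral for the remaining frequencies. *)
Lemma integral_cube_wave d (k : 'cV[int]_d) (th : R) :
  (\int[cube_measure R d]_t (1 + wave k th (tcol t))%:E = (1 + (k == 0)%:R * cos th)%:E)%E.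
Proof.
elim: d k th => [|n IH] k th.
  have -> : k = 0 by apply/colP => -[].
  rewrite eqxx mul1r /= integral_dirac//; last first.
    apply/measurable_EFinP/measurable_funD; first exact: measurable_cst.
    exact: measurable_wave.
  by rewrite diracT mul1e /wave /phase big_ord0 add0r.
have mw : measurable_fun setT (fun t : n.+1.-tuple mR => (1 + wave k th (tcol t))%:E).
  apply/measurable_EFinP/measurable_funD; first exact: measurable_cst.
  exact: measurable_wave.
have w0 (t : n.+1.-tuple mR) : (0 <= (1 + wave k th (tcol t))%:E)%E.
  by rewrite lee_fin -lerBlDl sub0r cos_geN1.
rewrite /= ge0_integral_pushforward//.
rewrite (@fubini_tonelli2 _ _ _ _ _ _ _ _ (measurableT_comp mw (@measurable_tcons R n))); last first.
  by move=> z; exact: w0.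
rewrite /fubini_G /=.
have [k0|k0] := eqVneq (k 0 0) 0.
  have kE : (k == 0) = (ktail k == 0).
    apply/eqP/eqP => [->|tk]; first by apply/colP => i; rewrite !mxE.
    apply/colP => i; rewrite mxE; case: (unliftP ord0 i) => [j ->|->//].
    by have := congr1 (fun m : 'cV[int]_n => m j 0) tk; rewrite !mxE.
  rewrite kE -IH; apply: eq_integral => t _.
  rewrite (eq_integral (cst (1 + wave (ktail k) th (tcol t))%:E)).
    exact: (integral_cst_prob (uniform_prob (@ltr01 R))).
  by move=> x _; rewrite /wave phase_tcons k0 !mul0r add0r.
have -> : (k == 0) = false.
  by apply/negP => /eqP kE; move: k0; rewrite kE mxE eqxx.
rewrite mul0r addr0 (eq_integral (cst 1%E)).
  exact: (integral_cst_prob (cube_measure R n)).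
move=> t _ /=; rewrite -[RHS](uniform_wave (phase (ktail k) (tcol t) + th) k0).
by apply: eq_integral => x _; rewrite /wave phase_tcons addrA.
Qed.

Lemma mean_wave d (k : 'cV[int]_d) (th : R) :
  mean (cube_measure R d) (fun t => wave k th (tcol t)) = (k == 0)%:R * cos th.
Proof.
have h : mean (cube_measure R d) (fun t => 1 + wave k th (tcol t)) = 1 + (k == 0)%:R * cos th.
  by rewrite /mean /Rintegral integral_cube_wave.
rewrite (@meanD _ _ _ _ (fun=> 1)) in h; last 2 first.
- exact: bmeas_cst.
- exact: bmeas_wave.
by move: h; rewrite mean_cst => /addrI.
Qed.

Lemma measurable_box d (l r : 'I_d -> R) :
  measurable [set t : d.-tuple mR | forall i, l i < tnth t i < r i].
Proof.
rewrite (_ : [set t | _] = \big[setI/setT]_(i < d)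
    [set t | tnth t i \in `](l i), (r i)[]); last first.
  rewrite -bigcap_seq; apply/seteqP; split => t /= => [Bt i _ /=|Bt i].
    by rewrite in_itv; exact: Bt.
  by have := Bt i; rewrite /= in_itv; apply; rewrite /= mem_index_enum.
apply: bigsetI_measurable => i _.
have := @measurable_tnth _ mR d i measurableT `](l i), (r i)[%classic (measurable_itv _).
by rewrite setTI; exact.
Qed.

Lemma cube_box_gt0 d (l r : 'I_d -> R) : (forall i, 0 <= l i /\ l i < r i /\ r i <= 1) ->
  (0 < cube_measure R d [set t | forall i, (l i < tnth t i < r i)%R])%E.
Proof.
elim: d l r => [|n IH] l r lr.
  by rewrite /= diracE mem_set// => -[].
pose I : set mR := `]l ord0, r ord0[%classic.
pose B := [set t : n.-tuple mR | forall i : 'I_n, l (lift ord0 i) < tnth t i < r (lift ord0 i)].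
have mI : measurable I by exact: measurable_itv.
have mB : measurable B by exact: measurable_box.
have -> : cube_measure R n.+1 [set t | forall i, l i < tnth t i < r i] =
    (uniform_prob (@ltr01 R) \x cube_measure R n)%E (I `*` B).
  rewrite /= /distribution /pushforward; congr (_ _).
  apply/seteqP; split => [[x t] /= h|[x t] /= [h1 h2] i].
    split; first by have := h ord0; rewrite /I /= in_itv.
    by move=> i; have := h (lift ord0 i); rewrite tnthS.
  case: (unliftP ord0 i) => [j ->|->]; first by rewrite tnthS; exact: h2.
  by move: h1; rewrite /I /= in_itv.
rewrite product_measure1E// mule_gt0//; last by apply: IH => i; exact: lr.
have [l0 [lr0 r1]] := lr ord0.
suff : (0 < uniform_prob (@ltr01 R) I)%E by [].
rewrite /uniform_prob integral_uniform_pdf (_ : I `&` `[0, 1]%classic = I); last first.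
  apply/seteqP; split => [x []//|x Ix]; split => //; move: Ix.
  rewrite /I /= !in_itv /= => /andP[h1 h2].
  by rewrite (le_trans l0 (ltW h1)) (le_trans (ltW h2) r1).
rewrite (eq_integral (cst 1%E)).
  rewrite integral_cst// mul1e.
  suff : (0 < (lebesgue_measure : set R -> \bar R) [set` `]l ord0, r ord0[])%E by [].
  by rewrite lebesgue_measure_itv /= lte_fin lr0 lte_fin subr_gt0.
move=> x /set_mem; rewrite /I /= in_itv /= => /andP[h1 h2].
by rewrite /uniform_pdf (le_trans l0 (ltW h1)) (le_trans (ltW h2) r1) subr0 invr1.
Qed.

End CubeWaves.

Section RootOfUnity.

(** [X^n - 1] splits into factors [X - z] with [z^n = 1], and their product at [M] kills [u]. None
    of these [z] is an eigenvalue, so each factor is injective on rows and they can be stripped one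
    by one. *)
Lemma fixed_row_eq0 (C : closedFieldType) d (M : 'M[C]_d) (n : nat) (u : 'rV[C]_d) :
  (forall lam, eigenvalue M lam -> lam ^+ n != 1) -> (0 < n)%N ->
  iter n (fun w => w *m M) u = u -> u = 0.
Proof.
case: d M u => [M u _ _ _|d M u eig n0 fixu]; first by apply/rowP => -[].
have [r rE] := closed_field_poly_normal ('X^n - 1 : {poly C}).
have lc : lead_coef ('X^n - 1 : {poly C}) = 1 by apply/monicP; rewrite monicXnsubC.
rewrite lc scale1r in rE.
have rP z : z \in r -> z ^+ n = 1.
  move=> zr; have : root ('X^n - 1) z by rewrite rE root_prod_XsubC.
  by rewrite /root !hornerE subr_eq0 => /eqP.
have HE : horner_mx M ('X^n - 1) = \prod_(z <- r) (M - z%:M).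
  rewrite rE rmorph_prod; apply: eq_bigr => z _.
  by rewrite rmorphB /= horner_mx_X horner_mx_C.
have iterE m w : iter m (fun w => w *m M) w = w *m M ^+ m.
  by elim: m => [|m IH] /=; rewrite ?expr0 ?mulmx1// IH exprSr mulmxA.
have u0 : u *m \prod_(z <- r) (M - z%:M) = 0.
  rewrite -HE rmorphB /= rmorphXn /= horner_mx_X rmorph1 mulmxBr mulmx1.
  by rewrite -iterE fixu subrr.
elim: r rP u {fixu rE HE} u0 => [|z r IH] rP u.
  by rewrite big_nil mulmx1.
rewrite big_cons -[(_ * _)%R]/(_ *m _) mulmxA => /IH h.
have : u *m (M - z%:M) = 0 by apply: h => y yr; apply: rP; rewrite inE yr orbT.
rewrite mulmxBr => /eqP; rewrite subr_eq0 mul_mx_scalar => /eqP uz.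
apply/eqP; apply: contraT => un0.
have /eig : eigenvalue M z by apply/eigenvalueP; exists u.
by rewrite (rP z (mem_head _ _)) eqxx.
Qed.

Lemma transpose_iter_neq (R : realType) d (A : 'M[int]_d) (k : 'cV[int]_d) (n : nat) :
  (forall lam : R[i], eigenvalue (map_mx intr A) lam ->
     forall n : nat, (0 < n)%N -> lam ^+ n != 1) ->
  (0 < n)%N -> iter n (fun l => A^T *m l) k = k -> k = 0.
Proof.
move=> nonroot n0 fixk.
pose u : 'rV[R[i]]_d := map_mx intr k^T.
have uE m : map_mx intr (iter m (fun l => A^T *m l) k)^T =
    iter m (fun w => w *m map_mx intr A) u.
  by elim: m => //= m <-; rewrite trmx_mul trmxK map_mxM.
have : u = 0.
  apply: (@fixed_row_eq0 _ d (map_mx intr A) n); last by rewrite -uE fixk.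
    by move=> lam /nonroot; exact.
  exact: n0.
move=> u0; apply/colP => i; have := congr1 (fun w : 'rV_d => w 0 i) u0.
by rewrite !mxE => /eqP; rewrite intr_eq0 => /eqP.
Qed.

End RootOfUnity.

(** * Variance of time averages of trigonometric polynomials *)

Section Variance.
Variables (R : realType) (d : nat) (A : 'M[int]_d).
Hypothesis detA : \det A = 1.
Hypothesis nofix : forall (k : 'cV[int]_d) n, (0 < n)%N ->
  iter n (fun l => A^T *m l) k = k -> k = 0.
Local Notation V := 'cV[R]_d.
Local Notation AR := (map_mx intr A : 'M[R]_d).
Local Notation P := (cube_measure R d).
Local Notation mR := (measurableTypeR R).
Local Notation orb n v := (iter n (fun u => AR *m u) v).
Local Notation dual n k := (iter n (fun l => A^T *m l) k).

Lemma phase_mul k v : phase k (AR *m v) = phase (A^T *m k) v.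
Proof.
rewrite /phase; under eq_bigr do rewrite mxE mulr_sumr mulr_suml.
rewrite exchange_big; apply: eq_bigr => j _ /=.
rewrite mxE rmorph_sum /= !mulr_suml; apply: eq_bigr => i _.
by rewrite !mxE rmorphM /=; ring.
Qed.

Lemma phaseD (k l : 'cV[int]_d) (v : V) : phase (k + l) v = phase k v + phase l v.
Proof.
by rewrite /phase -big_split; apply: eq_bigr => i _ /=; rewrite mxE rmorphD /= !mulrDl.
Qed.

Lemma phaseN (k : 'cV[int]_d) (v : V) : phase (- k) v = - phase k v.
Proof.
by rewrite /phase -sumrN; apply: eq_bigr => i _ /=; rewrite mxE rmorphN /= !mulNr.
Qed.

Lemma wave_orb n k th v : wave k th (orb n v) = wave (dual n k) th v.
Proof.
elim: n k => //= n IH k; rewrite /wave phase_mul -/(wave _ _ _) IH.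
by rewrite -iterSr.
Qed.

Lemma waveM (k l : 'cV[int]_d) th th' (v : V) : wave k th v * wave l th' v =
  2^-1 * wave (k + l) (th + th') v + 2^-1 * wave (k - l) (th - th') v.
Proof.
rewrite /wave phaseD (phaseD k (- l)) phaseN.
set a := phase k v; set b := phase l v.
rewrite (_ : a + b + (th + th') = (a + th) + (b + th')); last by ring.
rewrite (_ : a - b + (th - th') = (a + th) - (b + th')); last by ring.
by set x := a + th; set y := b + th'; rewrite (cosD x y) (cosB x y); field.
Qed.

Let dual_inj n (k : 'cV[int]_d) : dual n k = 0 -> k = 0.
Proof.
elim: n => //= n IH h; apply: IH.
rewrite -[LHS]mul1mx -(_ : \adj A^T *m A^T = 1%:M) -?mulmxA ?h ?mulmx0//.
by rewrite mul_adj_mx det_tr detA.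
Qed.

Let dualB n (k l : 'cV[int]_d) : dual n (k - l) = dual n k - dual n l.
Proof. by elim: n => //= n ->; rewrite mulmxBr. Qed.

Let dualN n (k : 'cV[int]_d) : dual n (- k) = - dual n k.
Proof. by rewrite -[- k]sub0r dualB -[dual n 0]subr0 -{1}[0](subrr (0 : 'cV[int]_d)) dualB subr0 subrr sub0r. Qed.

Let dual_eq n m (k : 'cV[int]_d) : k != 0 -> dual n k = dual m k -> n = m.
Proof.
move=> k0; wlog nm : n m / (n <= m)%N => [wl h|].
  by have [/wl->//|/ltnW/wl->] := leqP n m.
rewrite -{1}(subnKC nm) iterD => h.
have : dual (m - n) k - k = 0 by apply: (@dual_inj n); rewrite dualB h subrr.
move=> /eqP; rewrite subr_eq0 => /eqP e.
have [mn0|mn0] := posnP (m - n)%N; first by apply/eqP; rewrite eqn_leq nm -subn_eq0 mn0.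
by move: k0; rewrite (nofix mn0 e) eqxx.
Qed.

(** If the transpose sends [k] to [- k] in [m - n > 0] steps, twice as many steps fix [k]; and
    [m = n] gives [2 k = 0]. *)
Let dual_opp n m (k : 'cV[int]_d) : k != 0 -> dual n k + dual m k != 0.
Proof.
move=> k0; wlog nm : n m / (n <= m)%N => [wl|].
  by have [/wl//|/ltnW/wl] := leqP n m; rewrite addrC.
apply: contraNneq k0; rewrite -{1}(subnKC nm) iterD.
have [->|mn0] := posnP (m - n)%N.
  move=> /= h; apply/eqP; apply: (@dual_inj n); apply/colP => i.
  have := congr1 (fun w : 'cV[int]_d => w i 0) h.
  by rewrite !mxE => /eqP; rewrite -mulr2n mulrn_eq0 => /eqP.
move=> h; apply/eqP.
have e : dual (m - n) k = - k.
  apply/eqP; rewrite -subr_eq0 opprK; apply/eqP; apply: (@dual_inj n).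
  by rewrite -{2}[k]opprK dualB dualN opprK addrC.
apply: (@nofix _ ((m - n) + (m - n))%N); first by rewrite addn_gt0 mn0.
by rewrite iterD e dualN e opprK.
Qed.

(** The variance bound is uniform in the starting time [N], since it is applied to orbits restricted
    only from some time on. *)
Definition time_mean (g : V -> R) (c : R) :=
  [/\ forall n, bmeas (fun t : d.-tuple mR => g (orb n (tcol t))),
    mean P (fun t => g (tcol t)) = c &
    exists2 C : R, 0 <= C & forall N M : nat,
      mean P (fun t => (\sum_(n < M) g (orb (N + n) (tcol t)) - M%:R * c) ^+ 2) <= C * M%:R].

(** The square is expanded by the product formula. For [k != 0], sums of two frequencies along the
    orbit of [k] never vanish and differences vanish only on the diagonal, so each of the [M]
    diagonal terms contributes 1/2 and all others 0. *)
Lemma time_mean_wave (k : 'cV[int]_d) th : time_mean (wave k th) ((k == 0)%:R * cos th).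
Proof.
split; [| |exists 2^-1 => // N M].
- by move=> n; under eq_fun do rewrite wave_orb; exact: bmeas_wave.
- exact: mean_wave.
have [->|k0] := eqVneq k 0.
  have w0 v : wave 0 th v = cos th.
    by rewrite /wave /phase big1 ?add0r// => i _; rewrite mxE !mul0r.
  have -> : (fun t : d.-tuple mR => (\sum_(n < M) wave 0 th (orb (N + n) (tcol t)) -
      M%:R * (true%:R * cos th)) ^+ 2) = fun=> 0.
    apply/funext => t; under eq_bigr do rewrite w0.
    by rewrite sumr_const card_ord mul1r mulr_natl subrr expr0n.
  by rewrite mean_cst mulr_ge0.
rewrite mul0r.
have -> : (fun t : d.-tuple mR => (\sum_(n < M) wave k th (orb (N + n) (tcol t)) - M%:R * 0) ^+ 2) =
  fun t => \sum_(n < M) \sum_(m < M)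
    (2^-1 * wave (dual (N + n) k + dual (N + m) k) (th + th) (tcol t) +
     2^-1 * wave (dual (N + n) k - dual (N + m) k) (th - th) (tcol t)).
  apply/funext => t; rewrite mulr0 subr0 expr2 mulr_suml; apply: eq_bigr => n _.
  by rewrite mulr_sumr; apply: eq_bigr => m _; rewrite !wave_orb waveM.
have bw l t : bmeas (fun t' : d.-tuple mR => 2^-1 * wave l t (tcol t')).
  by apply: bmeasM; [exact: bmeas_cst|exact: bmeas_wave].
rewrite mean_sum; last by move=> n; apply: bmeas_sum => m; exact: bmeasD.
rewrite (eq_bigr (fun=> 2^-1)) => [|n _].
  by rewrite sumr_const card_ord -[leLHS]mulr_natr.
rewrite mean_sum; last by move=> m; exact: bmeasD.
rewrite (bigD1 n)//= big1 => [|m mn].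
  rewrite meanD// !meanZ; try exact: bmeas_wave.
  by rewrite !mean_wave (negbTE (dual_opp _ _ k0)) !subrr eqxx mul0r cos0 mulr0 add0r addr0 !mulr1.
rewrite meanD// !meanZ; try exact: bmeas_wave.
rewrite !mean_wave (negbTE (dual_opp _ _ k0)) mul0r mulr0 add0r.
case: eqP => [/eqP|_]; last by rewrite mul0r mulr0.
rewrite subr_eq0 => /eqP/(dual_eq k0)/addnI nm.
by move: mn; rewrite eq_sym -val_eqE /= nm eqxx.
Qed.

Lemma time_meanZ (a : R) g c : time_mean g c -> time_mean (fun v => a * g v) (a * c).
Proof.
move=> [gb gc [C C0 gv]]; split.
- by move=> n; apply: bmeasM; [exact: bmeas_cst|exact: gb].
- by rewrite meanZ ?gc//; exact: (gb 0%N).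
exists (a ^+ 2 * C) => [|N M]; first by rewrite mulr_ge0 ?sqr_ge0.
have -> : (fun t : d.-tuple mR => (\sum_(n < M) a * g (orb (N + n) (tcol t)) - M%:R * (a * c)) ^+ 2) =
    fun t => a ^+ 2 * ((\sum_(n < M) g (orb (N + n) (tcol t)) - M%:R * c) ^+ 2).
  by apply/funext => t; rewrite -mulr_sumr; ring.
rewrite meanZ; first by rewrite -mulrA ler_wpM2l ?sqr_ge0.
under eq_fun do rewrite expr2.
by apply: bmeasM; (apply: bmeasD; [apply: bmeas_sum => n; exact: gb|exact: bmeas_cst]).
Qed.

Lemma time_meanD g g' c c' : time_mean g c -> time_mean g' c' ->
  time_mean (fun v => g v + g' v) (c + c').
Proof.
move=> [gb gc [C C0 gv]] [gb' gc' [C' C0' gv']]; split.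
- by move=> n; exact: bmeasD.
- by rewrite meanD ?gc ?gc'//; [exact: (gb 0%N)|exact: (gb' 0%N)].
exists (2 * (C + C')) => [|N M]; first by rewrite mulr_ge0 ?addr_ge0.
have bsq (h : V -> R) e : (forall n, bmeas (fun t : d.-tuple mR => h (orb n (tcol t)))) ->
    bmeas (fun t : d.-tuple mR => (\sum_(n < M) h (orb (N + n) (tcol t)) - M%:R * e) ^+ 2).
  move=> hb; under eq_fun do rewrite expr2.
  by apply: bmeasM; (apply: bmeasD; [apply: bmeas_sum => n; exact: hb|exact: bmeas_cst]).
have b1 := bsq g c gb; have b2 := bsq g' c' gb'.
apply: (@le_trans _ _ (mean P (fun t => 2 *
   ((\sum_(n < M) g (orb (N + n) (tcol t)) - M%:R * c) ^+ 2 +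
   (\sum_(n < M) g' (orb (N + n) (tcol t)) - M%:R * c') ^+ 2)))).
  apply: le_mean.
  - by apply: (bsq (fun v => g v + g' v) (c + c')) => n; exact: bmeasD.
  - by apply: bmeasM; [exact: bmeas_cst|exact: bmeasD].
  move=> t; rewrite big_split /=.
  set S := \sum_(n < M) g _; set S' := \sum_(n < M) g' _; rewrite -subr_ge0.
  rewrite (_ : _ - _ = ((S - M%:R * c) - (S' - M%:R * c')) ^+ 2) ?sqr_ge0//.
  by ring.
rewrite meanZ; last exact: bmeasD.
by rewrite meanD// -mulrA ler_pM2l// mulrDl lerD.
Qed.

Definition trig_poly (g : V -> R) := exists s : seq (R * 'cV[int]_d * R),
  forall v, g v = \sum_(x <- s) x.1.1 * wave x.1.2 x.2 v.

Lemma trig_poly_wave (a : R) k th : trig_poly (fun v => a * wave k th v).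
Proof. by exists [:: (a, k, th)] => v; rewrite big_seq1. Qed.

Lemma trig_polyD g g' : trig_poly g -> trig_poly g' -> trig_poly (fun v => g v + g' v).
Proof. by move=> [s sE] [s' sE']; exists (s ++ s') => v; rewrite big_cat sE sE'. Qed.

Lemma trig_polyM g g' : trig_poly g -> trig_poly g' -> trig_poly (fun v => g v * g' v).
Proof.
move=> [s sE] [s' sE'].
have H : forall v, g v * g' v = \sum_(x <- s) \sum_(y <- s') x.1.1 * wave x.1.2 x.2 v * (y.1.1 * wave y.1.2 y.2 v).
  move=> v; rewrite sE sE' mulr_suml; apply: eq_bigr => x _.
  by rewrite mulr_sumr.
suff [u uE] : trig_poly (fun v => \sum_(x <- s) \sum_(y <- s')
    x.1.1 * wave x.1.2 x.2 v * (y.1.1 * wave y.1.2 y.2 v)).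
  by exists u => v; rewrite H uE.
have sum_closed (I : Type) (r : seq I) (h : I -> V -> R) : (forall i, trig_poly (h i)) ->
    trig_poly (fun v => \sum_(i <- r) h i v).
  move=> hb; elim: r => [|i r IH]; first by exists [::] => v; rewrite !big_nil.
  have [w wE] := trig_polyD (hb i) IH.
  by exists w => v; rewrite big_cons wE.
apply: (sum_closed) => x; apply: (sum_closed) => y.
have [w wE] := trig_polyD
  (trig_poly_wave (x.1.1 * y.1.1 * 2^-1) (x.1.2 + y.1.2) (x.2 + y.2))
  (trig_poly_wave (x.1.1 * y.1.1 * 2^-1) (x.1.2 - y.1.2) (x.2 - y.2)).
exists w => v; rewrite -wE mulrACA waveM; ring.
Qed.

Lemma trig_poly_time_mean g : trig_poly g -> time_mean g (mean P (fun t => g (tcol t))).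
Proof.
move=> [s sE]; suff [c gc] : exists c, time_mean g c by have [_ ->] := gc.
have -> : g = fun v => \sum_(x <- s) x.1.1 * wave x.1.2 x.2 v by apply/funext.
elim: s {sE} => [|x s [c IH]].
  exists (0 * ((0 : 'cV[int]_d) == 0)%:R * cos 0).
  have := time_meanZ 0 (time_mean_wave 0 0); rewrite mulrA; congr time_mean.
  by apply/funext => v; rewrite big_nil mul0r.
eexists; under eq_fun do rewrite big_cons.
by apply: time_meanD IH; apply: time_meanZ; exact: time_mean_wave.
Qed.

End Variance.

Lemma continuous_prod (R : realType) (Z : topologicalType) (I : Type) (r : seq I)
    (g : I -> Z -> R) : (forall i, continuous (g i)) ->
  continuous (fun z => \prod_(i <- r) g i z).
Proof.
move=> gc z; apply: cvg_big => [|i _]; last exact: gc.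
by move=> p; apply: cvgM; [exact: cvg_fst|exact: cvg_snd].
Qed.

Lemma bmeas_trig_poly (R : realType) d (g : 'cV[R]_d -> R) :
  trig_poly g -> bmeas (fun t : d.-tuple (measurableTypeR R) => g (tcol t)).
Proof.
move=> [s sE]; under eq_fun do rewrite sE; apply: bmeas_sum => x.
by apply: bmeasM; [exact: bmeas_cst|exact: bmeas_wave].
Qed.

Section Kernel.
Variables (R : realType) (d : nat) (a : 'I_d -> R).
Local Notation V := 'cV[R]_d.

(* The powers of [cos_bump] are trigonometric polynomials whose mass concentrates on
   the translates of [a] by integer vectors. *)
Definition cos_bump_factor (x : R) : R := (1 + cos (x * (pi *+ 2))) / 2.

Definition cos_bump (v : V) : R := \prod_i cos_bump_factor (v i 0 - a i).

Lemma cos_bump_factor_itv x : 0 <= cos_bump_factor x <= 1.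
Proof. by have := cos_geN1 (x * (pi *+ 2)); have := cos_le1 (x * (pi *+ 2)); rewrite /cos_bump_factor; lra. Qed.

Lemma cos_bump_factorDz x (k : int) : cos_bump_factor (x + k%:~R) = cos_bump_factor x.
Proof. by rewrite /cos_bump_factor (mulrDl x) (cos_sinD2piz _ k).1. Qed.

Lemma cos_bump_factor_away (dl x : R) : 0 < dl -> dl <= 2^-1 ->
  (forall l : int, dl <= `|x + l%:~R|) -> cos_bump_factor x <= cos_bump_factor dl.
Proof.
(* [l] is minus an integer nearest to [x], so [|u| <= 1/2], the range on which the cosine of
   [2 * pi * |u|] decreases. *)
move=> dl0 dl2 far; pose l := - Num.floor (x + 2^-1).
pose u := x + l%:~R; have := far l; rewrite -/u => ul.
have u2 : `|u| <= 2^-1.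
  have /andP[h1 h2] := floor_itv (x + 2^-1).
  by rewrite ler_norml /u /l rmorphN /=; move: h1 h2; rewrite intrD1; lra.
rewrite -(cos_bump_factorDz x l) -/u ler_pM2r ?invr_gt0// lerD2l.
have -> : cos (u * (pi *+ 2)) = cos (`|u| * (pi *+ 2)).
  have p2 : 0 <= (pi *+ 2 : R) by rewrite mulrn_wge0// ltW// pi_gt0.
  by rewrite -{2}(ger0_norm p2) -normrM cos_norm.
have ran (y : R) : 0 <= y -> y <= 2^-1 -> y * (pi *+ 2) \in `[0, pi].
  move=> y0 y2; have p0 := pi_gt0 R.
  have -> : y * (pi *+ 2) = (y *+ 2) * pi by rewrite mulrnAr mulrnAl.
  have y1 : y *+ 2 <= 1 by rewrite -mulr_natr; move: y2; lra.
  rewrite in_itv /=; apply/andP; split; last by rewrite -[leRHS]mul1r ler_pM2r.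
  by apply: mulr_ge0; [exact: mulrn_wge0|rewrite ltW].
rewrite leNgt ltr_cos ?ran ?(ltW dl0)// -leNgt ler_pM2r//.
by rewrite pmulrn_lgt0// pi_gt0.
Qed.

Lemma cos_bump_factor_lt1 (dl : R) : 0 < dl -> dl <= 2^-1 -> cos_bump_factor dl < 1.
Proof.
move=> dl0 dl2; have p0 := pi_gt0 R.
rewrite /cos_bump_factor ltr_pdivrMr// mul1r -ltrBrDl (_ : 2 - 1 = 1); last by ring.
rewrite -cos0 ltr_cos.
- by rewrite mulr_gt0// pmulrn_lgt0.
- by rewrite in_itv /= lexx ltW.
have -> : dl * (pi *+ 2) = (dl *+ 2) * pi by rewrite mulrnAr mulrnAl.
have d1 : dl *+ 2 <= 1 by rewrite -mulr_natr; move: dl2; lra.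
rewrite in_itv /=; apply/andP; split; last by rewrite -[leRHS]mul1r ler_pM2r.
by apply: mulr_ge0; [apply: mulrn_wge0; exact: ltW|rewrite ltW].
Qed.

Lemma cos_bump_itv v : 0 <= cos_bump v <= 1.
Proof.
rewrite /cos_bump; apply/andP; split.
  by apply: prodr_ge0 => i _; case/andP: (cos_bump_factor_itv (v i 0 - a i)).
by apply: Num.Theory.prodr_ile1 => i _; exact: cos_bump_factor_itv.
Qed.

Lemma cos_bumpD (v : V) k : cos_bump (v + map_mx intr k) = cos_bump v.
Proof. by apply: eq_bigr => i _; rewrite !mxE addrAC cos_bump_factorDz. Qed.

Lemma cos_bump_center (v : V) : (forall i, exists k : int, v i 0 = a i + k%:~R) -> cos_bump v = 1.
Proof.
move=> va; apply: big1 => i _; have [k ->] := va i.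
rewrite addrAC subrr add0r -[_%:~R]add0r cos_bump_factorDz /cos_bump_factor mul0r cos0.
by rewrite divff.
Qed.

Lemma cos_bump_away (dl : R) (v : V) : 0 < dl -> dl <= 2^-1 ->
  ~ (exists k : 'cV[int]_d, forall i, `|v i 0 + (k i 0)%:~R - a i| < dl) ->
  cos_bump v <= cos_bump_factor dl.
Proof.
move=> dl0 dl2 nex.
have [i far] : exists i, forall l : int, dl <= `|v i 0 - a i + l%:~R|.
  apply: contrapT => ni; apply: nex.
  have H i : exists l : int, `|v i 0 - a i + l%:~R| < dl.
    apply: contrapT => nl; apply: ni; exists i => l.
    by rewrite leNgt; apply/negP => h; apply: nl; exists l.
  exists (\col_i projT1 (cid (H i))) => i; rewrite mxE.
  by case: (cid (H i)) => l /=; rewrite addrAC.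
rewrite /cos_bump (bigD1 i)//=; apply: le_trans (cos_bump_factor_away dl0 dl2 far).
apply: ler_piMr; first by case/andP: (cos_bump_factor_itv (v i 0 - a i)).
by apply: Num.Theory.prodr_ile1 => j _; exact: cos_bump_factor_itv.
Qed.

Lemma cos_bump_trig_poly m : trig_poly (fun v => cos_bump v ^+ m).
Proof.
have one : trig_poly (fun _ : V => 1).
  have [s sE] := @trig_poly_wave R d 1 0 0; exists s => v; rewrite -sE mul1r /wave /phase.
  by rewrite big1 ?addr0 ?cos0// => i _; rewrite mxE !mul0r.
have fac i : trig_poly (fun v : V => cos_bump_factor (v i 0 - a i)).
  have [s sE] := trig_polyD (@trig_poly_wave R d 2^-1 0 0)
    (@trig_poly_wave R d 2^-1 (delta_mx i 0) (- (a i * (pi *+ 2)))).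
  exists s => v; rewrite -sE /wave /phase.
  rewrite [X in cos (X + 0)]big1 => [|j _]; last by rewrite mxE !mul0r.
  rewrite (bigD1 i)//= big1 => [|j ji]; last by rewrite mxE (negbTE ji) !mul0r.
  by rewrite mxE !eqxx mul1r !addr0 cos0 /cos_bump_factor mulrBl; field.
have qp : trig_poly cos_bump.
  rewrite /cos_bump; elim: (index_enum _) => [|i r [s sE]].
    by have [s sE] := one; exists s => v; rewrite big_nil; exact: sE.
  have [s' sE'] := trig_polyM (fac i) (ex_intro _ s sE).
  by exists s' => v; rewrite big_cons sE'.
elim: m => [|m [s sE]]; first exact: one.
have [s' sE'] := trig_polyM qp (ex_intro _ s sE).
by exists s' => v; rewrite exprS sE'.
Qed.

Lemma cos_bump_continuous : continuous cos_bump.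
Proof.
apply: continuous_prod => i v.
apply: (@continuous_comp V R R (fun v : V => v i 0) (fun x => cos_bump_factor (x - a i))).
  exact: coord_continuous.
apply: cvgM; last exact: cvg_cst.
apply: cvgD; first exact: cvg_cst.
apply: (@continuous_comp R R R (fun x => (x - a i) * (pi *+ 2)) (@cos R)); last exact: continuous_cos.
apply: cvgM; last exact: cvg_cst.
by apply: cvgB; [exact: cvg_id|exact: cvg_cst].
Qed.

End Kernel.

Section AlmostEveryPoint.
Variables (R : realType) (d : nat).
Local Notation V := 'cV[R]_d.
Local Notation P := (cube_measure R d).
Local Notation mR := (measurableTypeR R).

(** Choose [t] strictly between [s] and 1. The bump exceeds [t] on a box of positive measure, so the
    mean of its power is at least [t ^ m] times that measure, and [(s / t) ^ m] eventually drops
    below it. *)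
Lemma cos_bump_pow_mean (a : 'I_d -> R) (s : R) : 0 <= s < 1 ->
  exists m, s ^+ m < mean P (fun t => cos_bump a (tcol t) ^+ m).
Proof.
move=> /andP[s0 s1]; pose t := (1 + s) / 2.
have [st t1] : s < t /\ t < 1 by rewrite /t; lra.
have t0 : 0 < t by exact: le_lt_trans st.
(* The representative of [a] in the half-open unit cube. The box starts at [v] and extends to larger
   coordinates, capped at 1, so that it stays inside the cube. *)
pose v : V := \col_i (a i - (Num.floor (a i))%:~R).
have [Q vQ QU] : nbhs v [set w | t < cos_bump a w].
  apply: (@cos_bump_continuous R d a v [set x | t < x]).
  rewrite /= (_ : cos_bump a v = 1); first by exact: lt_nbhsr.
  by apply: cos_bump_center => i; exists (- Num.floor (a i)); rewrite mxE rmorphN.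
have Qe i : exists2 e : R, 0 < e & ball (v i 0) e `<=` Q i 0.
  by have /nbhs_ballP[e /= e0 eQ] := vQ i 0; exists e.
pose e i := projT1 (cid2 (Qe i)).
have e0 i : 0 < e i by rewrite /e; case: cid2.
have eQ i : ball (v i 0) (e i) `<=` Q i 0 by rewrite /e; case: cid2.
pose r i := Num.min (v i 0 + e i) 1.
have lr i : 0 <= v i 0 /\ v i 0 < r i /\ r i <= 1.
  have /andP[f1 f2] := floor_itv (a i); rewrite intrD1 in f2.
  rewrite /r mxE subr_ge0 f1 ge_min lexx orbT lt_min ltrDl e0.
  by rewrite ltrBlDl; split.
pose B := [set u : d.-tuple mR | forall i, v i 0 < tnth u i < r i].
have mB : measurable B by exact: measurable_box.
have Bt u : B u -> t < cos_bump a (tcol u).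
  move=> Bu; apply: QU => i j; rewrite ord1; apply: eQ.
  have /andP[h1] := Bu i; rewrite /r lt_min => /andP[h2 _].
  rewrite /ball /= [tcol u i 0]mxE ltr_distlC h2 andbT.
  by apply: lt_trans h1; rewrite ltrBlDr ltrDl.
have k0 : 0 < fine (P B).
  apply: fine_gt0; rewrite (@cube_box_gt0 R d _ _ lr) /=.
  by apply: le_lt_trans (probability_le1 P mB) _; rewrite ltry.
have [m mP] : exists m, (s / t) ^+ m < fine (P B).
  have st1 : `|s / t| < 1.
    by rewrite ger0_norm ?(divr_ge0 s0 (ltW t0))// ltr_pdivrMr// mul1r.
  have /cvgrPdist_lt/(_ _ k0)[m _ h] := cvg_expr st1; exists m.
  have := h m (leqnn _); rewrite sub0r normrN; apply: le_lt_trans.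
  exact: ler_norm.
exists m; rewrite expr_div_n ltr_pdivrMr ?exprn_gt0// mulrC in mP.
apply: (lt_le_trans mP).
have bB : bmeas (fun u => t ^+ m * \1_B u).
  by apply: bmeasM; [exact: bmeas_cst|exact: bmeas_indic].
rewrite -mean_indic// -meanZ; last exact: bmeas_indic.
apply: le_mean => //; first exact: (bmeas_trig_poly (cos_bump_trig_poly a m)).
move=> u; rewrite indicE; case: (boolP (u \in B)) => [/set_mem/Bt tb|_].
  by rewrite mulr1 lerXn2r ?nnegrE ?(ltW t0)// ?(ltW tb)// (le_trans (ltW t0) (ltW tb)).
by rewrite mulr0 exprn_ge0//; case/andP: (cos_bump_itv a (tcol u)).
Qed.

Variables (A : 'M[int]_d).
Hypothesis detA : \det A = 1.
Hypothesis nonroot : forall lam : R[i], eigenvalue (map_mx intr A) lam ->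
  forall n : nat, (0 < n)%N -> lam ^+ n != 1.
Local Notation AR := (map_mx intr A : 'M[R]_d).
Local Notation orb n v := (iter n (fun u => AR *m u) v).
Local Notation T := (toral_aut R detA).

Let iter_torus_pi n (v : V) : iter n T (torus_pi v) = torus_pi (orb n v).
Proof. by elim: n => //= n ->; rewrite /= torus_map_pi. Qed.

Definition avoids (a : 'I_d -> R) (dl : R) (N : nat) (v : V) := forall n, (N <= n)%N ->
  ~ exists k : 'cV[int]_d, forall i, `|orb n v i 0 + (k i 0)%:~R - a i| < dl.

(** Along an avoiding orbit each term of the time average of [cos_bump ^ m] is at most [s ^ m],
    strictly below the mean [c]. Chebyshev's inequality against a variance of order [M] gives
    [M * (c - s ^ m)^2 * p <= C] for all [M], hence [p = 0]. *)
Lemma avoids_negligible a dl N : 0 < dl -> dl <= 2^-1 ->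
  (torus_lebesgue R d).-negligible [set w : borel (torus R d) | avoids a dl N (repr w)].
Proof.
move=> dl0 dl2; pose s := cos_bump_factor dl.
have s01 : 0 <= s < 1.
  by rewrite cos_bump_factor_lt1// andbT; case/andP: (cos_bump_factor_itv dl).
have [m mP] := cos_bump_pow_mean a s01.
set c := mean _ _ in mP.
have hE (v : V) : cos_bump a (repr (torus_pi v)) = cos_bump a v.
  have [k {2}->] := (torus_piP (repr (torus_pi v)) v).1 (torus_pi_repr _).
  by rewrite cos_bumpD.
pose h (w : torus R d) : R := cos_bump a (repr w).
have hc : continuous h.
  apply/quotient_continuous.
  rewrite (_ : _ \o _ = cos_bump a); last by apply/funext => v; exact: hE.
  exact: cos_bump_continuous.
have hnE n v : h (iter n T (torus_pi v)) = cos_bump a (orb n v).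
  by rewrite iter_torus_pi /h hE.
(* The avoiding points are enclosed in an intersection of closed sets, which is Borel. *)
pose B : set (torus R d) := \bigcap_(n in [set n | (N <= n)%N])
  ((fun w => h (iter n T w) ^+ m) @^-1` [set x | x <= s ^+ m]).
have mB : measurable (B : set (borel (torus R d))).
  rewrite -[B]setCK; apply: measurableC; apply: sub_sigma_algebra.
  apply: closed_openC; apply: closed_bigI => n _.
  apply: ((continuous_closedP (fun w => h (iter n T w) ^+ m)).1 _ [set x | x <= s ^+ m]); last exact: closed_le.
  move=> w; apply: (@continuous_comp _ R R (fun w => h (iter n T w)) (fun x => x ^+ m)); last exact: exprn_continuous.
  apply: (@continuous_comp _ _ R (iter n T) h); last exact: hc.
  elim: n {hnE} w => [w|n IH w]; first exact: cvg_id.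
  by apply: (@continuous_comp _ _ _ (iter n T) T); [exact: IH|exact: hfun_continuous].
have c0 : 0 < (c - s ^+ m) ^+ 2 by rewrite exprn_gt0// subr_gt0.
exists B; split => //.
  have mB' : measurable (@cube_proj R d @^-1` B).
    by rewrite -[X in measurable X]setTI; exact: measurable_cube_proj.
  suff B0 : fine (P (@cube_proj R d @^-1` B)) = 0.
    by rewrite /torus_lebesgue /= /distribution /pushforward -[LHS]fineK ?B0//; exact: fin_num_measure.
  have [gb gm [C C0 gv]] := trig_poly_time_mean detA (fun k n => @transpose_iter_neq R d A k n nonroot)
    (cos_bump_trig_poly a m).
  set p := fine _; have p0 : 0 <= p by exact: fine_ge0.
  have le M : M%:R * ((c - s ^+ m) ^+ 2 * p) <= C.
    case: M => [|M]; first by rewrite mul0r.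
    rewrite -(ler_pM2l (ltr0Sn R M)) [leRHS]mulrC; apply: le_trans (gv N M.+1).
    rewrite [leLHS](_ : _ = (M.+1%:R * (c - s ^+ m)) ^+ 2 * p); last first.
      by rewrite (exprMn 2 M.+1%:R) [M.+1%:R ^+ 2]expr2 !mulrA.
    apply: chebyshev_sq => //.
      by apply: bmeasD; [apply: bmeas_sum => n; exact: gb|exact: bmeas_cst].
    move=> t Bt.
    have sle : \sum_(n < M.+1) cos_bump a (orb (N + n) (tcol t)) ^+ m <= M.+1%:R * s ^+ m.
      rewrite mulr_natl -[M.+1 in leRHS]card_ord -sumr_const; apply: ler_sum => n _.
      have := Bt (N + n)%N (leq_addr _ _).
      by rewrite /= -[cube_proj t]/(torus_pi (tcol t)) hnE.
    have ge0 : 0 <= M.+1%:R * (c - s ^+ m) by rewrite mulr_ge0// subr_ge0 ltW.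
    have dle : M.+1%:R * (c - s ^+ m) <=
        M.+1%:R * c - \sum_(n < M.+1) cos_bump a (orb (N + n) (tcol t)) ^+ m.
      by rewrite mulrBr lerD2l lerN2.
    by rewrite -/c -[leRHS]sqrrN opprB lerXn2r ?nnegrE// (le_trans ge0 dle).
  apply/eqP; rewrite eq_le p0 andbT leNgt; apply/negP => p1.
  have e0 : 0 < (c - s ^+ m) ^+ 2 * p by rewrite mulr_gt0.
  have := le (Num.truncn (C / ((c - s ^+ m) ^+ 2 * p))).+1.
  by rewrite -ler_pdivlMr// leNgt truncnS_gt.
move=> w /= aw n /= Nn; rewrite -[w]torus_pi_repr hnE.
have [b0 b1] := andP (cos_bump_itv a (orb n (repr w))).
apply: lerXn2r; rewrite ?nnegrE//; first by case/andP: s01.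
by apply: cos_bump_away => //; exact: aw.
Qed.

Lemma ae_recurrent :
  {ae torus_lebesgue R d, forall w : borel (torus R d), recurrent A (repr w : V)}.
Proof.
(* Rational centres, radii [1 / (j + 2)] and starting times form a countable family; the offset 2
   keeps the radius at most 1/2, as [avoids_negligible] requires. *)
pose F (q : {ffun 'I_d -> rat} * nat * nat) : set (borel (torus R d)) :=
  [set w | avoids (fun i => ratr (q.1.1 i)) (q.1.2.+2%:R^-1) q.2 (repr w)].
apply: (@negligibleS _ _ _ _ (\bigcup_n oapp F set0 (unpickle n))); last first.
  apply: negligible_bigcup => n; case: (unpickle n) => [q|] /=; last exact: (negligible_set0 (torus_lebesgue R d)).
  apply: avoids_negligible; first by rewrite invr_gt0.
  by rewrite lef_pV2 ?posrE// ler_nat.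
move=> w /= nrec; apply: contrapT => nF; apply: nrec => U oU [v Uv] Up N.
apply: contrapT => nU.
have /nbhs_ballP[e /= e0 eU] : nbhs v U by exact: open_nbhs_nbhs.
have e20 : 0 < e / 2 by rewrite divr_gt0.
have [j jP] : exists j : nat, j.+2%:R^-1 < e / 2.
  exists (Num.truncn (e / 2)^-1); rewrite invf_plt ?posrE//.
  by apply: lt_trans (truncnS_gt _) _; rewrite ltr_nat.
have tri (x y z c : R) : c < e / 2 -> z \in `](x - e / 2), (x + e / 2)[ ->
    `|y - z| < c -> `|x - y| < e.
  rewrite in_itv /= !ltr_norml => h1 /andP[h2 h3] /andP[h4 h5].
  by apply/andP; split; move: h1 h2 h3 h4 h5; lra.
have Q i : exists q : rat, ratr q \in `](v i 0 - e / 2), (v i 0 + e / 2)[.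
  by apply: rat_in_itvoo; rewrite ltrBlDr -addrA ltrDl addr_gt0.
pose q : {ffun 'I_d -> rat} := [ffun i => projT1 (cid (Q i))].
apply: nF; exists (pickle (q, j, N)) => //.
rewrite pickleK /= /F /= => n Nn [k kP].
apply: nU; exists n => //.
rewrite -(addrK (map_mx intr k) (orb n (repr w))) -map_mxN.
apply: Up; apply: eU; split => // i0 i1; rewrite ord1 !mxE /ball /=.
have := kP i0; rewrite ffunE; case: cid => p /= pv kp.
exact: tri jP pv kp.
Qed.
End AlmostEveryPoint.

Theorem theorem8p6 (R : realType) (d : nat) (A : 'M[int]_d)
    (detA : \det A = 1)
    (nonroot : forall lam : R[i], eigenvalue (map_mx intr A) lam ->
       forall n : nat, (0 < n)%N -> lam ^+ n != 1) :
  schwartzman_range (toral_aut R detA) (torus_lebesgue R d) =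
    range (intr : int -> R) /\
  forall f : torus R d -> R, continuous f ->
    exists S : set R,
      is_ae_spectrum (toral_aut R detA) f (torus_lebesgue R d) S /\
      is_interval S.
Proof.
have A1 : ~~ eigenvalue (map_mx intr A : 'M[R[i]]_d) 1.
  by apply/negP => /nonroot/(_ 1%N isT); rewrite expr1 eqxx.
split=> [|f fc]; first exact: schwartzman_range_int.
have rec := ae_recurrent detA nonroot.
(* The set [spectral_set] does not refer to a point, so one recurrent point is enough to show that
   it is an interval; one exists because the torus has mass 1. *)
have [v0 v0rec] : exists v0 : 'cV[R]_d, recurrent A v0.
  apply: contrapT => nrec; have [B [mB B0 BP]] := rec.
  have BT : B = setT by apply/seteqP; split => // w _; apply: BP => h; apply: nrec; exists (repr w).
  move: B0; rewrite BT => B0; have := probability_setT (torus_lebesgue R d).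
  by rewrite B0 => /esym/eqP; rewrite onee_eq0.
exists (spectral_set detA f); split; last exact: spectral_set_interval v0rec.
split; first exact: spectral_set_compact.
have [B [mB B0 BP]] := rec; exists B; split => // w nw; apply: BP => h; apply: nw.
by rewrite -[w]torus_pi_repr; exact: spectrum_recurrent.
Qed.
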